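(* Let $N\subset M$ be a finite index unital inclusion of $\mathrm{II}_1$ factors and write $\lambda=[M:N]$. Then $$\mathcal G(N)=\lambda^2\,\mathcal G(\langle M,e_N\rangle).$$
   Context: For a $\mathrm{II}_1$ factor $M$ with its faithful normal trace $\tau$, $\tau(1)=1$, let $\mathcal P(M)$ be the collection of all finite sets of mutually orthogonal projections in $M$ which sum to $1$. For $x\in M$ and $P\in\mathcal P(M)$ put $\mathcal I(x;P)=\sum_{p,q\in P,\ pxq\neq 0}\tau(p)\tau(q)$. For a finite subset $X\subset M$ put $\mathcal I(X;P)=\sum_{x\in X}\mathcal I(x;P)$ and $\mathcal I(X)=\inf_{P\in\mathcal P(M)}\mathcal I(X;P)$. $W^*(X)$ denotes the von Neumann algebra generated by $X$ (not automatically assumed to contain the identity of $M$). The generator invariant is $\mathcal G(M)=\inf\{\mathcal I(X): X\subset M\text{ finite},\ W^*(X)=M\}$, with $\mathcal G(M)=\infty$ if $M$ is not finitely generated. For a unital inclusion $N\subset M$ of $\mathrm{II}_1$ factors, $e_N$ is the orthogonal projection of $L^2(M)$ onto $L^2(N)$, and the basic construction $\langle M,e_N\rangle$ is the von Neumann subalgebra of $\mathbb B(L^2(M))$ generated by $M$ and $e_N$. $N$ has finite index if $\langle M,e_N\rangle$ is a $\mathrm{II}_1$ factor, and then $[M:N]=\mathrm{Tr}(1)$, where $\mathrm{Tr}$ is the unique trace on $\langle M,e_N\rangle$ normalised by $\mathrm{Tr}(e_N)=1$. The invariant $\mathcal G(\langle M,e_N\rangle)$ is computed with respect to the normalised trace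 $[M:N]^{-1}\mathrm{Tr}$. *)

(* Defs.v *)
From HB Require Import structures.
From mathcomp Require Import all_boot all_order all_algebra.
From mathcomp Require Import finmap complex.
From mathcomp Require Import all_classical all_reals all_analysis.

Set Implicit Arguments.
Unset Strict Implicit.
Unset Printing Implicit Defensive.

Import Order.TTheory GRing.Theory Num.Theory.
Import numFieldNormedType.Exports.

Local Open Scope classical_set_scope.
Local Open Scope ring_scope.
Local Open Scope complex_scope.

(* The form is linear in the first variable, conjugate linear in the second. *)
Record hilbert (R : realType) := Hilbert {
  hilbert_car :> completeNormedModType R[i] ;
  hdot : {dot hilbert_car for Num.conj} ;
  hdotE : forall u : hilbert_car, hdot u u = `|u| ^+ 2 }.

Arguments hdot {R h}.

Section Operators.
Variables (R : realType) (H : hilbert R).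
Local Notation op := (H -> H).
Implicit Types (x y p q T : op) (M X : set op) (tau : op -> R[i]).
Implicit Types P : {fset op}.

(* B(H) as a set of functions; the vector space structure on H -> H is the
   pointwise one, the product is \o and the unit is idfun. *)
Definition bounded_op : set op := [set T | linear T /\ continuous T].

Definition is_adjoint x y := forall u v : H, hdot (x u) v = hdot u (y v).

(* Strongly closed *-subalgebra of B(H), not required to contain idfun.
   The topology of {ptws H -> H}, restricted to B(H), is the strong operator
   topology; pointwise limits of elements of M may be unbounded, hence the
   intersection with bounded_op. *)
Definition vN_algebra : set (set op) := [set M |
  [/\ M `<=` bounded_op,
      M 0 /\ (forall (c : R[i]) x y, M x -> M y -> M (c *: x + y)),
      (forall x y, M x -> M y -> M (x \o y)),
      (forall x, M x -> exists2 y, M y & is_adjoint x y) &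
      bounded_op `&` closure (M : set {ptws H -> H}) `<=` M]].

Definition W_star X : set op := smallest vN_algebra X.

(* Order on self-adjoint operators. The order of R[i] compares only complex
   numbers whose difference is real. *)
Definition op_le x y := forall u : H, hdot (x u) u <= hdot (y u) u.

Definition sa_part M : set op := [set x | M x /\ is_adjoint x x].

Definition is_op_sup M (D : set op) x :=
  [/\ sa_part M x, (forall d, D d -> op_le d x) &
      forall y, sa_part M y -> (forall d, D d -> op_le d y) -> op_le x y].

(* tau preserves suprema of bounded increasing nets. *)
Definition normal_on M tau := forall (D : set op) x,
  D !=set0 -> D `<=` sa_part M ->
  (forall d1 d2, D d1 -> D d2 -> exists d, [/\ D d, op_le d1 d & op_le d2 d]) ->
  is_op_sup M D x ->
  complex.Re (tau x) = sup [set complex.Re (tau d) | d in D].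

(* Faithful normal finite positive trace on M, not necessarily normalised.
   Values of tau outside M are irrelevant. *)
Definition is_trace M tau :=
  [/\ (forall (c : R[i]) x y, M x -> M y ->
         tau (c *: x + y) = c * tau x + tau y),
      (forall x y, M x -> M y -> tau (x \o y) = tau (y \o x)),
      (forall x y, M x -> is_adjoint x y -> 0 <= tau (y \o x)),
      (forall x y, M x -> is_adjoint x y -> tau (y \o x) = 0 -> x = 0) &
      normal_on M tau].

Definition is_tracial_state M tau := is_trace M tau /\ tau idfun = 1.

Definition finite_dimensional M := exists (n : nat) (b : 'I_n -> op),
  forall x, M x -> exists c : 'I_n -> R[i], x = \sum_(i < n) c i *: b i.

(* Since idfun is the unit of M, inclusions between two such M on the same H
   are unital. *)
Definition II1_factor M :=
  [/\ vN_algebra M, M idfun,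
      (forall x, M x -> (forall y, M y -> x \o y = y \o x) ->
         exists c : R[i], x = c *: (idfun : op)),
      ~ finite_dimensional M &
      exists tau, is_tracial_state M tau].

Definition is_projection p :=
  [/\ bounded_op p, p \o p = p & is_adjoint p p].

Definition proj_partitions M : set {fset op} := [set P : {fset op} |
  [/\ (forall p, p \in P -> M p /\ is_projection p),
      (forall p q, p \in P -> q \in P -> p != q -> p \o q = 0) &
      \sum_(p <- P) p = idfun]].

(* Traces of projections are real, so taking real parts loses nothing. *)
Definition calI1 tau x P : R :=
  \sum_(p <- P) \sum_(q <- P | p \o x \o q != 0)
    complex.Re (tau p) * complex.Re (tau q).

Definition calI_part tau (X : {fset op}) P : R := \sum_(x <- X) calI1 tau x P.

Definition calI M tau (X : {fset op}) : \bar R :=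
  ereal_inf [set (calI_part tau X P)%:E | P in proj_partitions M].

(* Equal to +oo when M is not finitely generated, as ereal_inf set0 = +oo. *)
Definition calG M tau : \bar R :=
  ereal_inf [set calI M tau X | X in
    [set X : {fset op} | [set` X] `<=` M /\ W_star [set` X] = M]].

(* Orthogonal projection onto the closed subspace S. *)
Definition is_orthogonal_projection_onto (S : set H) (e : op) :=
  forall u : H, S (e u) /\ forall v : H, S v -> hdot (u - e u) v = 0.

End Operators.

Arguments bounded_op {R H}.
Arguments vN_algebra {R H}.

Section BasicConstruction.
Variables (R : realType) (H K : hilbert R).
Implicit Types (M N : set (H -> H)) (tau : (H -> H) -> R[i]).
Implicit Types eta : (H -> H) -> K.

(* K is the Hilbert space completion of M for <x, y> = tau (y^* x), with
   canonical map eta; values of eta outside M are irrelevant. *)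
Definition is_L2 M tau eta :=
  [/\ (forall (c : R[i]) x y, M x -> M y ->
         eta (c *: x + y) = c *: eta x + eta y),
      (forall x y y', M x -> M y -> is_adjoint y y' ->
         hdot (eta x) (eta y) = tau (y' \o x)) &
      closure (eta @` M) = setT].

(* M acting on K by left multiplication. *)
Definition left_action M eta : set (K -> K) := [set T |
  bounded_op T /\ exists2 x, M x & forall y, M y -> T (eta y) = eta (x \o y)].

(* L^2(N) is the closure of N in L^2(M). *)
Definition is_Jones_projection N eta (e : K -> K) :=
  is_orthogonal_projection_onto (closure (eta @` N)) e.

Definition basic_construction M eta (e : K -> K) : set (K -> K) :=
  W_star (left_action M eta `|` [set e]).

End BasicConstruction.

(* Main.v *)
(* Both sides are compared through the corner e<M,e>e, where e = e_N.

   Amplification: for a factor Q with trace t and a projection e in Q, the least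
   cost of generating eQe equals that of generating Q, when both are measured with
   the unnormalised trace t. A projection is tiled by copies of a projection g of
   small trace up to a small remainder: w_i^* w_i = g, with the sum of the w_i w_i^*
   equal to the projection. Generators x adapted to a partition are cut into
   w_i^* x w_j; together with finitely many partial isometries, whose cost is
   O(t(g)), these generate the other corner with a cost that is larger by an
   arbitrarily small amount. Letting t(g) tend to 0 gives the equality, and passing
   to the normalised trace of Q gives the factor lambda^2.

   Identification of the corner: e<M,e>e is the image of N under n |-> L_n e. A
   corner element T is a strong-* limit on L^2(N) of operators L_(n_k). For the dense
   set of vectors d of H with |x d|^2 <= C tau(x^* x), the map S : x |-> x d extends to
   L^2(M); hence n_k d converges, and since T commutes with S^* S the limit is bounded
   by |T| |d|. This defines the element of N that represents T. Strong-* density on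
   both sides shows that generating sets correspond, and the two traces on N agree on
   projections by comparison. *)
Require Import Defs.
From HB Require Import structures.
From mathcomp Require Import all_boot all_order all_algebra.
From mathcomp Require Import finmap complex.
From mathcomp Require Import all_classical all_reals all_analysis.
From mathcomp Require Import ring lra.
Set Implicit Arguments.
Unset Strict Implicit.
Unset Printing Implicit Defensive.

Import Order.TTheory GRing.Theory Num.Theory.
Import numFieldNormedType.Exports.

Local Open Scope classical_set_scope.
Local Open Scope ring_scope.
Local Open Scope complex_scope.

(** * Positive semidefinite forms *)

(** The algebras [M] and [N] act on an arbitrary [H], the basic construction on [L2M], and nothing
    identifies the two representations. Vectors of [H] bounded by the trace bridge them: they carry
    a limit found in [L2M] back to an operator on [H]; conversely finitely many of them dominate the
    trace, so closeness at these vectors implies closeness in [L2M]. The approximating sequences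
    carry no bound in operator norm. Membership in an algebra is therefore deduced from convergence,
    together with adjoints, on a dense set of vectors only: the projection onto the closure of A xi
    in H^k commutes with the limit operator. Spectral tools are built from monotone limits: square
    roots from an increasing iteration, supports from powers of a contraction, polar parts from a
    Neumann series. Maximal projections and partial isometries are found by maximising the trace
    along increasing sequences. *)

Section PsdForm.
Variables (R : realType) (V : lmodType R[i]).
Implicit Types (f : V -> V -> R) (u v w : V).

(** Linearity over the reals only, and f may be degenerate: the same lemmas then apply to the real
    part of the inner product, to finite sums of copies of it, and to [<<a u, v>>] for a positive
    operator a. *)
Definition psd f :=
  [/\ (forall u v w, f (u + v) w = f u w + f v w),
      (forall r u v, f (r%:C *: u) v = r * f u v),
      (forall u v, f u v = f v u) &
      (forall u, 0 <= f u u)].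

Variable f : V -> V -> R.
Hypothesis hf : psd f.

Lemma psdDl u v w : f (u + v) w = f u w + f v w. Proof. by case: hf. Qed.
Lemma psdZl r u v : f (r%:C *: u) v = r * f u v. Proof. by case: hf. Qed.
Lemma psdC u v : f u v = f v u. Proof. by case: hf. Qed.
Lemma psd_ge0 u : 0 <= f u u. Proof. by case: hf. Qed.
Lemma psdDr u v w : f w (u + v) = f w u + f w v.
Proof. by rewrite psdC psdDl !(psdC w). Qed.
Lemma psdZr r u v : f v (r%:C *: u) = r * f v u.
Proof. by rewrite psdC psdZl psdC. Qed.
Lemma psdNl u v : f (- u) v = - f u v.
Proof.
have -> : - u = (-1)%:C *: u by rewrite rmorphN rmorph1 scaleN1r.
by rewrite psdZl mulN1r.
Qed.
Lemma psdNr u v : f v (- u) = - f v u.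
Proof. by rewrite psdC psdNl psdC. Qed.
Lemma psdBl u v w : f (u - v) w = f u w - f v w.
Proof. by rewrite psdDl psdNl. Qed.
Lemma psdBr u v w : f w (u - v) = f w u - f w v.
Proof. by rewrite psdDr psdNr. Qed.
Lemma psd0l u : f 0 u = 0.
Proof. by rewrite -(subrr 0) psdBl subrr. Qed.
Lemma psd0r u : f u 0 = 0.
Proof. by rewrite psdC psd0l. Qed.

(** The discriminant criterion, evaluated at the minimiser -b/a. If a = 0 and b is nonzero, some t
    gives the value -(d + 1), which is excluded. *)
Lemma quad_ge (a b d : R) : 0 <= a -> 0 <= d ->
  (forall t, - d <= 2 * t * b + t ^+ 2 * a) -> b ^+ 2 <= a * d.
Proof.
move=> a0 d0 h.
have [a1|a1] := eqVneq a 0.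
  rewrite a1 mul0r.
  have [->|b0] := eqVneq b 0; first by rewrite expr0n.
  have := h (- (d + 1) / (2 * b)); rewrite a1 mulr0 addr0.
  have -> : 2 * (- (d + 1) / (2 * b)) * b = - (d + 1) by field.
  by lra.
have ap : 0 < a by rewrite lt_def a1.
have := h (- b / a).
have -> : 2 * (- b / a) * b + (- b / a) ^+ 2 * a = - (b ^+ 2 / a) by field.
by rewrite lerN2 ler_pdivrMr // mulrC.
Qed.

Lemma psd_expand u v t :
  f (u + t%:C *: v) (u + t%:C *: v) = f u u + 2 * t * f u v + t ^+ 2 * f v v.
Proof. by rewrite !(psdDl, psdDr, psdZl, psdZr) (psdC v u); ring. Qed.

Lemma psdCS u v : f u v ^+ 2 <= f u u * f v v.
Proof.
rewrite mulrC; apply: quad_ge; rewrite ?psd_ge0 // => t.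
by have := psd_ge0 (u + t%:C *: v); rewrite psd_expand; lra.
Qed.

Lemma psdB2 u v : f (u - v) (u - v) = f u u - 2 * f u v + f v v.
Proof. by rewrite !(psdBl, psdBr) (psdC v u); ring. Qed.

Lemma psd_tri2 u v w :
  f (u - w) (u - w) <= 2 * f (u - v) (u - v) + 2 * f (v - w) (v - w).
Proof.
rewrite !psdB2; have := psd_ge0 ((u - v) - (v - w)).
by rewrite !(psdBl, psdBr) (psdC v u) (psdC w u) (psdC w v); lra.
Qed.

Lemma psdD2_le u v : f (u + v) (u + v) <= 2 * f u u + 2 * f v v.
Proof.
have := psd_tri2 u 0 (- v).
by rewrite !subr0 !sub0r !opprK.
Qed.

Lemma psd_swap2 u v : f (u - v) (u - v) = f (v - u) (v - u).
Proof. by rewrite !psdB2 (psdC v u); ring. Qed.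

Definition fcvg (s : nat -> V) v :=
  forall e : R, 0 < e -> exists N, forall n, (N <= n)%N ->
    f (v - s n) (v - s n) < e.

Definition fcauchy (s : nat -> V) :=
  forall e : R, 0 < e -> exists N, forall m n, (N <= m)%N -> (N <= n)%N ->
    f (s m - s n) (s m - s n) < e.

Lemma fcvg_dot s v w : fcvg s v ->
  forall e : R, 0 < e -> exists N, forall n, (N <= n)%N ->
    `|f v w - f (s n) w| < e.
Proof.
move=> sv e e0.
have C0 : 0 < f w w + 1 by have := psd_ge0 w; lra.
have [N hN] := sv (e ^+ 2 / (f w w + 1)) ltac:(by rewrite divr_gt0 ?exprn_gt0).
exists N => n /hN; rewrite ltr_pdivlMr // => h.
rewrite -psdBl -(ltr_pXn2r (n := 2)) ?nnegrE ?(ltW e0) //.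
rewrite real_normK ?num_real //.
apply: le_lt_trans (psdCS _ _) _; apply: le_lt_trans h.
by apply: ler_wpM2l; [exact: psd_ge0 | lra].
Qed.

(** Two different sequences and test vectors are allowed, so that an adjunction identity true along
    approximants passes to the limit on both sides at once. *)
Lemma psd_cvg_eq2 (s t : nat -> V) u v w z : fcvg s u -> fcvg t v ->
  (forall n, f (s n) w = f (t n) z) -> f u w = f v z.
Proof.
move=> su tv h; apply/eqP/negPn/negP => ne.
have e0 : 0 < `|f u w - f v z| / 2.
  by rewrite divr_gt0 // normr_gt0 subr_eq0.
have [N hN] := fcvg_dot w su e0; have [M hM] := fcvg_dot z tv e0.
have := hN _ (leq_maxl N M); have := hM _ (leq_maxr N M); rewrite h.
set x := f (t _) z; set d := `|_| / 2 => h1 h2.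
have := ler_normB (f u w - x) (f v z - x).
rewrite opprB addrA subrK; move: h1 h2; rewrite /d; lra.
Qed.

Lemma inv_lt_ex (e : R) : 0 < e -> exists N, forall n, (N <= n)%N -> n.+1%:R^-1 < e.
Proof.
move=> e0; exists (Num.bound (e^-1)) => n hn.
rewrite invf_plt ?posrE ?ltr0n //.
apply: lt_le_trans (archi_boundP _) _; first by rewrite invr_ge0 ltW.
by rewrite ler_nat (leq_trans hn).
Qed.

(** Minimisation of f(u, u) - 2 g(u) over S. S need not be closed: the representing vector is only a
    limit of elements of S. With g = f(w, .) this is the orthogonal projection of w onto the closure
    of S; with S the whole space it is the Riesz theorem. *)
Lemma psd_riesz (S : set V) (g : V -> R) (C : R) :
  S 0 -> (forall u v, S u -> S v -> S (u + v)) ->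
  (forall r u, S u -> S (r%:C *: u)) ->
  (forall u v, S u -> S v -> g (u + v) = g u + g v) ->
  (forall r u, S u -> g (r%:C *: u) = r * g u) ->
  0 <= C -> (forall u, S u -> g u ^+ 2 <= C * f u u) ->
  (forall s, (forall n, S (s n)) -> fcauchy s -> exists v, fcvg s v) ->
  exists v, (forall e : R, 0 < e -> exists2 s, S s & f (v - s) (v - s) < e) /\
            forall s, S s -> f v s = g s.
Proof.
move=> S0 SD SZ gD gZ C0 gC compl.
pose J u := f u u - 2 * g u.
have Jlb u : S u -> - C <= J u.
  move=> Su; rewrite /J; have := gC _ Su; have h := psd_ge0 u.
  move=> h2; suff : (2 * g u) <= C + f u u by lra.
  have [gn|gp] := ltP (g u) 0; first by lra.
  rewrite -(ler_pXn2r (n := 2)) ?nnegrE; [|done|lra|lra].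
  by have := sqr_ge0 (C - f u u); nra.
pose E := [set J u | u in S].
have Einf : has_inf E.
  split; first by exists (J 0), 0.
  by exists (- C) => _ [u Su <-]; exact: Jlb.
have hm u : S u -> inf E <= J u by move=> Su; apply: ge_inf => //; [case: Einf | exists u].
have hs n : exists u, S u /\ J u < inf E + n.+1%:R^-1.
  have [_ [u Su <-] h] := inf_adherent (ltac:(by rewrite invr_gt0 ltr0n) : 0 < (n.+1%:R^-1 : R)) Einf.
  by exists u.
have [s sP] := choice hs.
(* Comparing J at s n with J at s n + t u for all real t leaves a quadratic in t bounded below by
   -1/(n+1); the discriminant gives the Euler equation up to that error. *)
have key n u : S u -> (f (s n) u - g u) ^+ 2 <= f u u * n.+1%:R^-1.
  move=> Su; apply: quad_ge; rewrite ?psd_ge0 ?invr_ge0 ?ler0n // => t.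
  have [Sn Jn] := sP n.
  have := hm _ (SD _ _ Sn (SZ t _ Su)).
  rewrite /J psd_expand gD // ?gZ //; last exact: SZ.
  move: Jn; rewrite /J. move: (n.+1%:R^-1) => i. lra.
have sc : fcauchy s.
  move=> e e0; have [N hN] := inv_lt_ex (ltac:(by rewrite divr_gt0 ?ltr0n) : 0 < e / 4).
  exists N => m n /hN hm' /hN hn'.
  have [Sm Jm] := sP m; have [Sn Jn] := sP n.
  (* The midpoint of s m and s n is compared with the infimum; the parallelogram identity makes
     minimising sequences Cauchy. *)
  have := hm _ (SZ (2^-1) _ (SD _ _ Sm Sn)).
  have -> : J ((2^-1)%:C *: (s m + s n)) =
    4^-1 * (f (s m) (s m) + 2 * f (s m) (s n) + f (s n) (s n)) - (g (s m) + g (s n)).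
    rewrite /J gZ ?gD //; last exact: SD.
    rewrite !(psdZl, psdZr, psdDl, psdDr) (psdC (s n) (s m)).
    by field.
  rewrite psdB2; move: Jm Jn hm' hn'; rewrite /J; move: (m.+1%:R^-1) (n.+1%:R^-1) => i1 i2; lra.
have [v sv] := compl s (fun n => (sP n).1) sc.
exists v; split.
  by move=> e /sv [N /(_ _ (leqnn N)) h]; exists (s N) => //; case: (sP N).
move=> u Su; apply/eqP/negPn/negP => /eqP ne.
have d0 : 0 < `|f v u - g u| by rewrite normr_gt0 subr_eq0; apply/eqP.
set d := `|_| in d0.
have [N1 h1] := fcvg_dot u sv (ltac:(by rewrite divr_gt0) : 0 < d / 2).
have fu1 : 0 < f u u + 1 by have := psd_ge0 u; lra.
have [N2 h2] := inv_lt_ex (ltac:(by rewrite divr_gt0 ?exprn_gt0 ?divr_gt0) : 0 < (d / 2) ^+ 2 / (f u u + 1)).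
have {}h1 := h1 _ (leq_maxl N1 N2); have {}h2 := h2 _ (leq_maxr N1 N2).
have := key (maxn N1 N2) _ Su; move: h1 h2; set n := maxn _ _ => h1.
rewrite ltr_pdivlMr // => h2 h3.
have h4 : `|f (s n) u - g u| < d / 2.
  rewrite -(ltr_pXn2r (n := 2)) ?nnegrE ?divr_ge0 ?(ltW d0) //.
  rewrite real_normK ?num_real //; apply: le_lt_trans h3 _; apply: le_lt_trans h2.
  by rewrite mulrC ler_wpM2l ?invr_ge0 ?ler0n //; lra.
have := ler_normD (f v u - f (s n) u) (f (s n) u - g u).
rewrite addrA subrK -/d; lra.
Qed.

End PsdForm.

(** * Real inner products, completeness and closures *)

Section ComplexRe.
Variable R : realType.
Implicit Types z : R[i].

Lemma ReD z w : complex.Re (z + w) = complex.Re z + complex.Re w.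
Proof. by case: z; case: w. Qed.
Lemma ReZ (r : R) z : complex.Re (r%:C * z) = r * complex.Re z.
Proof. by case: z => a b /=; rewrite mul0r subr0. Qed.
Lemma Re_i z : complex.Re ('i%C * z) = - complex.Im z.
Proof. by case: z => a b /=; rewrite mul0r mul1r sub0r. Qed.
Lemma ReJ z : complex.Re (Num.conj z) = complex.Re z.
Proof. by case: z. Qed.
Lemma complex_eqP z w : complex.Re z = complex.Re w ->
  complex.Im z = complex.Im w -> z = w.
Proof. by case: z; case: w => a b c d /= -> ->. Qed.
Lemma complex_gt0 z : 0 < z -> exists2 r : R, 0 < r & z = r%:C.
Proof.
rewrite ltcE => /andP[/eqP /= i0 r0]; exists (complex.Re z) => //.
exact: complex_eqP.
Qed.
End ComplexRe.

Section HilbertBasics.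
Variables (R : realType) (H : hilbert R).
Implicit Types u v w : H.

Definition rdot u v : R := complex.Re (hdot u v).

Lemma hdotDl u v w : hdot (u + v) w = hdot u w + hdot v w.
Proof. exact: linearDl. Qed.
Lemma hdotZl (c : R[i]) u v : hdot (c *: u) v = c * hdot u v.
Proof. exact: linearZl_LR. Qed.
Lemma hdotC u v : hdot u v = Num.conj (hdot v u).
Proof. by rewrite hermC expr0 mul1r. Qed.
Lemma hdotZr (c : R[i]) u v : hdot v (c *: u) = Num.conj c * hdot v u.
Proof. by rewrite hdotC hdotZl rmorphM /= -hdotC. Qed.

Lemma hdot_normE u : hdot u u = (rdot u u)%:C.
Proof.
apply: complex_eqP => //=.
have : 0 <= hdot u u by rewrite hdotE exprn_ge0.
by rewrite lecE => /andP[/eqP ->].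
Qed.

Lemma normE_rdot u : `|u| ^+ 2 = (rdot u u)%:C.
Proof. by rewrite -hdotE hdot_normE. Qed.

Lemma rdot_psd : psd rdot.
Proof.
split.
- by move=> u v w; rewrite /rdot hdotDl ReD.
- by move=> r u v; rewrite /rdot hdotZl ReZ.
- by move=> u v; rewrite /rdot hdotC ReJ.
- by move=> u; rewrite -lecR -normE_rdot exprn_ge0.
Qed.

Lemma rdot_eq0 u : rdot u u = 0 -> u = 0.
Proof.
move=> h; have /eqP := normE_rdot u.
by rewrite h sqrf_eq0 normr_eq0 => /eqP.
Qed.

Lemma rdot_i u v : rdot ('i%C *: u) v = - complex.Im (hdot u v).
Proof. by rewrite /rdot hdotZl Re_i. Qed.

Lemma norm_sqrt u : `|u| = (Num.sqrt (rdot u u))%:C.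
Proof.
apply/eqP; rewrite -(@eqrXn2 _ 2) ?normr_ge0 //; last by rewrite lecR sqrtr_ge0.
by rewrite normE_rdot -rmorphXn /= sqr_sqrtr // (psd_ge0 rdot_psd).
Qed.

Lemma norm_lt u (e : R) : 0 < e -> (`|u| < e%:C) = (rdot u u < e ^+ 2).
Proof.
move=> e0; rewrite norm_sqrt ltcR -(ltr_pXn2r (n := 2)) ?nnegrE ?sqrtr_ge0 ?(ltW e0) //.
by rewrite sqr_sqrtr // (psd_ge0 rdot_psd).
Qed.

Lemma rdot_extl u v : (forall w, rdot u w = rdot v w) -> u = v.
Proof.
move=> h; apply/eqP; rewrite -subr_eq0; apply/eqP/rdot_eq0.
by rewrite (psdBl rdot_psd) h subrr.
Qed.

Lemma rdot_extr u v : (forall w, rdot w u = rdot w v) -> u = v.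
Proof. by move=> h; apply: rdot_extl => w; rewrite !(psdC rdot_psd _ w). Qed.

(** Imaginary parts are recovered from real ones by replacing u with i u, which is where linearity
    of f over the complex numbers enters. *)
Lemma hdot_ext_rdot (f g : H -> H) : linear f ->
  (forall u v, rdot (f u) v = rdot u (g v)) -> forall u v, hdot (f u) v = hdot u (g v).
Proof.
move=> fl h u v; apply: complex_eqP; first exact: h.
have fZ c w : f (c *: w) = c *: f w.
  have f0 : f 0 = 0.
    have := fl 1 0 0; rewrite !scale1r addr0 => h0.
    by rewrite -[LHS](addrK (f 0)) -h0 subrr.
  by have := fl c w 0; rewrite f0 !addr0.
by apply: oppr_inj; rewrite -!rdot_i -fZ h.
Qed.

Lemma hilbert_complete (s : nat -> H) : fcauchy rdot s -> exists v, fcvg rdot s v.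
Proof.
move=> sc.
have : cauchy (s @ \oo).
  apply/cauchy_ballP => _ /complex_gt0 [e e0 ->].
  have [N hN] := sc _ (exprn_gt0 2 e0).
  exists ([set s n | n in [set n | (N <= n)%N]], [set s n | n in [set n | (N <= n)%N]]).
    by split; exists N => // n /= Nn; exists n.
  move=> [_ _] /= [[m Nm <-] [n Nn <-]].
  by rewrite -ball_normE /= norm_lt // hN.
move/cauchy_cvgP => /= /cvg_ex [v sv]; exists v => e e0.
have e1 : 0 < Num.sqrt e by rewrite sqrtr_gt0.
have /cvgrPdist_lt /(_ (Num.sqrt e)%:C) := sv.
rewrite ltcR e1 => /(_ isT) [N _ hN]; exists N => n /hN /=.
by rewrite norm_lt // sqr_sqrtr // ltW.
Qed.

Lemma closure_rdotP (A : set H) u :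
  closure A u <-> forall e : R, 0 < e -> exists2 a, A a & rdot (u - a) (u - a) < e.
Proof.
split.
  move=> cA e e0; have e1 : 0 < Num.sqrt e by rewrite sqrtr_gt0.
  have [a [Aa]] := cA (ball u (Num.sqrt e)%:C) (nbhsx_ballx _ _ (ltac:(by rewrite ltcR) : 0 < (Num.sqrt e)%:C)).
  rewrite -ball_normE /= norm_lt // sqr_sqrtr ?ltW // => h.
  by exists a.
move=> h B /nbhs_ballP [_ /complex_gt0 [e e0 ->] sB].
have [a Aa ha] := h _ (exprn_gt0 2 e0).
by exists a; split => //; apply: sB; rewrite -ball_normE /= norm_lt.
Qed.

(** The strong operator topology in terms of finitely many vectors; all uses of the pointwise
    topology in [vN_algebra] go through this form. *)
Lemma ptws_closureP (A : set (H -> H)) (x : H -> H) :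
  closure (A : set {ptws H -> H}) x <->
  forall (s : seq H) (e : R), 0 < e -> exists2 a, A a &
    forall u, u \in s -> rdot (x u - a u) (x u - a u) < e.
Proof.
split.
  rewrite closureEcvg => -[G PG [Gx AG]] s e e0.
  have e1 : 0 < Num.sqrt e by rewrite sqrtr_gt0.
  have hG : forall s : seq H, G [set a | forall u, u \in s -> rdot (x u - a u) (x u - a u) < e].
    elim=> [|u s' ih]; first by apply: filterS filterT => a _ u; rewrite in_nil.
    have Gu : G [set a | rdot (x u - a u) (x u - a u) < e].
      have /pointwise_cvgP /(_ u) /cvgrPdist_lt /(_ (Num.sqrt e)%:C) := Gx.
      rewrite ltcR e1 => /(_ isT) /=; apply: filterS => a /=.
      by rewrite norm_lt // sqr_sqrtr // ltW.
    apply: filterS2 Gu ih => a /= h1 h2 v; rewrite in_cons => /orP[/eqP ->//|].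
    exact: h2.
  have GA : G A by apply: AG.
  have [a [Aa ha]] := filter_ex (filterI GA (hG s)).
  by exists a.
move=> h; rewrite closureEcvg.
(* A filter on A converging to x is generated by the basic neighbourhoods, indexed by a finite list
   of vectors and a tolerance. *)
pose D := [set i : seq H * R | 0 < i.2].
pose B (i : seq H * R) := [set a | A a /\ forall u, u \in i.1 -> rdot (x u - a u) (x u - a u) < i.2].
have BF : Filter (filter_from D B).
  apply: filter_from_filter; first by exists ([::], 1); rewrite /D /=.
  move=> [s e] [t d] /= e0 d0; exists (s ++ t, Num.min e d); first by rewrite /D /= lt_min e0.
  move=> a [Aa ha]; split; split => // u us; apply: lt_le_trans (ha u _) _;
    by rewrite /= ?mem_cat ?us ?orbT // ge_min lexx ?orbT.
exists (filter_from D B); last split.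
- apply: filter_from_proper => // -[s e] /= e0.
  by have [a Aa ha] := h s e e0; exists a.
- apply/pointwise_cvgP => u; apply/cvgrPdist_lt => _ /complex_gt0 [e e0 ->].
  exists ([:: u], e ^+ 2); first by rewrite /D /= exprn_gt0.
  by move=> a [_ /(_ u)]; rewrite /= mem_head norm_lt // => ->.
- move=> P /= AP; exists ([::], 1); first by rewrite /D /=.
  by move=> a [/AP].
Qed.

End HilbertBasics.

(** * Bounded operators *)

Section LinearPred.
Variables (R : realType) (U V : lmodType R[i]) (T : U -> V).
Implicit Types u v : U.
Hypothesis Tl : linear T.

Lemma lin0 : T 0 = 0.
Proof.
have := Tl 1 0 0; rewrite !scale1r addr0 => h0.
by rewrite -[LHS](addrK (T 0)) -h0 subrr.
Qed.
Lemma linZ c u : T (c *: u) = c *: T u.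
Proof. by have := Tl c u 0; rewrite lin0 !addr0. Qed.
Lemma linD u v : T (u + v) = T u + T v.
Proof. by have := Tl 1 u v; rewrite !scale1r. Qed.
Lemma linN u : T (- u) = - T u.
Proof. by rewrite -scaleN1r linZ scaleN1r. Qed.
Lemma linB u v : T (u - v) = T u - T v.
Proof. by rewrite linD linN. Qed.
End LinearPred.

Section BoundedOperators.
Variables (R : realType) (H : hilbert R).
Implicit Types u v w : H.
Local Notation "<< u , v >>" := (rdot u v) (at level 0, format "<< u ,  v >>").
Let dp := rdot_psd H.

Lemma bounded_opP (T : H -> H) :
  bounded_op T <-> linear T /\ exists2 C : R, 0 <= C & forall u, <<T u, T u>> <= C * <<u, u>>.
Proof.
split.
  move=> [Tl Tc]; split => //.
  pose LT := GRing.isLinear.Build _ _ _ _ T Tl.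
  pose fT : {linear H -> H} := HB.pack T LT.
  have : continuous fT by [].
  move/linear_bounded_continuous/linear_boundedP/pinfty_ex_gt0 => [_ /complex_gt0 [r r0 ->]] h.
  exists (r ^+ 2) => [|u]; first by rewrite exprn_ge0 // ltW.
  rewrite -lecR rmorphM /= -!normE_rdot rmorphXn /= -exprMn.
  by rewrite lerXn2r ?nnegrE ?mulr_ge0 ?normr_ge0 ?lecR ?(ltW r0) //; exact: h.
move=> [Tl [C C0 h]]; split => //.
move=> u; apply/cvgrPdist_lt => _ /complex_gt0 [e e0 ->].
have C1 : 0 < C + 1 by lra.
have d0 : 0 < e / Num.sqrt (C + 1) by rewrite divr_gt0 ?sqrtr_gt0.
apply/nbhs_ballP; exists (e / Num.sqrt (C + 1))%:C; first by rewrite /= ltcR.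
move=> v; rewrite -ball_normE /= !norm_lt // -linB //.
rewrite expr_div_n sqr_sqrtr ?(ltW C1) // ltr_pdivlMr // => hv.
apply: le_lt_trans (h _) _; apply: le_lt_trans hv.
by rewrite mulrC ler_wpM2l ?(psd_ge0 dp) //; lra.
Qed.

(** Boundedness is stored as a boolean, so that operators equal as functions are equal, and
    composition becomes the product of a ring; the ring may be zero, because H may be. *)
Record bop := Bop { bfun :> H -> H; bfunP : `[< bounded_op bfun >] }.
HB.instance Definition _ := [isSub for bfun].
HB.instance Definition _ := [Choice of bop by <:].
Implicit Types a b c x y z p q : bop.

Lemma bop_bounded a : bounded_op a. Proof. exact/asboolP/(bfunP a). Qed.
Lemma bop_ext a b : (forall u, a u = b u) -> a = b.
Proof. by move=> h; apply: val_inj; apply/funext. Qed.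
Lemma bop_lin a : linear a. Proof. by case: (bop_bounded a). Qed.
Lemma bop_bd a : exists2 C : R, 0 <= C & forall u, <<a u, a u>> <= C * <<u, u>>.
Proof. by case/bounded_opP: (bop_bounded a). Qed.
Lemma bop0v a : a 0 = 0. Proof. exact/lin0/bop_lin. Qed.
Lemma bopZv a k u : a (k *: u) = k *: a u. Proof. exact/linZ/bop_lin. Qed.
Lemma bopDv a u v : a (u + v) = a u + a v. Proof. exact/linD/bop_lin. Qed.
Lemma bopNv a u : a (- u) = - a u. Proof. exact/linN/bop_lin. Qed.
Lemma bopBv a u v : a (u - v) = a u - a v. Proof. exact/linB/bop_lin. Qed.

Definition mkbop (T : H -> H) (h : bounded_op T) : bop := Bop (introT (asboolP _) h).
Lemma mkbopE T h u : @mkbop T h u = T u. Proof. by []. Qed.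

Fact zero_bounded : bounded_op (fun _ : H => 0 : H).
Proof.
apply/bounded_opP; split; first by move=> k u v; rewrite scaler0 addr0.
by exists 0 => // u; rewrite (psd0l dp) mul0r.
Qed.
Fact add_bounded a b : bounded_op (fun u => a u + b u).
Proof.
apply/bounded_opP; split.
  by move=> k u v; rewrite !bopDv !bopZv scalerDr !addrA; congr (_ + _); rewrite -!addrA; congr (_ + _); exact: addrC.
have [C C0 hC] := bop_bd a; have [D D0 hD] := bop_bd b.
exists (2 * C + 2 * D) => [|u]; first lra.
by have := psdD2_le dp (a u) (b u); have := hC u; have := hD u; lra.
Qed.
Fact opp_bounded a : bounded_op (fun u => - a u).
Proof.
apply/bounded_opP; split; first by move=> k u v; rewrite !bopDv !bopZv opprD scalerN.
by have [C C0 hC] := bop_bd a; exists C => // u; rewrite (psdNl dp) (psdNr dp) opprK.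
Qed.
Fact one_bounded : bounded_op (fun u : H => u).
Proof.
apply/bounded_opP; split; first by [].
by exists 1 => // u; rewrite mul1r.
Qed.
Fact mul_bounded a b : bounded_op (fun u => a (b u)).
Proof.
apply/bounded_opP; split; first by move=> k u v; rewrite !bopDv !bopZv.
have [C C0 hC] := bop_bd a; have [D D0 hD] := bop_bd b.
exists (C * D) => [|u]; first exact: mulr_ge0.
apply: le_trans (hC _) _; rewrite -mulrA; exact: ler_wpM2l.
Qed.
Lemma rdot_scale (k : R[i]) u :
  <<k *: u, k *: u>> = (complex.Re k ^+ 2 + complex.Im k ^+ 2) * <<u, u>>.
Proof.
rewrite /rdot hdotZl hdotZr hdot_normE; case: k => r s /=; ring.
Qed.
Fact scale_bounded (k : R[i]) a : bounded_op (fun u => k *: a u).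
Proof.
apply/bounded_opP; split.
  by move=> l u v; rewrite !bopDv !bopZv scalerDr !scalerA mulrC.
have [C C0 hC] := bop_bd a.
exists ((complex.Re k ^+ 2 + complex.Im k ^+ 2) * C) => [|u].
  by rewrite mulr_ge0 // addr_ge0 ?sqr_ge0.
by rewrite rdot_scale -mulrA ler_wpM2l // addr_ge0 ?sqr_ge0.
Qed.

Definition bop_zero := mkbop zero_bounded.
Definition bop_add a b := mkbop (add_bounded a b).
Definition bop_opp a := mkbop (opp_bounded a).
Definition bop_one := mkbop one_bounded.
Definition bop_mul a b := mkbop (mul_bounded a b).
Definition bop_scale k a := mkbop (scale_bounded k a).

Fact bop_addA : associative bop_add.
Proof. by move=> a b c; apply: bop_ext => u /=; rewrite addrA. Qed.
Fact bop_addC : commutative bop_add.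
Proof. by move=> a b; apply: bop_ext => u /=; rewrite addrC. Qed.
Fact bop_add0 : left_id bop_zero bop_add.
Proof. by move=> a; apply: bop_ext => u /=; rewrite add0r. Qed.
Fact bop_addN : left_inverse bop_zero bop_opp bop_add.
Proof. by move=> a; apply: bop_ext => u /=; rewrite addNr. Qed.
HB.instance Definition _ := GRing.isZmodule.Build bop bop_addA bop_addC bop_add0 bop_addN.

Fact bop_mulA : associative bop_mul.
Proof. by move=> a b c; apply: bop_ext. Qed.
Fact bop_mul1l : left_id bop_one bop_mul.
Proof. by move=> a; apply: bop_ext. Qed.
Fact bop_mul1r : right_id bop_one bop_mul.
Proof. by move=> a; apply: bop_ext. Qed.
Fact bop_mulDl : left_distributive bop_mul +%R.
Proof. by move=> a b c; apply: bop_ext. Qed.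
Fact bop_mulDr : right_distributive bop_mul +%R.
Proof. by move=> a b c; apply: bop_ext => u /=; rewrite bopDv. Qed.
HB.instance Definition _ := GRing.Zmodule_isPzRing.Build bop bop_mulA bop_mul1l bop_mul1r bop_mulDl bop_mulDr.

Fact bop_scaleA k l a : bop_scale k (bop_scale l a) = bop_scale (k * l) a.
Proof. by apply: bop_ext => u /=; rewrite scalerA. Qed.
Fact bop_scale1 : left_id 1 bop_scale.
Proof. by move=> a; apply: bop_ext => u /=; rewrite scale1r. Qed.
Fact bop_scaleDr : right_distributive bop_scale +%R.
Proof. by move=> k a b; apply: bop_ext => u /=; rewrite scalerDr. Qed.
Fact bop_scaleDl a : {morph bop_scale^~ a : k l / k + l}.
Proof. by move=> k l; apply: bop_ext => u /=; rewrite scalerDl. Qed.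
HB.instance Definition _ := GRing.Zmodule_isLmodule.Build R[i] bop
  bop_scaleA bop_scale1 bop_scaleDr bop_scaleDl.

Lemma bopD a b u : (a + b) u = a u + b u. Proof. by []. Qed.
Lemma bopN a u : (- a) u = - a u. Proof. by []. Qed.
Lemma bopB a b u : (a - b) u = a u - b u. Proof. by []. Qed.
Lemma bopM a b u : (a * b) u = a (b u). Proof. by []. Qed.
Lemma bopZ k a u : (k *: a) u = k *: a u. Proof. by []. Qed.
Lemma bop1 u : (1 : bop) u = u. Proof. by []. Qed.
Lemma bop0 u : (0 : bop) u = 0. Proof. by []. Qed.
Definition bopE := (bopD, bopN, bopM, bopZ, bop1, bop0).
Lemma bopZAl k a b : k *: (a * b) = (k *: a) * b.
Proof. by apply: bop_ext. Qed.
Lemma bopZAr k a b : k *: (a * b) = a * (k *: b).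
Proof. by apply: bop_ext => u; rewrite !bopE bopZv. Qed.

(** The Riesz theorem for u |-> [<<a u, v>>]. Only real parts are compared, so complex linearity of
    b is derived afterwards from uniqueness. *)
Fact adjoint_ex (a : bop) : exists b : bop, forall u v, <<a u, v>> = <<u, b v>>.
Proof.
have [C C0 hC] := bop_bd a.
have h v : exists w, forall u, <<a u, v>> = <<u, w>>.
  have := @psd_riesz R H (@rdot R H) dp setT (fun u => <<a u, v>>) (C * <<v, v>>).
  case=> //.
  - by move=> x y _ _; rewrite bopDv (psdDl dp).
  - by move=> r x _; rewrite bopZv (psdZl dp).
  - by rewrite mulr_ge0 ?(psd_ge0 dp).
  - move=> u _; apply: le_trans (psdCS dp _ _) _.
    by rewrite mulrAC ler_wpM2r ?(psd_ge0 dp).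
  - by move=> s _; exact: hilbert_complete.
  by move=> w [_ hw]; exists w => u; rewrite -hw // (psdC dp).
have [b hb] := choice h.
have bl : linear b.
  move=> k u v; apply: rdot_extr => w; rewrite -hb !(psdDr dp) -hb; congr (_ + _).
  have hZ (l : R[i]) u' v' : <<u', l *: v'>> = <<Num.conj l *: u', v'>>.
    by rewrite /rdot hdotZr hdotZl.
  by rewrite !hZ -bopZv hb.
have bb : bounded_op b.
  apply/bounded_opP; split => //; exists C => // u.
  have : <<b u, b u>> ^+ 2 <= C * <<b u, b u>> * <<u, u>>.
    rewrite -[X in X ^+ 2]hb; apply: le_trans (psdCS dp _ _) _.
    by apply: ler_wpM2r; rewrite ?(psd_ge0 dp).
  have [->|n0] := eqVneq <<b u, b u>> 0; first by rewrite mulr_ge0 ?(psd_ge0 dp).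
  have p0 : 0 < <<b u, b u>> by rewrite lt_def n0 (psd_ge0 dp).
  by rewrite mulrAC expr2 ler_pM2r.
by exists (mkbop bb).
Qed.

Definition star a : bop := projT1 (cid (adjoint_ex a)).
Local Notation "a ^#" := (star a) : ring_scope.

Lemma starE a u v : <<a u, v>> = <<u, a^# v>>.
Proof. by rewrite /star; case: cid. Qed.
Lemma starEr a u v : <<a^# u, v>> = <<u, a v>>.
Proof. by rewrite (psdC dp) -starE (psdC dp). Qed.
Lemma star_unique a b : (forall u v, <<a u, v>> = <<u, b v>>) -> b = a^#.
Proof.
by move=> h; apply: bop_ext => v; apply: rdot_extr => u; rewrite -h starE.
Qed.
Lemma starK a : (a^#)^# = a.
Proof. by symmetry; apply: star_unique => u v; rewrite starEr. Qed.
Lemma star_inj a b : a^# = b^# -> a = b.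
Proof. by move=> h; rewrite -(starK a) h starK. Qed.
Lemma starD a b : (a + b)^# = a^# + b^#.
Proof.
by symmetry; apply: star_unique => u v; rewrite !bopE (psdDl dp) (psdDr dp) !starE.
Qed.
Lemma starN a : (- a)^# = - a^#.
Proof.
by symmetry; apply: star_unique => u v; rewrite !bopE (psdNl dp) (psdNr dp) !starE.
Qed.
Lemma starB a b : (a - b)^# = a^# - b^#.
Proof. by rewrite starD starN. Qed.
Lemma starM a b : (a * b)^# = b^# * a^#.
Proof. by symmetry; apply: star_unique => u v; rewrite !bopE !starE. Qed.
Lemma starZ k a : (k *: a)^# = Num.conj k *: a^#.
Proof.
symmetry; apply: star_unique => u v; rewrite !bopE.
have hZ (l : R[i]) u' v' : << l *: u', v'>> = <<u', Num.conj l *: v'>>.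
  by rewrite /rdot hdotZr hdotZl conjCK.
by rewrite hZ starE bopZv.
Qed.
Lemma starZr (r : R) a : (r%:C *: a)^# = r%:C *: a^#.
Proof. by rewrite starZ; congr (_ *: _); exact: conjc_real. Qed.
Lemma star1 : (1 : bop)^# = 1.
Proof. by symmetry; apply: star_unique. Qed.
Lemma star0 : (0 : bop)^# = 0.
Proof. by symmetry; apply: star_unique => u v; rewrite (psd0l dp) (psd0r dp). Qed.
Lemma starX a n : (a ^+ n)^# = (a^#) ^+ n.
Proof. by elim: n => [|n ih]; rewrite ?expr0 ?star1 // exprS starM ih exprSr. Qed.

Lemma star_adjoint a b : is_adjoint a b <-> b = star a :> bop.
Proof.
split=> [h|->]; first by apply: star_unique => u v; rewrite /rdot h.
by apply: hdot_ext_rdot; [exact: bop_lin | exact: starE].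
Qed.

Lemma star_mul0 a : a^# * a = 0 -> a = 0.
Proof.
move=> h; apply: bop_ext => u; apply: rdot_eq0.
by rewrite starE -bopM h (psd0r dp).
Qed.

End BoundedOperators.

Notation "<< u , v >>" := (rdot u v) (at level 0, format "<< u ,  v >>") : ring_scope.
Notation "a ^#" := (star a) : ring_scope.

(** * Strong convergence of sequences and commutation *)

Section Convergence.
Variables (R : realType) (H : hilbert R).
Implicit Types (u v w : H) (a b c x y : bop H).
Let dp := rdot_psd H.
Local Notation cvgs := (fcvg (@rdot R H)).

Lemma fcvg_cst v : cvgs (fun=> v) v.
Proof. by move=> e e0; exists 0%N => n _; rewrite subrr (psd0l dp). Qed.

Lemma fcvgD (s t : nat -> H) u v : cvgs s u -> cvgs t v -> cvgs (fun n => s n + t n) (u + v).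
Proof.
move=> su tv e e0; have e1 : 0 < e / 4 by rewrite divr_gt0.
have [N hN] := su _ e1; have [M hM] := tv _ e1.
exists (maxn N M) => n; rewrite geq_max => /andP[/hN h1 /hM h2].
rewrite opprD addrACA; have := psdD2_le dp (u - s n) (v - t n); lra.
Qed.

Lemma fcvg_op a (s : nat -> H) u : cvgs s u -> cvgs (fun n => a (s n)) (a u).
Proof.
move=> su e e0; have [C C0 hC] := bop_bd a.
have C1 : 0 < C + 1 by lra.
have [N hN] := su _ (divr_gt0 e0 C1).
exists N => n /hN; rewrite ltr_pdivlMr // => h.
rewrite -bopBv; apply: le_lt_trans (hC _) _.
have := psd_ge0 dp (u - s n); nra.
Qed.

Lemma fcvgN (s : nat -> H) u : cvgs s u -> cvgs (fun n => - s n) (- u).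
Proof. by move=> /(fcvg_op (-1)). Qed.

Lemma fcvgZ (k : R[i]) (s : nat -> H) u : cvgs s u -> cvgs (fun n => k *: s n) (k *: u).
Proof. by move=> /(fcvg_op (k *: (1 : bop H))). Qed.

Lemma fcvgS (s : nat -> H) u : cvgs s u -> cvgs (fun n => s n.+1) u.
Proof.
by move=> su e /su [N hN]; exists N => n Nn; apply: hN; exact: leqW.
Qed.

Lemma fcvg_unique (s : nat -> H) u v : cvgs s u -> cvgs s v -> u = v.
Proof.
move=> su sv; apply/eqP; rewrite -subr_eq0; apply/eqP/rdot_eq0/eqP.
apply/negPn/negP => n0.
have e0 : 0 < <<u - v, u - v>> by rewrite lt_def n0 (psd_ge0 dp).
have e1 : 0 < <<u - v, u - v>> / 4 by rewrite divr_gt0.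
have [N hN] := su _ e1; have [M hM] := sv _ e1.
have := hN _ (leq_maxl N M); have := hM _ (leq_maxr N M).
set n := maxn N M; have := psd_tri2 dp u (s n) v.
by rewrite (psd_swap2 dp (s n) v); lra.
Qed.

Lemma fcvg_eq (s t : nat -> H) u : (forall n, s n = t n) -> cvgs s u -> cvgs t u.
Proof. by move=> /funext ->. Qed.

Lemma fcvg_dot_le (s : nat -> H) u w (r : R) :
  cvgs s u -> (forall n, << s n, w>> <= r) -> <<u, w>> <= r.
Proof.
move=> su h; rewrite leNgt; apply/negP => lt.
have [N hN] := fcvg_dot dp w su (ltac:(by rewrite subr_gt0) : 0 < <<u, w>> - r).
by have := hN _ (leqnn N); have := h N; rewrite ltr_norml; lra.
Qed.

Lemma fcvg_dot_ge (s : nat -> H) u w (r : R) :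
  cvgs s u -> (forall n, r <= << s n, w>>) -> r <= <<u, w>>.
Proof.
move=> /fcvgN su h; rewrite -lerN2 -(psdNl dp).
by apply: fcvg_dot_le su _ => n; rewrite (psdNl dp) lerN2.
Qed.

Lemma fcvg_dot_eq (s : nat -> H) u w (r : R) :
  cvgs s u -> (forall n, << s n, w>> = r) -> <<u, w>> = r.
Proof.
move=> su h; apply: le_anti; apply/andP; split.
  by apply: fcvg_dot_le su _ => n; rewrite h.
by apply: fcvg_dot_ge su _ => n; rewrite h.
Qed.

Lemma fcvg_dot_eq2 (s t : nat -> H) u v w z : cvgs s u -> cvgs t v ->
  (forall n, << s n, w>> = << t n, z>>) -> <<u, w>> = <<v, z>>.
Proof. exact: psd_cvg_eq2. Qed.

Lemma fcvg_norm_le (s : nat -> H) u (r : R) :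
  cvgs s u -> (forall n, << s n, s n>> <= r) -> <<u, u>> <= r.
Proof.
move=> su h; rewrite leNgt; apply/negP => lt.
have r0 : 0 <= r by apply: le_trans (h 0%N); exact: psd_ge0.
have u0 : 0 < <<u, u>> by lra.
(* |<u, s n>|^2 <= |u|^2 r, and <u, s n> -> |u|^2 *)
have [q q0 qE] : exists2 q : R, 0 < q & 2 * q = <<u, u>> - r.
  by exists ((<<u, u>> - r) / 2); [rewrite divr_gt0 // subr_gt0 | field].
have [N hN] := fcvg_dot dp u su q0.
have := hN _ (leqnn N); have := h N; rewrite ltr_norml.
have := psdCS dp (s N) u; have := psd_ge0 dp (s N).
move: << s N, s N>> << s N, u>> <<u, u>> qE u0 lt {hN} => A B C qE u0 lt A0 cs Ar /andP[_ h2].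
have hB : (C + r) / 2 < B by lra.
have : B ^+ 2 <= r * C by apply: le_trans cs _; rewrite ler_wpM2r // ltW.
have : ((C + r) / 2) ^+ 2 < B ^+ 2 by rewrite ltr_pXn2r ?nnegrE //; lra.
by have := sqr_ge0 (C - r); lra.
Qed.

Implicit Types s t : nat -> bop H.

(** Strong operator convergence of a sequence. *)
Definition scv (s : nat -> bop H) a := forall u, cvgs (fun n => s n u) (a u).

Lemma scv_cst a : scv (fun=> a) a. Proof. by move=> u; exact: fcvg_cst. Qed.
Lemma scvD s t a b : scv s a -> scv t b -> scv (fun n => s n + t n) (a + b).
Proof. by move=> sa tb u; exact: fcvgD. Qed.
Lemma scvN s a : scv s a -> scv (fun n => - s n) (- a).
Proof. by move=> sa u; exact: fcvgN. Qed.
Lemma scvB s t a b : scv s a -> scv t b -> scv (fun n => s n - t n) (a - b).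
Proof. by move=> sa /scvN; exact: scvD. Qed.
Lemma scvZ k s a : scv s a -> scv (fun n => k *: s n) (k *: a).
Proof. by move=> sa u; exact: fcvgZ. Qed.
Lemma scvMl c s a : scv s a -> scv (fun n => c * s n) (c * a).
Proof. by move=> sa u; exact: fcvg_op. Qed.
Lemma scvMr c s a : scv s a -> scv (fun n => s n * c) (a * c).
Proof. by move=> sa u; exact: (sa (c u)). Qed.
Lemma scvS s a : scv s a -> scv (fun n => s n.+1) a.
Proof. by move=> sa u; exact: (fcvgS (sa u)). Qed.
Lemma scv_unique s a b : scv s a -> scv s b -> a = b.
Proof. by move=> sa sb; apply: bop_ext => u; exact: fcvg_unique (sa u) (sb u). Qed.
Lemma scv_eq s t a : (forall n, s n = t n) -> scv s a -> scv t a.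
Proof. by move=> /funext ->. Qed.

(** Multiplication is not jointly strongly continuous; the uniform bound on the left factors is what
    makes s n (t n u - b u) vanish. *)
Lemma scvM (C : R) s t a b : (forall n u, << s n u, s n u>> <= C * <<u, u>>) ->
  scv s a -> scv t b -> scv (fun n => s n * t n) (a * b).
Proof.
move=> hC sa tb u.
apply: (@fcvg_eq (fun n => s n (b u) + (s n (t n u - b u)))).
  by move=> n; rewrite bopBv addrC subrK.
rewrite -[(a * b) u]addr0; apply: fcvgD; first exact: sa.
move=> e e0; have C1 : 0 < `|C| + 1 by have := normr_ge0 C; lra.
have [N hN] := tb u _ (divr_gt0 e0 C1).
exists N => n /hN; rewrite ltr_pdivlMr // (psd_swap2 dp) => h.
rewrite sub0r (psdNl dp) (psdNr dp) opprK; apply: le_lt_trans (hC _ _) _.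
have := psd_ge0 dp (t n u - b u); have := ler_norm C; nra.
Qed.

Lemma scv_limit (C : R) (s : nat -> bop H) : 0 <= C ->
  (forall n u, << s n u, s n u>> <= C * <<u, u>>) ->
  (forall u, fcauchy (@rdot R H) (fun n => s n u)) -> exists a, scv s a.
Proof.
move=> C0 hC hs.
have [a ha] := choice (fun u => hilbert_complete (hs u)).
have ab : bounded_op a.
  apply/bounded_opP; split.
    move=> k u v; apply: fcvg_unique (ha _) _.
    apply: (@fcvg_eq (fun n => k *: s n u + s n v)); first by move=> n; rewrite bopDv bopZv.
    by apply: fcvgD => //; exact: fcvgZ.
  by exists C => // u; apply: fcvg_norm_le (ha u) _ => n.
by exists (mkbop ab).
Qed.

Definition comm a b := a * b = b * a.

Lemma commC a b : comm a b -> comm b a. Proof. by []. Qed.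
Lemma comm_refl a : comm a a. Proof. by []. Qed.
Lemma comm1 a : comm a 1. Proof. by rewrite /comm mulr1 mul1r. Qed.
Lemma commD a b c : comm c a -> comm c b -> comm c (a + b).
Proof. by rewrite /comm mulrDl mulrDr => -> ->. Qed.
Lemma commN a c : comm c a -> comm c (- a).
Proof. by rewrite /comm mulrN mulNr => ->. Qed.
Lemma commB a b c : comm c a -> comm c b -> comm c (a - b).
Proof. by move=> ca /commN; exact: commD. Qed.
Lemma commM a b c : comm c a -> comm c b -> comm c (a * b).
Proof. by rewrite /comm => ca cb; rewrite mulrA ca -mulrA cb mulrA. Qed.
Lemma commZ k a c : comm c a -> comm c (k *: a).
Proof. by rewrite /comm -bopZAr -bopZAl => ->. Qed.
Lemma commX a c n : comm c a -> comm c (a ^+ n).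
Proof.
move=> ca; elim: n => [|n ih]; first by rewrite expr0; exact: comm1.
by rewrite exprS; exact: commM.
Qed.
Lemma comm_scv s a c : (forall n, comm c (s n)) -> scv s a -> comm c a.
Proof.
move=> cs sa; apply: scv_unique (scvMl c sa) _.
by apply: scv_eq (scvMr c sa) => n; rewrite cs.
Qed.

End Convergence.

(** * Positive operators and monotone limits *)

Section Positive.
Variables (R : realType) (H : hilbert R).
Implicit Types (u v w : H) (a b c x y : bop H).
Let dp := rdot_psd H.
Local Notation cvgs := (fcvg (@rdot R H)).

Local Notation rI r := (r%:C *: (1 : bop H)).

Definition pos a := a^# = a /\ forall u, 0 <= <<a u, u>>.

Lemma pos_psd a : pos a -> psd (fun u v => <<a u, v>>).
Proof.
move=> [ sa a0]; split => //.
- by move=> u v w; rewrite bopDv (psdDl dp).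
- by move=> r u v; rewrite bopZv (psdZl dp).
- by move=> u v; rewrite starE sa (psdC dp).
Qed.
Lemma posD a b : pos a -> pos b -> pos (a + b).
Proof.
move=> [ sa a0] [sb b0]; split; first by rewrite starD sa sb.
by move=> u; rewrite bopE (psdDl dp) addr_ge0.
Qed.
Lemma posZ (r : R) a : 0 <= r -> pos a -> pos (r%:C *: a).
Proof.
move=> r0 [sa a0]; split; first by rewrite starZr sa.
by move=> u; rewrite bopE (psdZl dp) mulr_ge0.
Qed.
Lemma pos_sandwich a b : pos a -> pos (b^# * a * b).
Proof.
move=> [sa a0]; split; first by rewrite !starM starK sa mulrA.
by move=> u; rewrite !bopE starEr.
Qed.
Lemma pos1 : pos (1 : bop H).
Proof. by split; [exact: star1 | move=> u; exact: psd_ge0]. Qed.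
Lemma pos0 : pos (0 : bop H).
Proof. by split; [exact: star0 | move=> u; rewrite (psd0l dp)]. Qed.
Lemma pos_sq b : pos (b^# * b).
Proof. by have := pos_sandwich b pos1; rewrite mulr1. Qed.
Lemma pos_sum I (s : seq I) (P : pred I) (F : I -> bop H) :
  (forall i, P i -> pos (F i)) -> pos (\sum_(i <- s | P i) F i).
Proof. by move=> h; elim/big_ind: _ => //; [exact: pos0 | exact: posD]. Qed.

Lemma sa_quad0 a : a^# = a -> (forall u, <<a u, u>> = 0) -> a = 0.
Proof.
move=> sa h; apply: bop_ext => u; apply: rdot_extl => v; rewrite (psd0l dp).
have := h (u + v); rewrite bopDv !(psdDl dp) !(psdDr dp) !h.
by rewrite (starE a v) sa (psdC dp v); lra.
Qed.
Lemma pos_anti a : pos a -> pos (- a) -> a = 0.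
Proof.
move=> [sa a0] [_ b0]; apply: sa_quad0 => // u.
by have := a0 u; have := b0 u; rewrite bopE (psdNl dp); lra.
Qed.
Lemma bop_qbd a : exists2 K : R, 0 < K & forall u, <<a u, u>> <= K * <<u, u>>.
Proof.
have [C C0 hC] := bop_bd a; exists (C + 1) => [|u]; first by lra.
have := psd_ge0 dp (a u - u); rewrite (psdB2 dp).
by have := hC u; have := psd_ge0 dp u; nra.
Qed.
Lemma sa_bound a : a^# = a -> exists2 K : R, 0 < K & pos (rI K - a).
Proof.
move=> sa; have [K K0 hK] := bop_qbd a; exists K => //; split.
  by rewrite starB sa starZr star1.
by move=> u; rewrite !bopE (psdBl dp) (psdZl dp) subr_ge0.
Qed.

(** Square roots are still to be built from this, so b^2 <= b comes from Cauchy-Schwarz for the form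
    [<<b u, v>>] at the pair u, b u, followed by division by |b u|^2. *)
Lemma pos_sq_le b : pos b -> pos (1 - b) -> pos (b - b * b).
Proof.
move=> pb [_ h1]; have [sb b0] := pb; split; first by rewrite starB starM sb.
move=> u; rewrite !bopE (psdBl dp) subr_ge0 starE sb.
have := psdCS (pos_psd pb) u (b u) => /= h2.
have h3 : <<b (b u), b u>> <= <<b u, b u>>.
  by have := h1 (b u); rewrite !bopE (psdBl dp) subr_ge0.
have h4 := psd_ge0 dp (b u); have h5 := b0 u.
have [->|n0] := eqVneq <<b u, b u>> 0 => //.
have p0 : 0 < <<b u, b u>> by rewrite lt_def n0.
by rewrite -(ler_pM2r p0); nra.
Qed.

Lemma pos_contr b : pos b -> pos (1 - b) -> forall u, <<b u, b u>> <= <<u, u>>.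
Proof.
move=> pb p1 u; have [_ /(_ u)] := pos_sq_le pb p1; have [_ /(_ u)] := p1.
have [sb _] := pb.
by rewrite !bopE !(psdBl dp) (starE b (b u)) sb; lra.
Qed.

Lemma nondecr_cauchy (r : nat -> R) (B : R) :
  (forall n, r n <= r n.+1) -> (forall n, r n <= B) ->
  forall e : R, 0 < e -> exists N, forall m n, (N <= n)%N -> (n <= m)%N -> r m - r n < e.
Proof.
move=> inc bd e e0.
have mono : {homo r : m n / (m <= n)%N >-> m <= n}.
  by apply: homo_leq => //; exact: le_trans.
have hs : has_sup (range r).
  by split; [exists (r 0%N), 0%N | exists B => _ [n _ <-]].
have [_ [N _ <-] hN] := sup_adherent e0 hs.
exists N => m n Nn nm; have := mono _ _ Nn.
have : r m <= sup (range r) by apply: ub_le_sup; [case: hs | exists m].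
by lra.
Qed.

(** Vigier's theorem for sequences: the numbers [<<s n u, u>>] increase and are bounded, and their
    Cauchy property is turned into strong convergence. *)
Lemma monotone_limit (s : nat -> bop H) c : (forall n, (s n)^# = s n) ->
  (forall n, pos (s n.+1 - s n)) -> (forall n, pos (c - s n)) ->
  exists a, [/\ a^# = a, scv s a, (forall n, pos (a - s n)) & pos (c - a)].
Proof.
move=> ss inc bd.
have incm m n : (n <= m)%N -> pos (s m - s n).
  move=> /subnK <-; elim: (m - n)%N => [|k ih]; first by rewrite subrr; exact: pos0.
  by rewrite addSn -[s _](subrK (s (k + n)%N)) -addrA; exact: posD.
have [K K0 hK] := bop_qbd (c - s 0%N).
(* For 0 <= d <= K, Cauchy-Schwarz for the form of d gives |d u|^2 <= K [<<d u, u>>]; here d <= c -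
   s 0 <= K. *)
have dq m n u : (n <= m)%N -> <<(s m - s n) u, (s m - s n) u>> <= K * <<(s m - s n) u, u>>.
  move=> nm; have pd := incm _ _ nm; set d := s m - s n in pd *.
  have hd v : << d v, v>> <= K * <<v, v>>.
    apply: le_trans (hK v); rewrite -subr_ge0 -(psdBl dp).
    have [_ /(_ v)] := bd m; have [_ /(_ v)] := incm n 0%N isT.
    rewrite /d !bopE !(psdBl dp). lra.
  have := psdCS (pos_psd pd) u (d u) => /= h1; have h2 := hd (d u).
  have h3 := psd_ge0 dp (d u); have [_ /(_ u) h4] := pd.
  have [->|n0] := eqVneq << d u, d u>> 0; first by rewrite mulr_ge0 // ltW.
  have p0 : 0 < << d u, d u>> by rewrite lt_def n0.
  rewrite -(ler_pM2r p0) -expr2; apply: le_trans h1 _.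
  by apply: le_trans (ler_wpM2l h4 h2) _; rewrite mulrA (mulrC << d u, u>>).
have hc u : fcauchy (@rdot R H) (fun n => s n u).
  move=> e e0.
  have [N hN] := nondecr_cauchy (r := fun n => << s n u, u>>) (B := <<c u, u>>)
     (ltac:(by move=> n; have [_ /(_ u)] := inc n; rewrite !bopE (psdBl dp) subr_ge0))
     (ltac:(by move=> n; have [_ /(_ u)] := bd n; rewrite !bopE (psdBl dp) subr_ge0))
     (divr_gt0 e0 K0).
  have key m n : (N <= n)%N -> (n <= m)%N -> << s m u - s n u, s m u - s n u>> < e.
    move=> Nn nm; apply: le_lt_trans (dq m n u nm) _.
    by have := hN _ _ Nn nm; rewrite ltr_pdivlMr // mulrC !bopE (psdBl dp).
  exists N => m n Nm Nn; have [nm|mn] := leqP n m; first exact: key.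
  by rewrite (psd_swap2 dp); apply: key => //; exact: ltnW.
have [C C0 hC] := bop_bd (s 0%N).
have [] := @scv_limit R H (2 * (K * K) + 2 * C) s _ _ hc.
- by have := ltW K0; nra.
- move=> n u; have := psdD2_le dp ((s n - s 0%N) u) (s 0%N u).
  rewrite {1 2}bopE subrK => h; apply: le_trans h _.
  have := dq n 0%N u isT; have := hC u.
  have h1 : <<(s n - s 0%N) u, u>> <= K * <<u, u>>.
    apply: le_trans (hK u); have [_ /(_ u)] := bd n.
    by rewrite !bopE !(psdBl dp); lra.
  by nra.
move=> a ha; exists a.
have sa : a^# = a.
  apply/esym/star_unique => u v; rewrite (psdC dp u); apply: fcvg_dot_eq2 (ha u) (ha v) _ => n.
  by rewrite starE ss (psdC dp).
split => //.
- move=> n; split; first by rewrite starB sa ss.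
  move=> u; rewrite !bopE (psdBl dp) subr_ge0.
  have hm : cvgs (fun k => s (k + n)%N u) (a u).
    by move=> e /(ha u) [N hN]; exists N => k Nk; apply: hN; exact: leq_trans (leq_addr _ _).
  apply: fcvg_dot_ge hm _ => k.
  by rewrite -subr_ge0 -(psdBl dp); have [_ /(_ u)] := incm _ _ (leq_addl k n).
- have sc : c^# = c.
    by have [] := bd 0%N; rewrite starB ss => /(congr1 (fun x => x + s 0%N)); rewrite !subrK.
  split; first by rewrite starB sa sc.
  move=> u; rewrite !bopE (psdBl dp) subr_ge0; apply: fcvg_dot_le (ha u) _ => n.
  by rewrite -subr_ge0 -(psdBl dp); have [_ /(_ u)] := bd n.
Qed.

End Positive.

(** * Von Neumann algebras and square roots *)

(* Identities that are linear over products of opaque factors are checked after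
   pairing both sides with vectors, where they become commutative ring identities. *)
Ltac bop_ring := apply: bop_ext => ?; apply: rdot_extl => ?;
  rewrite !(bopE, bopDv, bopNv, bopZv, bop0v);
  rewrite ?(psdDl (rdot_psd _), psdNl (rdot_psd _), psdZl (rdot_psd _), psd0l (rdot_psd _));
  try first [by ring | by field].

Section FunctionalCalculus.
Variables (R : realType) (H : hilbert R).
Implicit Types (u v w : H) (a b c x y p q : bop H) (A : set (bop H)).
Let dp := rdot_psd H.
Local Notation rI r := (r%:C *: (1 : bop H)).

Definition strong_adherent A a := forall (s : seq H) (e : R), 0 < e ->
  exists2 b, A b & forall u, u \in s -> <<a u - b u, a u - b u>> < e.

(** [vN_algebra] for bundled operators; again the identity of B(H) need not belong to A, as happens
    for corners and ideals. *)
Definition vNset A := [/\ A 0 /\ (forall k a b, A a -> A b -> A (k *: a + b)),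
  (forall a b, A a -> A b -> A (a * b)),
  (forall a, A a -> A (a^#)) &
  forall a, strong_adherent A a -> A a].

Section VNsetTheory.
Variable A : set (bop H).
Hypothesis hA : vNset A.

Lemma vN0 : A 0. Proof. by case: hA => -[]. Qed.
Lemma vNlin k a b : A a -> A b -> A (k *: a + b).
Proof. by case: hA => -[_ h] _ _ _; exact: h. Qed.
Lemma vND a b : A a -> A b -> A (a + b).
Proof. by move=> Aa Ab; have := vNlin 1 Aa Ab; rewrite scale1r. Qed.
Lemma vNZ k a : A a -> A (k *: a).
Proof. by move=> Aa; have := vNlin k Aa vN0; rewrite addr0. Qed.
Lemma vNN a : A a -> A (- a).
Proof. by move=> /(vNZ (-1)); rewrite scaleN1r. Qed.
Lemma vNB a b : A a -> A b -> A (a - b).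
Proof. by move=> Aa /vNN; exact: vND. Qed.
Lemma vNM a b : A a -> A b -> A (a * b).
Proof. by case: hA => _ + _ _; apply. Qed.
Lemma vNstar a : A a -> A (a^#).
Proof. by case: hA => _ _ + _; apply. Qed.
Lemma vN_strong a : strong_adherent A a -> A a.
Proof. by case: hA => _ _ _; apply. Qed.
Lemma vN_sum I (s : seq I) (P : pred I) (F : I -> bop H) :
  (forall i, P i -> A (F i)) -> A (\sum_(i <- s | P i) F i).
Proof. by move=> h; elim/big_ind: _ => //; [exact: vN0 | exact: vND]. Qed.
Lemma vN_X a n : A 1 -> A a -> A (a ^+ n).
Proof. by move=> A1 Aa; elim: n => [|n ih]; rewrite ?expr0 // exprS; exact: vNM. Qed.

Lemma vN_scv (s : nat -> bop H) a : (forall n, A (s n)) -> scv s a -> A a.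
Proof.
move=> hs sa; apply: vN_strong => l e e0.
have [N hN] : exists N, forall n, (N <= n)%N -> forall u, u \in l -> <<a u - s n u, a u - s n u>> < e.
  elim: l => [|u l [N hN]]; first by exists 0%N.
  have [M hM] := sa u e e0; exists (maxn N M) => n; rewrite geq_max => /andP[h1 h2] v.
  by rewrite in_cons => /orP[/eqP ->|]; [exact: hM | exact: hN].
by exists (s N) => //; exact: hN.
Qed.
End VNsetTheory.

Inductive ppoly b : bop H -> Prop :=
| PPk (r : R) k : 0 <= r -> ppoly b (r%:C *: b ^+ k)
| PPD x y : ppoly b x -> ppoly b y -> ppoly b (x + y).

Lemma pos_X b k : pos b -> pos (b ^+ k).
Proof.
move=> pb; have [sb _] := pb.
have sx j : (b ^+ j)^# = b ^+ j by rewrite starX sb.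
rewrite -(odd_double_half k); case: (odd k) => /=; rewrite -addnn.
  have := pos_sandwich (b ^+ k./2) pb; rewrite sx.
  by rewrite -exprSr -exprD addSn.
by have := pos_sandwich (b ^+ k./2) (pos1 H); rewrite sx mulr1 -exprD.
Qed.

Lemma ppoly_pos b x : pos b -> ppoly b x -> pos x.
Proof.
move=> pb; elim=> [r k r0|x' y _ h1 _ h2]; last exact: posD.
by apply: posZ => //; exact: pos_X.
Qed.
Lemma ppoly_comm b x c : comm c b -> ppoly b x -> comm c x.
Proof.
move=> cb; elim=> [r k r0|x' y _ h1 _ h2]; last exact: commD.
by apply: commZ; exact: commX.
Qed.
Lemma ppolyM b x y : ppoly b x -> ppoly b y -> ppoly b (x * y).
Proof.
move=> hx hy; elim: hx => [r k r0|x1 x2 _ h1 _ h2]; last by rewrite mulrDl; exact: PPD.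
elim: hy => [r' k' r0'|x1 x2 _ h1 _ h2]; last by rewrite mulrDr; exact: PPD.
rewrite -bopZAl -bopZAr -exprD scalerA -rmorphM; exact/PPk/mulr_ge0.
Qed.
Lemma ppolyZ b (r : R) x : 0 <= r -> ppoly b x -> ppoly b (r%:C *: x).
Proof.
move=> r0; elim=> [r' k r0'|x1 x2 _ h1 _ h2]; last by rewrite scalerDr; exact: PPD.
by rewrite scalerA -rmorphM; exact/PPk/mulr_ge0.
Qed.
Lemma ppoly_id b : ppoly b b.
Proof. by have := @PPk b 1 1 ler01; rewrite scale1r expr1. Qed.
Lemma ppoly0 b : ppoly b 0.
Proof. by have := @PPk b 0 0 (lexx _); rewrite scale0r. Qed.

(* The iteration y' = (b + y^2)/2 increases to 1 - sqrt(1 - b) when 0 <= b <= 1;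
   its iterates and their increments are polynomials in b with nonnegative
   coefficients, which gives monotonicity. *)
Fixpoint sqrt_iter b n : bop H :=
  if n is m.+1 then (2^-1)%:C *: (b + sqrt_iter b m * sqrt_iter b m) else 0.

Lemma half_ge0 : 0 <= (2^-1 : R). Proof. by rewrite invr_ge0 ler0n. Qed.

Lemma sqrt_iter_ppoly b n : ppoly b (sqrt_iter b n).
Proof.
elim: n => [|n ih] /=; first exact: ppoly0.
apply: ppolyZ half_ge0 _; apply: PPD; [exact: ppoly_id | exact: ppolyM].
Qed.

Lemma sqrt_iter_inc b n : ppoly b (sqrt_iter b n.+1 - sqrt_iter b n).
Proof.
elim: n => [|n ih].
  by rewrite /= subr0; apply: ppolyZ half_ge0 _; rewrite mulr0 addr0; exact: ppoly_id.
set y := sqrt_iter b n.+1 in ih *; set z := sqrt_iter b n in ih *.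
have -> : sqrt_iter b n.+2 - y = (2^-1)%:C *: (y * (y - z) + (y - z) * z).
  transitivity ((2^-1)%:C *: (b + y * y) - (2^-1)%:C *: (b + z * z)); first by [].
  bop_ring.
apply: ppolyZ half_ge0 _; apply: PPD; apply: ppolyM => //; exact: sqrt_iter_ppoly.
Qed.

Lemma sqrt_iter_le1 b n : pos b -> pos (1 - b) -> pos (1 - sqrt_iter b n).
Proof.
move=> pb p1; elim: n => [|n ih] /=; first by rewrite subr0; exact: pos1.
set y := sqrt_iter b n in ih *.
have py : pos y by apply: ppoly_pos pb (sqrt_iter_ppoly b n).
have h := pos_sq_le py ih.
have -> : 1 - (2^-1)%:C *: (b + y * y) = (2^-1)%:C *: ((1 - b) + ((y - y * y) + (1 - y))).
  bop_ring.
apply: posZ half_ge0 _; apply: posD => //; exact: posD.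
Qed.

(** At the limit y the iteration reads 2 y = b + y^2, that is (1 - y)^2 = 1 - b. Commutation and
    membership in an algebra hold for every iterate and pass to the strong limit. *)
Lemma sqrt_complement b : pos b -> pos (1 - b) -> exists s,
  [/\ pos s, s * s = 1 - b, (forall c, comm c b -> comm c s) &
   (forall A, vNset A -> A 1 -> A b -> A s)].
Proof.
move=> pb p1.
have py n : pos (sqrt_iter b n) by apply: ppoly_pos pb (sqrt_iter_ppoly b n).
have [y [sy cy _ y1]] := @monotone_limit R H (sqrt_iter b) 1
  (fun n => (py n).1) (fun n => ppoly_pos pb (sqrt_iter_inc b n)) (fun n => sqrt_iter_le1 n pb p1).
exists (1 - y); split => //.
- have yE : y = (2^-1)%:C *: (b + y * y).
    apply: scv_unique (scvS cy) _; apply: scvZ; apply: scvD; first exact: scv_cst.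
    apply: (@scvM _ _ 1 _ _ _ _ _ cy cy) => n u; rewrite mul1r.
    exact: pos_contr (py n) (sqrt_iter_le1 n pb p1) u.
  have yE2 : y + y = b + y * y.
    rewrite {1 2}yE -scalerDl -rmorphD /= (_ : 2^-1 + 2^-1 = 1 :> R) ?rmorph1 ?scale1r //.
    by field.
  have -> : b = y + y - y * y by rewrite yE2 addrK.
  bop_ring.
- move=> c cb; apply: commB; first exact: comm1.
  by apply: comm_scv cy => n; exact: ppoly_comm cb (sqrt_iter_ppoly b n).
- move=> A hA A1 Ab; apply: (vNB hA) => //; apply: (vN_scv hA) cy.
  elim=> [|n ih] /=; first exact: vN0.
  by apply: (vNZ hA); apply: (vND hA) => //; exact: vNM.
Qed.

End FunctionalCalculus.

(** * Projections and partial isometries *)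

Section SpectralTools.
Variables (R : realType) (H : hilbert R).
Implicit Types (u v w : H) (a b c x y p q s : bop H) (A : set (bop H)).
Let dp := rdot_psd H.
Local Notation rI r := (r%:C *: (1 : bop H)).

Lemma bop_sqrt a : pos a -> exists s,
  [/\ pos s, s * s = a, (forall c, comm c a -> comm c s) &
   (forall A, vNset A -> A 1 -> A a -> A s)].
Proof.
move=> pa; have [K K0 hK] := sa_bound pa.1.
have K1 : 0 <= K^-1 by rewrite invr_ge0 ltW.
have KK : K^-1 * K = 1 by rewrite mulVf // gt_eqF.
have aE : 1 - (1 - (K^-1)%:C *: a) = (K^-1)%:C *: a by rewrite opprB addrC subrK.
have [||s [ps sE cs As]] := @sqrt_complement R H (1 - (K^-1)%:C *: a).
- have -> : 1 - (K^-1)%:C *: a = (K^-1)%:C *: (rI K - a) :> bop H.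
    by rewrite scalerBr scalerA -rmorphM /= KK rmorph1 scale1r.
  exact: posZ.
- by rewrite aE; exact: posZ.
rewrite aE in sE; exists ((Num.sqrt K)%:C *: s); split.
- by apply: posZ => //; exact: sqrtr_ge0.
- rewrite -bopZAl -bopZAr sE !scalerA -!rmorphM /=.
  by rewrite -expr2 sqr_sqrtr ?(ltW K0) // mulfV ?gt_eqF // rmorph1 scale1r.
- by move=> c ca; apply/commZ/cs/commB; [exact: comm1 | exact: commZ].
- move=> A hA A1 Aa; apply: (vNZ hA); apply: As => //.
  by apply: (vNB hA) => //; exact: (vNZ hA).
Qed.

(** With s the square root of a, commutation with b gives a b = s b s. *)
Lemma pos_mul a b : pos a -> pos b -> comm a b -> pos (a * b).
Proof.
move=> pa pb ab; have [s [ps sE cs _]] := bop_sqrt pa.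
have sb : s * b = b * s by apply/esym/cs.
by rewrite -sE -mulrA sb mulrA; have := pos_sandwich s pb; rewrite ps.1.
Qed.

Definition proj p := p^# = p /\ p * p = p.

Lemma proj_pos p : proj p -> pos p.
Proof. by move=> [sp pp]; rewrite -pp -{1}sp; exact: pos_sq. Qed.
Lemma projC p : proj p -> proj (1 - p).
Proof.
move=> [sp pp]; split; first by rewrite starB star1 sp.
by rewrite mulrBl mul1r mulrBr mulr1 pp subrr subr0.
Qed.
Lemma proj1 : proj (1 : bop H). Proof. by split; [exact: star1 | exact: mulr1]. Qed.
Lemma proj0 : proj (0 : bop H). Proof. by split; [exact: star0 | exact: mulr0]. Qed.

Lemma proj_scv (s : nat -> bop H) p : (forall n, proj (s n)) -> scv s p -> proj p.
Proof.
move=> hs sp.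
have ss : p^# = p.
  apply/esym/star_unique => u v; rewrite (psdC dp u).
  apply: (fcvg_dot_eq2 (sp u) (sp v)) => n.
  by rewrite starE (hs n).1 (psdC dp).
split => //; apply: scv_unique (sp).
apply: (@scv_eq _ _ (fun n => s n * s n)); first by move=> n; exact: (hs n).2.
apply: (@scvM _ _ 1 _ _ _ _ _ sp sp) => n u.
by rewrite mul1r starE (hs n).1 -bopM (hs n).2 -subr_ge0 -(psdBr dp) (psdC dp); exact: (proj_pos (projC (hs n))).2.
Qed.

(** s is the limit of 1 - (1 - c^2/K)^n: powers of the contraction 1 - c^2/K decrease to the
    projection onto the kernel of c. *)
Lemma support_proj c : c^# = c -> exists s,
  [/\ proj s, c * s = c, (forall x, c * x = 0 -> s * x = 0),
      (forall x, comm x c -> comm x s) & (forall A, vNset A -> A c -> A s)].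
Proof.
move=> sc.
have [K K0 hK] := @sa_bound R H (c * c) (ltac:(by rewrite starM sc)).
have K1 : 0 <= K^-1 by rewrite invr_ge0 ltW.
have KK : K^-1 * K = 1 by rewrite mulVf // gt_eqF.
pose t := (K^-1)%:C *: (c * c); pose b := 1 - t.
have pt : pos t by apply: posZ => //; rewrite -{1}sc; exact: pos_sq.
have pb : pos b.
  have -> : b = (K^-1)%:C *: (rI K - c * c).
    by rewrite scalerBr scalerA -rmorphM /= KK rmorph1 scale1r.
  exact: posZ.
have bt : 1 - b = t by rewrite opprB addrC subrK.
have cbX n : comm b (b ^+ n) by apply/commX/comm_refl.
have inc n : pos (1 - b ^+ n.+1 - (1 - b ^+ n)).
  have -> : 1 - b ^+ n.+1 - (1 - b ^+ n) = b ^+ n * (1 - b) by rewrite exprSr; bop_ring.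
  apply: pos_mul; [exact: pos_X | by rewrite bt |].
  by apply: commB; [exact: comm1 | exact/commC/cbX].
have bd n : pos (1 - (1 - b ^+ n)) by rewrite opprB addrC subrK; exact: pos_X.
have sa n : (1 - b ^+ n)^# = 1 - b ^+ n by rewrite starB star1 starX pb.1.
have [s [ss cs _ _]] := @monotone_limit R H (fun n => 1 - b ^+ n) 1 sa inc bd.
have b1s : b * (1 - s) = 1 - s.
  apply: scv_unique (scvMl b (scvB (scv_cst (1 : bop H)) cs)) _.
  apply: scv_eq (scvB (scv_cst (1 : bop H)) (scvS cs)) => n.
  by rewrite !opprB !(addrC 1) !subrK exprS.
have t1s : t * (1 - s) = 0.
  have : (1 - t) * (1 - s) = 1 - s by [].
  rewrite mulrBl mul1r => h.
  by rewrite -[t * _]opprK -[- (t * _)](addKr (1 - s)) h addNr oppr0.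
have cc1s : c * c * (1 - s) = 0.
  have -> : c * c = K%:C *: t by rewrite scalerA -rmorphM mulfV ?gt_eqF // rmorph1 scale1r.
  by rewrite -bopZAl t1s scaler0.
have c1s : c * (1 - s) = 0.
  apply: star_mul0; rewrite starM sc -mulrA [c * (c * _)]mulrA cc1s mulr0 //.
have sx x : c * x = 0 -> s * x = 0.
  move=> cx; apply: scv_unique (scvMr x cs) _.
  apply: scv_eq (scv_cst (0 : bop H)) => n; apply/esym.
  rewrite mulrBl mul1r; have -> : b ^+ n * x = x; last by rewrite subrr.
  elim: n => [|n ih]; first by rewrite expr0 mul1r.
  rewrite exprS -mulrA ih /b mulrBl mul1r /t -bopZAl -mulrA cx mulr0 scaler0 subr0 //.
exists s; split => //.
- split => //; have := sx _ c1s; rewrite mulrBr mulr1 => /eqP.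
  by rewrite subr_eq0 => /eqP.
- by move: c1s; rewrite mulrBr mulr1 => /eqP; rewrite subr_eq0 => /eqP.
- move=> x xc; apply: comm_scv cs => n; apply: commB; first exact: comm1.
  by apply/commX/commB; [exact: comm1 | exact/commZ/commM].
- move=> A hA Ac; apply: (vN_scv hA) cs.
  have At : A t by apply: (vNZ hA); exact: (vNM hA).
  elim=> [|n ih]; first by rewrite expr0 subrr; exact: vN0.
  (* Written without constant term, so that s lies in A even if A does not contain the identity. *)
  have -> : 1 - b ^+ n.+1 = (1 - b ^+ n) + (t - (1 - b ^+ n) * t).
    rewrite exprSr /b mulrBl mul1r mulrBr mulr1; bop_ring.
  by apply: (vND hA) => //; apply: (vNB hA) => //; exact: (vNM hA).
Qed.

(** With b = |a|, p is the complement of the support of b - a. As (b - a)(b + a) = 0, a agrees with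
    b on p and with -b on 1 - p. *)
Lemma spectral_split a : a^# = a -> exists p,
  [/\ proj p, pos (p * a), pos (- ((1 - p) * a)), (forall x, comm x a -> comm x p) &
      (forall A, vNset A -> A 1 -> A a -> A p)].
Proof.
move=> sa.
have [b [pb bb cb Ab]] := @bop_sqrt (a * a) (ltac:(by rewrite -{1}sa; exact: pos_sq)).
have ab : comm a b by apply/cb/commM; exact: comm_refl.
have sc : (b - a)^# = b - a by rewrite starB sa pb.1.
have [s [[ss sss] cs sx sC As]] := support_proj sc.
have sba : s * (b + a) = 0.
  apply: sx; rewrite mulrBl !mulrDr bb ab.
  by rewrite [X in _ - X]addrC subrr.
have pba : (1 - s) * (b - a) = 0.
  apply: star_inj; rewrite starM sc starB star1 ss star0 mulrBr mulr1 cs subrr //.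
have pa : (1 - s) * a = (1 - s) * b.
  by move: pba; rewrite mulrBr => /eqP; rewrite subr_eq0 => /eqP.
have sa' : (1 - (1 - s)) * a = - (s * b).
  rewrite opprB addrC subrK; apply/eqP; rewrite -addr_eq0 -mulrDr addrC sba //.
have cbs x : comm x a -> comm x s.
  by move=> xa; apply/sC/commB => //; apply/cb/commM.
exists (1 - s); split.
- exact: projC.
- rewrite pa; apply: pos_mul => //; first by apply/proj_pos/projC.
  by apply/commC/commB; [exact: comm1 | apply/sC/commB => //; exact/commC].
- rewrite sa' opprK; apply: pos_mul => //; first exact: proj_pos.
  by apply/commC/sC/commB => //; exact/commC.
- by move=> x xa; apply: commB; [exact: comm1 | exact: cbs].
- move=> A hA A1 Aa; apply: (vNB hA) => //; apply: As => //; apply: (vNB hA) => //.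
  by apply: Ab => //; exact: (vNM hA).
Qed.

(** The Neumann series. Its partial sums increase and are bounded by 1/(1 - r), and b^n, a
    difference of consecutive ones, tends to 0. *)
Lemma geometric_inverse b (r : R) : pos b -> r < 1 -> pos (rI r - b) -> exists s,
  [/\ pos s, s * (1 - b) = 1, (forall c, comm c b -> comm c s) &
   (forall A, vNset A -> A 1 -> A b -> A s)].
Proof.
move=> pb r1 prb.
pose S n := \sum_(k < n) b ^+ k.
have pS n : pos (S n) by apply: pos_sum => k _; exact: pos_X.
have S1 n : S n * (1 - b) = 1 - b ^+ n.
  elim: n => [|n ih]; first by rewrite /S big_ord0 mul0r expr0 subrr.
  rewrite /S big_ord_recr /= mulrDl [X in X + _]ih mulrBr mulr1 exprSr.
  by rewrite addrA subrK.
have cS c n : comm c b -> comm c (S n).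
  move=> cb; elim: n => [|n ih]; first by rewrite /S big_ord0 /comm mulr0 mul0r.
  by rewrite /S big_ord_recr; apply: commD => //; exact: commX.
have d0 : 0 < 1 - r by lra.
have d1 : 0 <= (1 - r)^-1 by rewrite invr_ge0 ltW.
have bd n : pos (rI (1 - r)^-1 - S n).
  have -> : rI (1 - r)^-1 - S n =
     ((1 - r)^-1)%:C *: (b ^+ n + S n * (rI r - b)).
    have -> : S n * (rI r - b) = (1 - b ^+ n) - (1 - r)%:C *: S n.
      by rewrite -S1; move: (S n) => x; bop_ring.
    rewrite addrA [b ^+ n + _]addrC subrK scalerBr scalerA -rmorphM /= mulVf ?gt_eqF //.
    by rewrite rmorph1 scale1r.
  apply: posZ => //; apply: posD; first exact: pos_X.
  apply: pos_mul => //; apply: commB; first by apply: commZ; exact: comm1.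
  by apply/commC/cS.
have [s [ss cs _ _]] := @monotone_limit R H S _ (fun n => (pS n).1)
  (ltac:(by move=> n; rewrite /S big_ord_recr /= addrAC subrr add0r; exact: pos_X)) bd.
have cb0 : scv (fun n => b ^+ n) 0.
  have h := scvB (scvS cs) cs; rewrite subrr in h.
  by apply: scv_eq h => n; rewrite /S big_ord_recr /= addrAC subrr add0r.
exists s; split.
- split => // u; apply: fcvg_dot_ge (cs u) _ => n; exact: (pS n).2.
- apply: scv_unique (scvMr (1 - b) cs) _.
  have h := scvB (scv_cst (1 : bop H)) cb0; rewrite subr0 in h.
  by apply: scv_eq h => n; rewrite S1.
- by move=> c cb; apply: comm_scv cs => n; exact: cS.
- move=> A hA A1 Ab; apply: (vN_scv hA) cs => n; apply: (vN_sum hA) => k _.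
  exact: (vN_X hA).
Qed.

(* Polar decomposition of x restricted to a spectral projection of x^# x on which
   x^# x is bounded below. *)
Lemma partial_isometry_of A x : vNset A -> A 1 -> A x -> x != 0 -> exists v : bop H,
  [/\ A v, v != 0, proj (v^# * v), (forall q, q * x = x -> q * v = v) &
      forall p, p^# = p -> x * p = x -> v * p = v].
Proof.
move=> hA A1 Ax x0; pose a := x^# * x.
have pa : pos a := pos_sq x.
have Aa : A a by apply: (vNM hA) => //; exact: (vNstar hA).
(* A level e above which a has a nonzero spectral projection p; without one, a <= e for all e > 0
   would force a = 0. *)
have [e e0 ne] : exists2 e : R, 0 < e & ~ pos (rI e - a).
  apply: contrapT => h.
  have {}h (e : R) : 0 < e -> pos (rI e - a).
    by move=> e0; apply: contrapT => ne; apply: h; exists e.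
  move/negP: x0; apply; apply/eqP/star_mul0/sa_quad0; first exact: pa.1.
  move=> u; apply/eqP; rewrite eq_le pa.2 andbT.
  apply/ler_addgt0Pl => d d0; rewrite addr0.
  have u0 : 0 < <<u, u>> + 1 by have := psd_ge0 dp u; lra.
  have [_ /(_ u)] := h _ (divr_gt0 d0 u0).
  rewrite !bopE (psdBl dp) (psdZl dp) subr_ge0 => h2; apply: le_trans h2 _.
  by rewrite mulrAC ler_pdivrMr // ler_wpM2l ?(ltW d0) //; lra.
have sae : (a - rI e)^# = a - rI e by rewrite starB pa.1 starZr star1.
have [p [pp ppos pneg pcomm Ap]] := spectral_split sae.
have cae y : comm y a -> comm y (a - rI e).
  by move=> ya; apply: commB => //; apply/commZ/comm1.
have pca y : comm y a -> comm y p by move=> ya; exact/pcomm/cae.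
have cap : comm a p by apply/pca/comm_refl.
have p0 : p != 0.
  apply/eqP => p0; apply: ne; move: pneg; rewrite p0 subr0 mul1r opprB //.
have [K K0 hK] := sa_bound pa.1.
have KK : K^-1 * K = 1 by rewrite mulVf // gt_eqF.
have K1 : 0 < K^-1 by rewrite invr_gt0.
pose t := (K^-1)%:C *: a.
have pt1 : pos (1 - t).
  have -> : 1 - t = (K^-1)%:C *: (rI K - a).
    by rewrite scalerBr scalerA -rmorphM /= KK rmorph1 scale1r.
  exact: posZ (ltW K1) hK.
(* On p one has a >= e, so b <= 1 - e/K < 1 and 1 - b is invertible, with p (1 - b) = p t. Its
   inverse is K times the inverse of a on p, so the v below is x times the inverse square root of a
   there. *)
pose b := p * (1 - t).
have cpt : comm p t by apply/commZ/commC.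
have pb : pos b.
  by apply: pos_mul => //; [exact: proj_pos | apply: commB => //; exact: comm1].
have r1 : 0 < e / K by rewrite divr_gt0.
have prb : 0 <= 1 - e / K -> pos (rI (1 - e / K) - b).
  move=> r0.
  have -> : rI (1 - e / K) - b = (1 - e / K)%:C *: (1 - p) + (K^-1)%:C *: (p * (a - rI e)).
    by rewrite /b /t; bop_ring.
  apply: posD; apply: posZ => //; first by apply/proj_pos/projC.
  exact: ltW.
have r0 : 0 <= 1 - e / K.
  rewrite leNgt; apply/negP => r0; move/eqP: p0; apply.
  have ekK : K <= e by move: r0; rewrite subr_lt0 ltr_pdivlMr // mul1r => /ltW.
  apply: contrapT => p0; apply: ne.
  have -> : rI e - a = (rI K - a) + (e - K)%:C *: (1 : bop H) by bop_ring.
  by apply: posD => //; apply: posZ; [rewrite subr_ge0 | exact: pos1].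
have Ab : A b.
  apply: (vNM hA); last by apply: (vNB hA) => //; exact: (vNZ hA).
  by apply: Ap => //; apply: (vNB hA) => //; exact: (vNZ hA).
have Apx : A p by apply: Ap => //; apply: (vNB hA) => //; exact: (vNZ hA).
have [s [ps s1 sc As]] := geometric_inverse pb (ltac:(lra) : 1 - e / K < 1) (prb r0).
have [r [pr rr rc Ar]] := bop_sqrt ps.
have rca y : comm y a -> comm y r.
  move=> ya; apply/rc/sc/commM; first exact: pca.
  by apply: commB; [exact: comm1 | exact: commZ].
have cpb : comm p b.
  by apply: commM; [exact: comm_refl | apply: commB => //; exact: comm1].
have cpr : comm p r by apply/rca/commC.
have car : comm a r by apply/rca/comm_refl.
pose v := (Num.sqrt K^-1)%:C *: (x * p * r).
have kE : (Num.sqrt K^-1) * (Num.sqrt K^-1) = K^-1 by rewrite -expr2 sqr_sqrtr // ltW.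
have vv : v^# * v = p.
  rewrite /v starZr -bopZAl -bopZAr scalerA -rmorphM /= kE !starM pr.1 pp.1.
  have e1 : p * x^# * (x * p) = p * a.
    by rewrite mulrA -(mulrA p) -/a -mulrA cap mulrA pp.2.
  have -> : r * (p * x^#) * (x * p * r) = p * a * (r * r).
    rewrite -mulrA (mulrA (p * x^#)) e1 mulrA [in RHS]mulrA; congr (_ * _).
    by apply/esym; apply/commC; apply: commM; exact/commC.
  have ptE : p * t = p * (1 - b).
    by rewrite mulrBr mulr1 /b !mulrA pp.2 mulrBr mulr1 opprB addrC subrK.
  rewrite rr bopZAl bopZAr -/t ptE -mulrA.
  have -> : (1 - b) * s = s * (1 - b).
    by apply/commC; apply: commB; [exact: comm1 | exact/commC/sc/comm_refl].
  by rewrite s1 mulr1.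
exists v; split.
- apply: (vNZ hA); apply: (vNM hA); first exact: (vNM hA).
  by apply: Ar => //; apply: As.
- by apply/eqP => v0; move/eqP: p0; apply; rewrite -vv v0 mulr0.
- by rewrite vv.
- by move=> q qx; rewrite /v -bopZAr !mulrA qx.
- move=> q sq xq; rewrite /v -bopZAl; congr (_ *: _).
  have qa : comm q a.
    have aq : a * q = a by rewrite -mulrA xq.
    by have := congr1 (@star R H) aq; rewrite starM sq pa.1 => h; rewrite /comm h aq.
  by rewrite -mulrA -(rca _ qa) mulrA -[x * p * q]mulrA -(pca _ qa) !mulrA xq.
Qed.

End SpectralTools.

(** * Strong-* density *)

Section StrongStarDensity.
Variables (R : realType) (H : hilbert R) (k : nat).
Local Notation V := ('I_k -> H).
Implicit Types (u v w z : V) (a b x : bop H).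
Let dp := rdot_psd H.

Definition dotk u v : R := \sum_i <<u i, v i>>.

Lemma dotk_psd : @psd R V dotk.
Proof.
split.
- by move=> u v w; rewrite /dotk -big_split /=; apply: eq_bigr => i _; rewrite fctE (psdDl dp).
- by move=> r u v; rewrite /dotk mulr_sumr; apply: eq_bigr => i _; rewrite fctE (psdZl dp).
- by move=> u v; apply: eq_bigr => i _; rewrite (psdC dp).
- by move=> u; apply: sumr_ge0 => i _; exact: psd_ge0.
Qed.
Let kp := dotk_psd.

Lemma dotk_ge u i : <<u i, u i>> <= dotk u u.
Proof.
rewrite /dotk (bigD1 i) //= lerDl; apply: sumr_ge0 => j _; exact: psd_ge0.
Qed.

Lemma dotk_eq0 u : dotk u u = 0 -> u = 0.
Proof.
move=> h; apply/funext => i; apply: rdot_eq0; apply/le_anti.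
by rewrite (psd_ge0 dp) andbT -h dotk_ge.
Qed.

Lemma dotk_lt (e : R) u : 0 < e -> (forall i, <<u i, u i>> < e / k.+1%:R) -> dotk u u < e.
Proof.
move=> e0 h; apply: (@le_lt_trans _ _ (\sum_(i < k) e / k.+1%:R)).
  by apply: ler_sum => i _; exact: ltW.
rewrite sumr_const card_ord -[X in X < _]mulr_natr mulrAC ltr_pdivrMr ?ltr0n //.
by rewrite ltr_pM2l // ltr_nat.
Qed.

Lemma dotk_cvg (s : nat -> V) u : (forall i, fcvg (@rdot R H) (fun n => s n i) (u i)) ->
  @fcvg R V dotk s u.
Proof.
move=> h e e0; have e1 : 0 < e / k.+1%:R by rewrite divr_gt0 ?ltr0n.
have [N hN] := choice (fun i => h i _ e1).
exists (\max_i N i)%N => n Nn; apply: dotk_lt => // i.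
by apply: hN; apply: leq_trans Nn; exact: leq_bigmax.
Qed.

Lemma dotk_complete (s : nat -> V) : @fcauchy R V dotk s -> exists v, @fcvg R V dotk s v.
Proof.
move=> hs.
have hi i : exists y : H, fcvg (@rdot R H) (fun n => s n i) y.
  apply: hilbert_complete => e /hs [N hN]; exists N => m n Nm Nn.
  by apply: le_lt_trans (hN m n Nm Nn); exact: (dotk_ge (s m - s n) i).
by have [v hv] := choice hi; exists v; exact: dotk_cvg.
Qed.

Definition act a u : V := fun i => a (u i).

Lemma dotk_star a u v : dotk (act a u) v = dotk u (act (a^#) v).
Proof. by apply: eq_bigr => i _; rewrite starE. Qed.

(** A vector xi of H^k encodes k vectors of H at once. The projection P onto the closure of A xi
    commutes with A; approximation of x and [x^#] on D, with no norm bound, is enough for x to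
    commute with P, hence for x xi to lie in that closure. *)
Lemma strong_star_dense (A : set (bop H)) x (D : set H) : vNset A ->
  (forall (u : H) (e : R), 0 < e -> exists2 d, D d & << u - d, u - d>> < e) ->
  (forall (s : seq H) (e : R), (forall d, d \in s -> D d) -> 0 < e -> exists2 a, A a &
     forall d, d \in s -> <<x d - a d, x d - a d>> < e /\ <<x^# d - a^# d, x^# d - a^# d>> < e) ->
  forall xi : V, forall e : R, 0 < e -> exists2 a, A a &
     dotk (act x xi - act a xi) (act x xi - act a xi) < e.
Proof.
move=> hA dD hx xi.
pose S : set V := [set w | exists2 a, A a & w = act a xi].
pose cl v := forall e : R, 0 < e -> exists2 w, S w & dotk (v - w) (v - w) < e.
have S0 : S 0 by exists 0; [exact: vN0 | apply/funext].
have SD u v : S u -> S v -> S (u + v).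
  by move=> [a Aa ->] [b Ab ->]; exists (a + b); [exact: vND | apply/funext].
have SZ (r : R) u : S u -> S (r%:C *: u).
  by move=> [a Aa ->]; exists (r%:C *: a); [exact: vNZ | apply/funext].
have SA a u : A a -> S u -> S (act a u).
  by move=> Aa [b Ab ->]; exists (a * b); [exact: vNM | apply/funext].
have hP u : exists v, cl v /\ forall w, S w -> dotk v w = dotk u w.
  have [] := @psd_riesz R V dotk kp S (dotk u) (dotk u u) S0 SD SZ.
  - by move=> v w _ _; rewrite (psdDr kp).
  - by move=> r v _; rewrite (psdZr kp).
  - exact: (psd_ge0 kp).
  - by move=> v _; exact: psdCS.
  - by move=> s _; exact: dotk_complete.
  by move=> v hv; exists v.
have [P PP] := choice hP.
have orth_cl z v : (forall w, S w -> dotk z w = 0) -> cl v -> dotk z v = 0.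
  move=> hz hv; apply/eqP; rewrite -sqrf_eq0 eq_le sqr_ge0 andbT.
  apply/ler_addgt0Pl => e e0; rewrite addr0.
  have C1 : 0 < dotk z z + 1 by have := psd_ge0 kp z; lra.
  have [w Sw hw] := hv _ (divr_gt0 e0 C1).
  have -> : dotk z v = dotk z (v - w) by rewrite (psdBr kp) (hz w) // subr0.
  apply: le_trans (psdCS kp _ _) _; move: hw; rewrite ltr_pdivlMr // => hw.
  by have := psd_ge0 kp (v - w); have := psd_ge0 kp z; nra.
have Pcl u v : cl v -> dotk (P u) v = dotk u v.
  move=> cv; apply/eqP; rewrite -subr_eq0 -(psdBl kp); apply/eqP/orth_cl => // w Sw.
  by rewrite (psdBl kp) ((PP u).2 w) // subrr.
have Psym u v : dotk (P u) v = dotk u (P v).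
  have h1 := Pcl u _ (PP v).1; have h2 := Pcl v _ (PP u).1.
  by rewrite (psdC kp) -h2 (psdC kp).
have Puniq u v : cl v -> (forall w, S w -> dotk v w = dotk u w) -> P u = v.
  move=> cv hv; apply/eqP; rewrite -subr_eq0; apply/eqP/dotk_eq0.
  have h w : S w -> dotk (P u - v) w = 0.
    by move=> Sw; rewrite (psdBl kp) ((PP u).2 w) // (hv w) // subrr.
  by rewrite (psdBr kp) !orth_cl ?subrr //; exact: (PP u).1.
have PS w : S w -> P w = w.
  by move=> Sw; apply: Puniq => // e e0; exists w => //; rewrite subrr (psd0l kp).
have clA a u : A a -> cl u -> cl (act a u).
  move=> Aa cu e e0; have [C C0 hC] := bop_bd a.
  have C1 : 0 < C + 1 by lra.
  have [w Sw hw] := cu _ (divr_gt0 e0 C1); exists (act a w); first exact: SA.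
  apply: (@le_lt_trans _ _ (C * dotk (u - w) (u - w))).
    rewrite /dotk mulr_sumr; apply: ler_sum => i _; rewrite !fctE /act -bopBv.
    exact: hC.
  by move: hw; rewrite ltr_pdivlMr // => hw; have := psd_ge0 kp (u - w); nra.
have PA a u : A a -> P (act a u) = act a (P u).
  move=> Aa; apply: Puniq; first by apply: clA => //; exact: (PP u).1.
  move=> w Sw; rewrite !dotk_star (PP u).2 //; apply: SA => //; exact: vNstar.
have dense z : (forall w : V, (forall i, D (w i)) -> dotk z w = 0) -> z = 0.
  move=> hz; apply: dotk_eq0; apply/eqP/negPn/negP => n0.
  have z0 : 0 < dotk z z by rewrite lt_def n0 (psd_ge0 kp).
  have hd i : exists d : H, D d /\ <<z i - d, z i - d>> < dotk z z / k.+1%:R.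
    have [d Dd h] := dD (z i) _ (divr_gt0 z0 (ltr0Sn R k)).
    by exists d.
  have [w hw] := choice hd.
  have Dw : forall i, D (w i) by move=> i; case: (hw i).
  have := psdCS kp z (z - w); rewrite (psdBr kp) (hz w) => [|i]; last (by case: (hw i)); rewrite subr0.
  have h1 : dotk (z - w) (z - w) < dotk z z by apply: dotk_lt => // i; case: (hw i).
  by move=> h2; nra.
have approx u v : (forall i, D (u i)) -> (forall i, D (v i)) -> exists a : nat -> bop H,
   [/\ forall n, A (a n), @fcvg R V dotk (fun n => act (a n) u) (act x u) &
       @fcvg R V dotk (fun n => act ((a n)^#) v) (act (x^#) v)].
  move=> Du Dv; pose l := codom u ++ codom v.
  have Dl d : d \in l -> D d by rewrite mem_cat => /orP[] /codomP[i ->].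
  have h n : exists a, A a /\ forall d, d \in l -> <<x d - a d, x d - a d>> < n.+1%:R^-1 /\ <<x^# d - a^# d, x^# d - a^# d>> < n.+1%:R^-1.
    have [a Aa ha] := hx l n.+1%:R^-1 Dl (ltac:(by rewrite invr_gt0 ltr0n)).
    by exists a.
  have [a ha] := choice h; exists a; split => [n||]; first by case: (ha n).
    apply: dotk_cvg => i e /inv_lt_ex [N hN]; exists N => n /hN.
    apply: lt_trans; have [_ /(_ (u i))] := ha n.
    by rewrite mem_cat codom_f => /(_ isT) [].
  apply: dotk_cvg => i e /inv_lt_ex [N hN]; exists N => n /hN.
  apply: lt_trans; have [_ /(_ (v i))] := ha n.
  by rewrite mem_cat codom_f orbT => /(_ isT) [].
(* Tested against vectors with entries in the dense set D, where the relation P a = a P passes to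
   the limit. *)
have step1 w : (forall i, D (w i)) -> P (act (x^#) w) = act (x^#) (P w).
  move=> Dw; apply/eqP; rewrite -subr_eq0; apply/eqP/dense => u Du.
  rewrite (psdBl kp) Psym (psdC kp (act _ (P w))) -dotk_star (psdC kp (act _ w)).
  rewrite -[X in X - _](psdC kp).
  have [a [Aa au aw]] := approx u w Du Dw.
  apply/eqP; rewrite subr_eq0; apply/eqP; apply: (psd_cvg_eq2 kp aw au) => n.
  by rewrite (psdC kp) -dotk_star -PA // Psym.
have step2 u : P (act x u) = act x (P u).
  apply/eqP; rewrite -subr_eq0; apply/eqP/dense => w Dw.
  by rewrite (psdBl kp) Psym !dotk_star Psym -step1 // subrr.
(* Since A need not contain the identity, xi may lie outside the closure of A xi. But every a in A
   kills xi - P xi, hence so does x. *)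
have zx : act x (xi - P xi) = 0.
  apply: dense => w Dw; rewrite dotk_star (psdC kp).
  have [a [Aa _ aw]] := approx w w Dw Dw.
  have c0 : @fcvg R V dotk (fun=> 0) 0 by move=> e e0; exists 0%N => n _; rewrite subrr (psd0l kp).
  apply: eq_trans (psd_cvg_eq2 (w := xi - P xi) (z := 0) kp aw c0 _) (psd0l kp _) => n.
  rewrite (psd0l kp) (psdC kp) -dotk_star.
  have -> : act (a n) (xi - P xi) = 0; last by rewrite (psd0l kp).
  have -> : act (a n) (xi - P xi) = act (a n) xi - act (a n) (P xi).
    by apply/funext => i; rewrite /act !fctE bopBv.
  rewrite -PA // PS ?subrr //; by exists (a n).
have xE : act x xi = P (act x xi).
  rewrite step2; apply/eqP; rewrite -subr_eq0 -zx; apply/eqP/funext => i.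
  by rewrite /act !fctE bopBv.
move=> e e0; have [_ [a Aa ->] h] := (PP (act x xi)).1 e e0.
by exists a => //; rewrite {1 2}xE.
Qed.

End StrongStarDensity.

Lemma vN_strong_star (R : realType) (H : hilbert R) (A : set (bop H)) (x : bop H) (D : set H) :
  vNset A ->
  (forall u (e : R), 0 < e -> exists2 d, D d & << u - d, u - d>> < e) ->
  (forall (s : seq H) (e : R), (forall d, d \in s -> D d) -> 0 < e -> exists2 a, A a &
     forall d, d \in s -> <<x d - a d, x d - a d>> < e /\ <<x^# d - a^# d, x^# d - a^# d>> < e) ->
  A x.
Proof.
move=> hA dD hx; apply: (vN_strong hA) => s e e0.
have [a Aa ha] := strong_star_dense hA dD hx (fun i : 'I_(size s) => nth 0 s i) e0.
exists a => // u us; apply: le_lt_trans ha.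
have iu : (index u s < size s)%N by rewrite index_mem.
have := dotk_ge (act x (fun i : 'I_(size s) => nth 0 s i) - act a (fun i => nth 0 s i)) (Ordinal iu).
by rewrite !fctE /act /= nth_index.
Qed.

(** * Factors and traces *)

Section MaximalElements.
Variable R : realType.

(* Brezis-Browder: a bounded monotone functional yields maximal elements without Zorn. *)
Lemma brezis_browder (T : Type) (le : T -> T -> Prop) (phi : T -> R) (B : R) :
  (forall x, le x x) -> (forall x y z, le x y -> le y z -> le x z) ->
  (forall x y, le x y -> phi x <= phi y) -> (forall x, phi x <= B) ->
  (forall s : nat -> T, (forall n, le (s n) (s n.+1)) -> exists u, forall n, le (s n) u) ->
  forall x0, exists x, le x0 x /\ forall y, le x y -> phi y = phi x.
Proof.
move=> refl trans mono bd ub x0.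
(* Each step realises at least half of the gain still possible. *)
have step x : exists y, le x y /\ forall z, le x z -> phi z - phi x <= 2 * (phi y - phi x).
  pose E := [set phi z | z in le x].
  have hE : has_sup E.
    by split; [exists (phi x), x; first exact: refl | exists B => _ [z _ <-]].
  have Ele z : le x z -> phi z <= sup E.
    by move=> xz; apply: ub_le_sup; [case: hE | exists z].
  have [e0|e0] := leP (sup E - phi x) 0.
    exists x; split => // z /Ele; lra.
  have [_ [y xy <-] hy] := sup_adherent (divr_gt0 e0 (ltr0Sn R 1)) hE.
  exists y; split => // z /Ele; move: hy; rewrite ltrBlDr; lra.
have [f fP] := choice step.
pose s := fix s n := if n is m.+1 then f (s m) else x0.
have inc n : le (s n) (s n.+1) by case: (fP (s n)).
have [u hu] := ub s inc.
exists u; split; first exact: (hu 0%N).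
move=> y uy; apply/eqP; rewrite eq_le (mono _ _ uy) andbT leNgt; apply/negP => lt.
(* If some y above u had a larger value, every step would gain at least half of phi y - phi u, which
   exceeds the bound B after finitely many steps. *)
have grow n : phi x0 + n%:R * ((phi y - phi u) / 2) <= phi (s n).
  elim: n => [|n ih]; first by rewrite mul0r addr0.
  have [_ /(_ y (trans _ _ _ (hu n) uy))] := fP (s n).
  have := mono _ _ (hu n); rewrite -[phi (s n.+1)]/(phi (f (s n))) -(natr1 n) [(n%:R + 1) * _]mulrDl [1 * (_ / _)]mul1r; move: ih; move: (n%:R * _) => z. lra.
have d0 : 0 < (phi y - phi u) / 2 by rewrite divr_gt0 // subr_gt0.
pose n := Num.bound ((B - phi x0) / ((phi y - phi u) / 2)).
have : (B - phi x0) / ((phi y - phi u) / 2) < n%:R.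
  apply: archi_boundP; rewrite divr_ge0 ?(ltW d0) // subr_ge0; exact: bd.
rewrite ltr_pdivrMr // => h; have := grow n; have := bd (s n); move: h; move: (n%:R * _) => z. lra.
Qed.
End MaximalElements.

(** * Projections in a factor with a faithful trace *)

Section FactorTheory.
Variables (R : realType) (H : hilbert R).
Implicit Types (u : H) (a b c x y p q g v w : bop H) (A B : set (bop H)).
Let dp := rdot_psd H.

(** A relation c x d = c' x d' involves x only at the vectors d u and d' u, so it survives strong
    limits; ideals, corners and commutants are closed for this reason. *)
Lemma adherent_eq B c d c' d' x : (forall b, B b -> c * b * d = c' * b * d') ->
  strong_adherent B x -> c * x * d = c' * x * d'.
Proof.
move=> hB hx; apply: bop_ext => u; apply/eqP; rewrite -subr_eq0; apply/eqP/rdot_eq0.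
apply/eqP; rewrite eq_le (psd_ge0 dp) andbT; apply/ler_addgt0Pl => e e0; rewrite addr0.
have [C C0 hC] := bop_bd c; have [D D0 hD] := bop_bd c'.
have K0 : 0 < 2 * C + 2 * D + 1 by lra.
have [b Bb hb] := hx [:: d u; d' u] _ (divr_gt0 e0 K0).
have h1 := hb (d u) (mem_head _ _).
have h2 := hb (d' u) (ltac:(by rewrite in_cons mem_head orbT)).
have e1 : c (b (d u)) = c' (b (d' u)) by have /(congr1 (fun z : bop H => z u)) := hB _ Bb.
have := psd_tri2 dp (c (x (d u))) (c (b (d u))) (c' (x (d' u))).
rewrite -bopBv e1 (psd_swap2 dp (c' _)) -bopBv.
have := hC (x (d u) - b (d u)); have := hD (x (d' u) - b (d' u)).
have := psd_ge0 dp (x (d u) - b (d u)); have := psd_ge0 dp (x (d' u) - b (d' u)).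
move: h1 h2; rewrite !ltr_pdivlMr //; rewrite !bopE.
move: <<x (d u) - b (d u), _>> <<x (d' u) - b (d' u), _>> => X Y.
move: (<<c _, c _>>) (<<c' _, c' _>>) (<<_ - _, _ - _>>) => P Q Z.
by nra.
Qed.

Lemma strong_adherentS A B x : A `<=` B -> strong_adherent A x -> strong_adherent B x.
Proof. by move=> AB hx s e /(hx s) [b /AB Bb hb]; exists b. Qed.

Definition factor A := [/\ vNset A, A 1 &
  forall x, A x -> (forall y, A y -> comm x y) -> exists k, x = k *: (1 : bop H)].

(** Real part of a faithful trace, linear over the reals and not normalised; normality is stated
    apart in [seqnormal]. *)
Definition ftrace A (t : bop H -> R) :=
  [/\ (forall (r : R) a b, A a -> A b -> t (r%:C *: a + b) = r * t a + t b),
      (forall a b, A a -> A b -> t (a * b) = t (b * a)),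
      (forall a, A a -> 0 <= t (a^# * a)) &
      (forall a, A a -> t (a^# * a) = 0 -> a = 0)].

Definition ple p q := q * p = p.

Lemma ple_sym p q : proj p -> proj q -> ple p q -> p * q = p.
Proof. by move=> [sp _] [sq _] /(congr1 (@star R H)); rewrite starM sp sq. Qed.
Lemma ple_refl p : proj p -> ple p p. Proof. by case. Qed.
Lemma ple_trans p q g : ple p q -> ple q g -> ple p g.
Proof. by rewrite /ple => pq qg; rewrite -pq mulrA qg. Qed.
Lemma projB p q : proj p -> proj q -> ple p q -> proj (q - p).
Proof.
move=> hp hq pq; have qp := ple_sym hp hq pq; case: hp hq => [sp pp] [sq qq].
split; first by rewrite starB sp sq.
by rewrite mulrBl !mulrBr qq pq qp pp subrr subr0.
Qed.
Lemma projD p q : proj p -> proj q -> p * q = 0 -> proj (p + q).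
Proof.
move=> [sp pp] [sq qq] pq.
have qp : q * p = 0 by apply: star_inj; rewrite starM sp sq pq star0.
split; first by rewrite starD sp sq.
by rewrite mulrDl !mulrDr pp qq pq qp addr0 add0r.
Qed.

Lemma proj_seq_sup (s : nat -> bop H) : (forall n, proj (s n)) ->
  (forall n, ple (s n) (s n.+1)) ->
  exists p, [/\ proj p, scv s p & forall n, ple (s n) p].
Proof.
move=> hs inc.
have [p [_ sp _ _]] := @monotone_limit R H s 1 (fun n => (hs n).1)
  (fun n => proj_pos (projB (hs n) (hs n.+1) (inc n))) (fun n => proj_pos (projC (hs n))).
exists p; split => //; first exact: proj_scv sp.
have incm m n : (n <= m)%N -> ple (s n) (s m).
  move=> /subnK <-; elim: (m - n)%N => [|k ih]; first exact/ple_refl.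
  by rewrite addSn; exact: ple_trans ih (inc _).
move=> n; rewrite /ple.
have h : scv (fun m => s (m + n)%N) p.
  by move=> u e /(sp u) [N hN]; exists N => k Nk; apply: hN; exact: leq_trans (leq_addr _ _).
apply: scv_unique (scvMr (s n) h) _; apply: scv_eq (scv_cst (s n)) => m.
by rewrite incm // leq_addl.
Qed.

Variables (A : set (bop H)) (t : bop H -> R).
Hypotheses (hA : vNset A) (A1 : A 1) (ht : ftrace A t).

Lemma tC a b : A a -> A b -> t (a * b) = t (b * a). Proof. by case: ht => _ h _ _; exact: h. Qed.
Lemma tD a b : A a -> A b -> t (a + b) = t a + t b.
Proof. by case: ht => h _ _ _ Aa Ab; have := h 1 a b Aa Ab; rewrite rmorph1 scale1r mul1r. Qed.
Lemma t0 : t 0 = 0.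
Proof. by apply: (addIr (t 0)); rewrite -tD ?addr0 ?add0r //; exact: vN0. Qed.
Lemma tZ (r : R) a : A a -> t (r%:C *: a) = r * t a.
Proof. by case: ht => h _ _ _ Aa; have := h r a 0 Aa (vN0 hA); rewrite t0 !addr0. Qed.
Lemma tN a : A a -> t (- a) = - t a.
Proof. by move=> /(tZ (-1)); rewrite mulN1r rmorphN rmorph1 scaleN1r. Qed.
Lemma tB a b : A a -> A b -> t (a - b) = t a - t b.
Proof. by move=> Aa Ab; rewrite tD ?tN //; exact: vNN. Qed.
Lemma t_sum I (s : seq I) (P : pred I) (F : I -> bop H) : (forall i, P i -> A (F i)) ->
  t (\sum_(i <- s | P i) F i) = \sum_(i <- s | P i) t (F i).
Proof.
move=> hF; elim: s => [|i s ih]; first by rewrite !big_nil t0.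
rewrite !big_cons; case: ifP => // Pi.
by rewrite tD ?ih //; [exact: hF | exact: (vN_sum hA)].
Qed.
Lemma t_sq_ge0 a : A a -> 0 <= t (a^# * a). Proof. by case: ht => _ _ h _; exact: h. Qed.
Lemma t_sq_eq0 a : A a -> t (a^# * a) = 0 -> a = 0. Proof. by case: ht => _ _ _ h; exact: h. Qed.
Lemma t_pos a : A a -> pos a -> 0 <= t a.
Proof.
move=> Aa pa; have [s [ps sE _ As]] := bop_sqrt pa.
by rewrite -sE -{1}ps.1; apply: t_sq_ge0; exact: As.
Qed.
Lemma t_proj p : proj p -> t p = t (p^# * p). Proof. by case=> -> ->. Qed.
Lemma t_proj_ge0 p : A p -> proj p -> 0 <= t p.
Proof. by move=> Ap hp; rewrite t_proj //; exact: t_sq_ge0. Qed.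
Lemma t_proj_eq0 p : A p -> proj p -> t p = 0 -> p = 0.
Proof. by move=> Ap hp; rewrite t_proj //; exact: t_sq_eq0. Qed.
Lemma t_proj_gt0 p : A p -> proj p -> p <> 0 -> 0 < t p.
Proof.
move=> Ap hp p0; rewrite lt_def t_proj_ge0 // andbT.
by apply/eqP => /(t_proj_eq0 Ap hp).
Qed.
Lemma t_ple p q : A p -> A q -> proj p -> proj q -> ple p q -> t p <= t q.
Proof.
move=> Ap Aq hp hq pq; rewrite -subr_ge0 -tB //.
by apply: t_proj_ge0; [exact: vNB | exact: projB].
Qed.
Lemma ple1 p : ple p 1. Proof. exact: mul1r. Qed.
Lemma t_le1 p : A p -> proj p -> t p <= t 1.
Proof. by move=> Ap hp; apply: t_ple => //; [exact: proj1 | exact: ple1]. Qed.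

Hypothesis hZ : forall x, A x -> (forall y, A y -> comm x y) -> exists k, x = k *: (1 : bop H).

(** If q A p = 0, the x with x A p = 0 = p A x form a strongly closed two-sided ideal J of A that
    contains q. Its largest projection is central, hence equal to 1 in a factor, which forces p =
    0. *)
Lemma factor_connect p q : A p -> A q -> proj p -> proj q -> p <> 0 -> q <> 0 ->
  exists2 x, A x & q * x * p <> 0.
Proof.
move=> Ap Aq hp hq p0 q0; apply: contrapT => hno.
have qxp x : A x -> q * x * p = 0.
  by move=> Ax; apply: contrapT => h; apply: hno; exists x.
pose J : set (bop H) := [set x | A x /\ forall y, A y -> x * y * p = 0 /\ p * y * x = 0].
have JA : J `<=` A by move=> x [].
have hJ : vNset J.
  split.
  - split; first by split => [|y _]; [exact: vN0 | rewrite !mul0r mulr0].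
    move=> k a b [Aa ha] [Ab hb]; split; first exact: vNlin.
    move=> y Ay; have [h1 h2] := ha y Ay; have [h3 h4] := hb y Ay.
    rewrite !mulrDl h3 mulrDr h4 -bopZAr -mulrA -bopZAl mulrA h1 h2 !scaler0 !addr0 //.
  - move=> a b [Aa ha] [Ab hb]; split; first exact: (vNM hA).
    move=> y Ay; split.
      by rewrite -(mulrA a) (ha _ (vNM hA Ab Ay)).1.
    by rewrite mulrA -(mulrA p) (hb _ (vNM hA Ay Aa)).2.
  - move=> a [Aa ha]; split; first exact: vNstar.
    move=> y Ay; have [h1 h2] := ha _ (vNstar hA Ay).
    split; apply: star_inj; rewrite !starM ?starK hp.1 star0 mulrA //.
  - move=> x hx; split; first exact/(vN_strong hA)/(strong_adherentS JA).
    move=> y Ay; split.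
      have := @adherent_eq J 1 (y * p) 0 0 x; rewrite mul1r mulr0 mulrA; apply => // b [_ /(_ y Ay) [h _]].
      by rewrite mul1r mulr0 mulrA.
    have := @adherent_eq J (p * y) 1 0 0 x; rewrite mulr1 mulr0; apply => // b [_ /(_ y Ay) [_ h]].
    by rewrite mulr1 mulr0.
have Jq : J q.
  split => // y Ay; split; first exact: qxp.
  have := qxp _ (vNstar hA Ay) => /(congr1 (@star R H)).
  by rewrite !starM starK hp.1 hq.1 star0 mulrA.
pose T := {x : bop H | J x /\ proj x}.
have Tsup (s : nat -> T) : (forall n, ple (sval (s n)) (sval (s n.+1))) ->
    exists u : T, forall n, ple (sval (s n)) (sval u).
  move=> hs; have [w [pw sw hw]] := proj_seq_sup (fun n => (svalP (s n)).2) hs.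
  by exists (exist _ w (conj (vN_scv hJ (fun n => (svalP (s n)).1) sw) pw)).
have [[z [Jz pz]] [/= qz zmax]] := @brezis_browder R T (fun x y : T => ple (sval x) (sval y))
  (fun x : T => t (sval x)) (t 1)
  (fun x : T => ple_refl (svalP x).2) (fun x y w : T => @ple_trans (sval x) (sval y) (sval w))
  (fun x y : T => t_ple (JA _ (svalP x).1) (JA _ (svalP y).1) (svalP x).2 (svalP y).2)
  (fun x : T => t_le1 (JA _ (svalP x).1) (svalP x).2) Tsup (exist _ q (conj Jq hq)).
(* Otherwise the support of y y^#, with y = x z - z x z, would be a nonzero projection of J
   orthogonal to z, and adding it would increase the trace. *)
have zx x : A x -> x * z = z * (x * z).
  move=> Ax; have Jxz : J (x * z).
    have [Az hz] := Jz; split; first exact: (vNM hA).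
    move=> y Ay; split; first by rewrite -!mulrA (mulrA z) (hz _ Ay).1 mulr0.
    by rewrite mulrA -(mulrA p) (hz _ (vNM hA Ay Ax)).2.
  pose y := x * z - z * (x * z).
  have Jy : J y by apply: (vNB hJ) => //; exact: (vNM hJ).
  have zy : z * y = 0 by rewrite mulrBr [X in _ - X]mulrA pz.2 subrr.
  have sc : (y * y^#)^# = y * y^# by rewrite starM starK.
  have [s [ps cs sx _ As]] := support_proj sc.
  have Js : J s by apply: As => //; apply: (vNM hJ) => //; exact: vNstar.
  have sz : s * z = 0.
    by apply: sx; rewrite -mulrA (_ : y^# * z = 0) ?mulr0 //; apply: star_inj; rewrite starM starK pz.1 zy star0.
  have zs : z * s = 0 by apply: star_inj; rewrite starM ps.1 pz.1 sz star0.
  have pzs : proj (z + s) := projD pz ps zs.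
  have := zmax (exist _ (z + s) (conj (vND hJ Jz Js) pzs)).
  rewrite /= tD; [|exact: JA|exact: JA] => h.
  have s0 : s = 0.
    apply: t_proj_eq0 => //; first exact: JA.
    have := h (ltac:(by rewrite /ple mulrDl pz.2 sz addr0)) => /(congr1 (fun r => r - t z)).
    by rewrite addrC addKr subrr.
  have y0 : y = 0.
    apply: star_inj; rewrite star0; apply: star_mul0; rewrite starK -cs s0 mulr0 //.
  by apply/eqP; rewrite -subr_eq0 -/y y0.
have [|k zk] := hZ Jz.1.
  move=> y Ay; rewrite /comm; have := zx _ (vNstar hA Ay) => /(congr1 (@star R H)).
  by rewrite !starM starK pz.1 -mulrA => ->; rewrite [RHS]zx.
have z0 : z <> 0 by move=> z0; apply: q0; rewrite -qz z0 mul0r.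
have k0 : k != 0 by apply/eqP => k0; apply: z0; rewrite zk k0 scale0r.
have z1 : z = 1.
  have : k^-1 *: (z * z) = k^-1 *: z by rewrite pz.2.
  by rewrite {1 3}zk -bopZAl mul1r !scalerA mulVf // !scale1r.
have [_ /(_ 1 A1) []] := Jz; rewrite z1 !mul1r => /p0 //.
Qed.

End FactorTheory.

(** * Comparison of projections *)

Section Comparison.
Variables (R : realType) (H : hilbert R).
Implicit Types (u : H) (a b c x y p q g v w : bop H).
Let dp := rdot_psd H.

Lemma pisomK v : proj (v^# * v) -> v * (v^# * v) = v.
Proof.
move=> h; apply/eqP; rewrite eq_sym -subr_eq0.
have -> : v - v * (v^# * v) = v * (1 - v^# * v) by rewrite mulrBr mulr1.
apply/eqP/star_mul0; rewrite starM (projC h).1 -mulrA (mulrA v^#).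
by rewrite [v^# * v * _]mulrBr mulr1 h.2 subrr mulr0.
Qed.
Lemma pisom_star v : proj (v^# * v) -> proj (v * v^#).
Proof.
move=> h; split; first by rewrite starM starK.
by rewrite -mulrA (mulrA v^#) mulrA pisomK.
Qed.
Lemma pisomKl v : proj (v^# * v) -> v * v^# * v = v.
Proof. by move=> /pisomK; rewrite mulrA. Qed.

(** Each partial isometry extends the previous one, so |s_m u - s_n u| is at most |(e_m - e_n) u|
    for the initial projections e_n, and these converge. *)
Lemma pisom_seq_sup (s : nat -> bop H) :
  (forall n, proj ((s n)^# * s n)) ->
  (forall n, s n.+1 * ((s n)^# * s n) = s n /\ ple ((s n)^# * s n) ((s n.+1)^# * s n.+1)) ->
  exists v, [/\ scv s v, proj (v^# * v) & forall n, v * ((s n)^# * s n) = s n /\ ple ((s n)^# * s n) (v^# * v)].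
Proof.
move=> hs inc.
have [e [pe se he]] := proj_seq_sup hs (fun n => (inc n).2).
have incm m n : (n <= m)%N -> s m * ((s n)^# * s n) = s n.
  move=> /subnK <-; elim: (m - n)%N => [|k ih]; first exact: pisomK.
  have pl : ple ((s n)^# * s n) ((s (k + n)%N)^# * s (k + n)%N).
    elim: k {ih} => [|k ih]; first exact/ple_refl.
    by rewrite addSn; exact: ple_trans ih (inc _).2.
  by rewrite addSn -[in LHS]pl mulrA (inc _).1.
have nrm n u : << s n u, s n u>> = <<((s n)^# * s n) u, u>>.
  by rewrite bopM starEr.
have contr n u : << s n u, s n u>> <= 1 * <<u, u>>.
  rewrite mul1r nrm -subr_ge0 -(psdBl dp).
  exact: (proj_pos (projC (hs n))).2.
have projn q u : proj q -> <<q u, u>> = <<q u, q u>>.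
  by move=> [sq qq]; rewrite (starE q u (q u)) sq -bopM qq (psdC dp).
have key m n u : (n <= m)%N -> << s m u - s n u, s m u - s n u>> <=
    <<((s m)^# * s m) u - ((s n)^# * s n) u, ((s m)^# * s m) u - ((s n)^# * s n) u>>.
  move=> nm.
  have -> : s m u - s n u = s m (((s m)^# * s m) u - ((s n)^# * s n) u).
    rewrite bopBv -[s m (((s n)^# * s n) u)]bopM incm //.
    by rewrite -[s m (((s m)^# * s m) u)]bopM pisomK.
  by apply: le_trans (contr _ _) _; rewrite mul1r.
have [] := @scv_limit R H 1 s ler01 contr.
  move=> u d d0; have d1 : 0 < d / 4 by rewrite divr_gt0.
  have [N hN] := se u _ d1.
  have hc m n : (N <= m)%N -> (N <= n)%N ->
    <<((s m)^# * s m) u - ((s n)^# * s n) u, ((s m)^# * s m) u - ((s n)^# * s n) u>> < d.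
    move=> Nm Nn; have := psd_tri2 dp (((s m)^# * s m) u) (e u) (((s n)^# * s n) u).
    by rewrite (psd_swap2 dp _ (e u)); have := hN _ Nm; have := hN _ Nn; lra.
  exists N => m n Nm Nn; have [nm|mn] := leqP n m; first by apply: le_lt_trans (key _ _ _ nm) _; exact: hc.
  by rewrite (psd_swap2 dp); apply: le_lt_trans (key _ _ _ (ltnW mn)) _; exact: hc.
move=> v sv; exists v.
have vs n : v * ((s n)^# * s n) = s n.
  have sh : scv (fun m => s (m + n)%N * ((s n)^# * s n)) (v * ((s n)^# * s n)).
    by apply: scvMr => u d /(sv u) [N hN]; exists N => k Nk; apply: hN; exact: leq_trans (leq_addr _ _).
  apply: scv_unique sh _; apply: scv_eq (scv_cst (s n)) => m.
  by rewrite incm // leq_addl.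
have ve : v * e = v.
  apply/eqP; rewrite -subr_eq0; apply/eqP.
  have h := scvB (scvMr e sv) sv; apply: scv_unique h _.
  apply: scv_eq (scv_cst 0) => n.
  by rewrite -{1 2}(pisomK (hs n)) -mulrA (ple_sym (hs n) pe (he n)) subrr.
have ee : e * (v^# * v * e) = e.
  have h : scv (fun n => ((s n)^# * s n) * (v^# * v * ((s n)^# * s n))) (e * (v^# * v * e)).
    apply: (@scvM _ _ 1 _ _ _ _ _ se); last exact: scvMl.
    by move=> n u; rewrite -projn // mul1r -nrm; have := contr n u; rewrite mul1r.
  apply: scv_unique h _; apply: scv_eq se => n.
  rewrite -(mulrA (v^#)) vs mulrA.
  have <- : (s n)^# = (s n)^# * s n * v^# by rewrite -[in LHS](vs n) starM (hs n).1.
  by [].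
have {}ve : v^# * v = e.
  have ev : e * v^# = v^# by rewrite -[in RHS]ve starM pe.1.
  by rewrite -[RHS]ee -(mulrA (v^#)) ve mulrA ev.
split => //; first by rewrite ve.
by move=> n; rewrite ve; split; [exact: vs | exact: he].
Qed.

Variables (A : set (bop H)) (t : bop H -> R).
Hypotheses (hF : factor A) (ht : ftrace A t).
Let hA : vNset A. Proof. by case: hF. Qed.
Let A1 : A 1. Proof. by case: hF. Qed.
Let hZ := let: And3 _ _ h := hF in h.

Lemma vN_sq v : A v -> A (v^# * v).
Proof. by move=> Av; apply: (vNM hA) => //; exact: vNstar. Qed.
Lemma vN_sqr v : A v -> A (v * v^#).
Proof. by move=> Av; apply: (vNM hA) => //; exact: vNstar. Qed.

(** Among partial isometries from p into q ordered by extension, take one whose initial projection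
    has maximal trace. If something remained on both sides, the polar part of a nonzero (q - v v^#)
    x (p - v^# v) would extend it. *)
Lemma comparison p q : A p -> A q -> proj p -> proj q -> exists v,
  [/\ A v, proj (v^# * v), v * p = v, q * v = v & v^# * v = p \/ v * v^# = q].
Proof.
move=> Ap Aq hp hq.
pose P v := [/\ A v, proj (v^# * v), v * p = v & q * v = v].
pose T := {v | P v}.
pose le (v w : T) := sval w * ((sval v)^# * sval v) = sval v /\ ple ((sval v)^# * sval v) ((sval w)^# * sval w).
have PA (v : T) : A (sval v) by case: (svalP v).
have PP (v : T) : proj ((sval v)^# * sval v) by case: (svalP v).
have P0 : P 0.
  by split; rewrite ?mulr0 ?mul0r //; [exact: vN0 | exact: proj0].
have le_refl (v : T) : le v v by split; [exact: pisomK | exact/ple_refl].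
have le_trans (x y z : T) : le x y -> le y z -> le x z.
  move=> [h1 h2] [h3 h4]; split; last exact: ple_trans h4.
  by rewrite -[in LHS]h2 mulrA h3.
have le_mono (x y : T) : le x y -> t ((sval x)^# * sval x) <= t ((sval y)^# * sval y).
  by move=> [_ h]; apply: (t_ple hA ht) => //; exact: vN_sq.
have le_bd (x : T) : t ((sval x)^# * sval x) <= t 1.
  by apply: (t_le1 hA A1 ht) => //; exact: vN_sq.
have le_sup (s : nat -> T) : (forall n, le (s n) (s n.+1)) -> exists u : T, forall n, le (s n) u.
  move=> hs; have [v [sv pv hv]] := pisom_seq_sup (fun n => PP (s n)) hs.
  have Pv : P v.
    split => //; first exact: (vN_scv hA) (fun n => PA (s n)) sv.
      apply: scv_unique (scvMr p sv) _; apply: scv_eq sv => n.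
      by case: (svalP (s n)).
    apply: scv_unique (scvMl q sv) _; apply: scv_eq sv => n.
    by case: (svalP (s n)).
  by exists (exist _ v Pv).
have [[v [Av pv vp qv]] [_ /= vmax]] := brezis_browder le_refl le_trans le_mono le_bd le_sup (exist _ 0 P0).
exists v; split => //.
have le1 : ple (v^# * v) p.
  by rewrite /ple mulrA -{1}hp.1 -starM vp.
have le2 : ple (v * v^#) q by rewrite /ple mulrA qv.
have pv' := pisom_star pv.
have [->|/eqP p0] := eqVneq (v^# * v) p; first by left.
have [->|/eqP q0] := eqVneq (v * v^#) q; first by right.
exfalso.
have Ap' : A (p - v^# * v) by apply: (vNB hA) => //; exact: vN_sq.
have Aq' : A (q - v * v^#) by apply: (vNB hA) => //; exact: vN_sqr.
have hp' := projB pv hp le1; have hq' := projB pv' hq le2.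
have [x Ax nx] := factor_connect hA A1 ht hZ Ap' Aq' hp' hq'
  (ltac:(by move/eqP; rewrite subr_eq0 eq_sym => /eqP))
  (ltac:(by move/eqP; rewrite subr_eq0 eq_sym => /eqP)).
have [w [Aw w0 pw lw rw]] := partial_isometry_of hA A1
  (vNM hA (vNM hA Aq' Ax) Ap') (introN eqP nx).
have qw : (q - v * v^#) * w = w by apply: lw; rewrite !mulrA hq'.2.
have wp : w * (p - v^# * v) = w by apply: rw; [exact: hp'.1 | rewrite -mulrA hp'.2].
have vsK : v^# * v * v^# = v^#.
  by have := congr1 (@star R H) (pisomKl pv); rewrite !starM starK mulrA.
have vw : v^# * w = 0.
  rewrite -qw mulrA mulrBr; have -> : v^# * q = v^#.
    by rewrite -hq.1 -starM qv.
  by rewrite mulrA vsK subrr mul0r.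
have wv : w^# * v = 0 by rewrite -[w^# * v]starK starM starK vw star0.
have vw' : v * w^# = 0.
  rewrite -wp starM hp'.1 mulrA mulrBr vp pisomK // subrr mul0r //.
have e1 : (v + w)^# * (v + w) = v^# * v + w^# * w.
  by rewrite starD mulrDl !mulrDr vw wv addr0 add0r.
have vvww : (v^# * v) * (w^# * w) = 0.
  by rewrite -mulrA (mulrA v) vw' mul0r mulr0.
have Pvw : P (v + w).
  split; first exact: (vND hA).
  - by rewrite e1; apply: projD.
  - by rewrite mulrDl vp -{1}wp -mulrA [(p - _) * p]mulrBl hp.2 -mulrA vp wp.
  - rewrite mulrDr qv -{1}qw mulrA [q * (q - _)]mulrBr hq.2 mulrA qv qw //.
have := vmax (exist _ _ Pvw); rewrite /= e1 (tD ht (vN_sq Av) (vN_sq Aw)) => h.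
have : t (w^# * w) = 0.
  apply: (addrI (t (v^# * v))); rewrite addr0; apply: h.
  split => /=.
    rewrite mulrDl pisomK // -[RHS]addr0; congr (_ + _).
    by rewrite mulrA -[w * v^#]starK starM starK vw' star0 mul0r.
  by rewrite /ple e1 mulrDl pv.2 -[RHS]addr0; congr (_ + _);
    apply: star_inj; rewrite star0 starM pv.1 starM starK.
by move/(t_sq_eq0 ht Aw)/eqP; apply/negP.
Qed.

End Comparison.

(** * Tilings by a small projection and uniqueness of the trace *)

Section Tilings.
Variables (R : realType) (H : hilbert R).
Implicit Types (u : H) (a b c x y p q g v : bop H).
Let dp := rdot_psd H.

(* p is the orthogonal sum of n copies of g, given by w 1, ..., w n, and of a
   remainder w 0 equivalent to a subprojection of g. *)
Definition tiling (A : set (bop H)) p g n (w : nat -> bop H) :=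
  [/\ (forall i, (i <= n)%N -> A (w i) /\ w i * g = w i),
      (forall i, (0 < i <= n)%N -> (w i)^# * w i = g),
      proj ((w 0%N)^# * w 0%N),
      (forall i j, (i <= n)%N -> (j <= n)%N -> i != j -> (w i)^# * w j = 0) &
      \sum_(i < n.+1) w i * (w i)^# = p].

Section TilingTheory.
Variables (A : set (bop H)) (p g : bop H) (n : nat) (w : nat -> bop H).
Hypotheses (hw : tiling A p g n w) (hg : proj g).

Lemma tilingA i : (i <= n)%N -> A (w i). Proof. by case: hw => h _ _ _ _ /h []. Qed.
Lemma tilingg i : (i <= n)%N -> w i * g = w i. Proof. by case: hw => h _ _ _ _ /h []. Qed.
Lemma tiling_proj i : (i <= n)%N -> proj ((w i)^# * w i).
Proof.
case: hw => _ h1 h2 _ _; case: i => [//|i] hi.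
by rewrite h1.
Qed.
Lemma tiling_absorb j : (j <= n)%N -> p * w j = w j.
Proof.
case: (hw) => _ _ _ ho <- hj.
have hj' : (j < n.+1)%N by [].
rewrite mulr_suml (bigD1 (Ordinal hj')) //= big1 ?addr0.
  by rewrite -mulrA pisomK //; exact: tiling_proj.
move=> i ij; rewrite -mulrA ho ?mulr0 //; first by rewrite -ltnS.
Qed.
Lemma tilinggl i : (i <= n)%N -> g * (w i)^# = (w i)^#.
Proof. by move=> hi; rewrite -[in LHS]hg.1 -starM tilingg. Qed.
End TilingTheory.

Variables (A : set (bop H)) (t : bop H -> R).
Hypotheses (hF : factor A) (ht : ftrace A t).
Let hA : vNset A. Proof. by case: hF. Qed.
Let A1 : A 1. Proof. by case: hF. Qed.

(** Each full tile has trace t g, and the remainder has trace between 0 and t g. *)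
Lemma tiling_trace p g n w : A g -> proj g -> tiling A p g n w ->
  n%:R * t g <= t p <= n.+1%:R * t g.
Proof.
move=> Ag hg hw; have [_ h1 h2 _ h4] := hw.
have tw i : (i <= n)%N -> t (w i * (w i)^#) = t ((w i)^# * w i).
  move=> hi; have Aw := tilingA hw hi; apply: (tC ht) => //; exact: (vNstar hA).
have -> : t p = t ((w 0%N)^# * w 0%N) + n%:R * t g.
  rewrite -h4 (t_sum hA ht); last first.
    by move=> i _; apply: (vN_sqr hF); apply: (tilingA hw); rewrite -ltnS.
  rewrite big_ord_recl /= tw //; congr (_ + _).
  rewrite (eq_bigr (fun=> t g)) ?sumr_const ?card_ord ?mulr_natl //.
  by move=> i _; rewrite /bump /= add1n tw ?h1 ?ltn_ord.
have A0 := tilingA hw (leq0n n).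
have h0 : 0 <= t ((w 0%N)^# * w 0%N) := t_sq_ge0 ht A0.
have h5 : t ((w 0%N)^# * w 0%N) <= t g.
  apply: (t_ple hA ht) => //; first exact: (vN_sq hF).
  by rewrite /ple mulrA (tilinggl hw hg).
by rewrite -[n.+1%:R]natr1 mulrDl mul1r [_ + t g]addrC lerDr h0 lerD2r.
Qed.

(** Induction on an integer exceeding t p / t g: by comparison either p embeds in g and is itself
    the remainder, or a copy of g is split off and becomes the last tile. *)
Lemma tiling_exists p g : A p -> A g -> proj p -> proj g -> g <> 0 ->
  exists n w, tiling A p g n w.
Proof.
move=> Ap Ag hp hg g0; have tg := t_proj_gt0 ht Ag hg g0.
have [m hm] : exists m, t p < m%:R * t g.
  exists (Num.bound (t p / t g)); rewrite -ltr_pdivrMr //.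
  by apply: archi_boundP; rewrite divr_ge0 ?(t_proj_ge0 ht) // ltW.
elim: m p Ap hp hm => [|m ih] p Ap hp hm.
  by move: hm; rewrite mul0r ltNge (t_proj_ge0 ht).
have [v [Av pv vp gv [vE|vE]]] := comparison hF ht Ap Ag hp hg.
  exists 0%N, (fun=> v^#); split.
  - by move=> i _; split; [exact: (vNstar hA) | rewrite -[in LHS]hg.1 -starM gv].
  - by case.
  - by rewrite starK; exact: pisom_star.
  - by do 2!case=> [|//].
  - by rewrite big_ord1 starK.
have pl : ple (v^# * v) p by rewrite /ple mulrA -[in LHS]hp.1 -starM vp.
have Av' := vNstar hA Av.
have Ap1 : A (p - v^# * v) by apply: (vNB hA) => //; exact: (vN_sq hF).
have hp1 := projB pv hp pl.
have [|n [w hw]] := ih _ Ap1 hp1.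
  rewrite (tB hA ht) //; last exact: (vN_sq hF).
  rewrite (tC ht Av' Av) vE.
  by move: hm; rewrite -natr1 mulrDl mul1r ltrBlDr.
have [_ h1 h2 h3 h4] := hw.
have vw j : (j <= n)%N -> v * w j = 0.
  move=> hj; rewrite -(tiling_absorb hw hg hj) mulrA mulrBr vp pisomK // subrr mul0r //.
exists n.+1, (fun i => if i == n.+1 then v^# else w i); split.
- move=> i; rewrite leq_eqVlt; case: eqP => [-> _|_ /= hi].
    by split; [exact: (vNstar hA) | rewrite -[in LHS]hg.1 -starM gv].
  by split; [exact: (tilingA hw) | exact: (tilingg hw)].
- move=> i; case: eqP => [-> _|ne /andP[i0 hi]]; first by rewrite starK.
  by apply: h1; rewrite i0 -ltnS ltn_neqAle hi andbT; apply/eqP.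
- by [].
- move=> i j; rewrite (leq_eqVlt i) (leq_eqVlt j).
  case: eqP => [-> _|_ /= hi]; case: eqP => [->|_ /= hj] //; rewrite ?eqxx //.
  + by move=> _; rewrite starK vw.
  + by move=> _ _; apply: star_inj; rewrite starM !starK star0 vw.
  + by apply: h3.
- rewrite big_ord_recr /= eqxx starK (eq_bigr (fun i : 'I_n.+1 => w i * (w i)^#)).
    by rewrite h4 subrK.
  by move=> i _; rewrite (ltn_eqF (ltn_ord i)).
Qed.

(** For self-adjoint a and any level s, the spectral projection of a - s meets g in 0 or g, so on
    the range of g the form of a lies on one side of s; the quotient [<<a w, w>> / <<w, w>>] is
    therefore constant. A general a splits into two self-adjoint parts. *)
Lemma minimal_proj_scalar g : A g -> proj g -> g <> 0 ->
  (forall p, A p -> proj p -> ple p g -> p = 0 \/ p = g) ->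
  forall a, A a -> g * a = a -> a * g = a -> exists k, a = k *: g.
Proof.
move=> Ag hg g0 gmin.
have main a : A a -> a^# = a -> g * a = a -> exists r : R, a = r%:C *: g.
  move=> Aa sa ga; have ag : a * g = a by rewrite -[in LHS]sa -{1}hg.1 -starM ga sa.
  have tri (s : R) : (forall w, g w = w -> s * <<w, w>> <= <<a w, w>>) \/
                     (forall w, g w = w -> <<a w, w>> <= s * <<w, w>>).
    have sas : (a - s%:C *: (1 : bop H))^# = a - s%:C *: (1 : bop H) by rewrite starB sa starZr star1.
    have [p [hp pp pn pc pA]] := spectral_split sas.
    have Ap : A p by apply: pA => //; apply: (vNB hA) => //; exact: (vNZ hA).
    have gp : comm g p.
      by apply: pc; apply: commB; [rewrite /comm ga ag | exact/commZ/comm1].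
    have hpg : proj (p * g).
      split; first by rewrite starM hp.1 hg.1 gp.
      by rewrite mulrA -(mulrA p g) gp mulrA hp.2 -mulrA hg.2.
    have [pg|pg] := gmin _ (vNM hA Ap Ag) hpg (ltac:(by rewrite /ple mulrA gp -mulrA hg.2)).
      right=> w gw; have [_ /(_ w)] := pn.
      have pw : p w = 0 by rewrite -gw -bopM pg.
      have cp : comm p (a - s%:C *: (1 : bop H)) by apply/commC/pc/comm_refl.
      have -> : - ((1 - p) * (a - s%:C *: (1 : bop H))) = (a - s%:C *: (1 : bop H)) * p - (a - s%:C *: (1 : bop H)).
        by rewrite -cp mulrBl mul1r opprB.
      by rewrite bopB bopM pw bop0v sub0r !bopE (psdNl dp) (psdBl dp) (psdZl dp) opprB subr_ge0.
    left=> w gw; have [_ /(_ w)] := pp.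
    have pw : p w = w by rewrite -{1}gw -bopM pg.
    have cp : comm p (a - s%:C *: (1 : bop H)) by apply/commC/pc/comm_refl.
    by rewrite cp bopM pw !bopE (psdBl dp) (psdZl dp) subr_ge0.
  have [u gu u0] : exists2 u, g u = u & <<u, u>> <> 0.
    apply: contrapT => h; apply: g0; apply: bop_ext => v; apply: rdot_eq0.
    by apply: contrapT => h2; apply: h; exists (g v) => //; rewrite -bopM hg.2.
  have up : 0 < <<u, u>> by rewrite lt_def (psd_ge0 dp) andbT; apply/eqP.
  have key (v w : H) : g v = v -> g w = w -> 0 < <<v, v>> -> 0 < <<w, w>> ->
      <<a v, v>> / <<v, v>> <= <<a w, w>> / <<w, w>>.
    move=> gv gw v0 w0; rewrite leNgt; apply/negP => lt.
    have [h|h] := tri ((<<a v, v>> / <<v, v>> + <<a w, w>> / <<w, w>>) / 2).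
      have := h w gw; rewrite -ler_pdivlMr //; lra.
    have := h v gv; rewrite -ler_pdivrMr //; lra.
  exists (<<a u, u>> / <<u, u>>); apply/eqP; rewrite -subr_eq0; apply/eqP/sa_quad0.
    by rewrite starB sa starZr hg.1.
  move=> v; rewrite !bopE (psdBl dp) (psdZl dp).
  have -> : <<a v, v>> = <<a (g v), g v>>.
    by rewrite -[in LHS]ga -[in LHS]ag mulrA !bopM starE hg.1.
  have -> : <<g v, v>> = <<g v, g v>> by rewrite -{1}hg.2 bopM starE hg.1.
  have ggv : g (g v) = g v by rewrite -bopM hg.2.
  have [z|nz] := eqVneq <<g v, g v>> 0.
    by rewrite z mulr0 (rdot_eq0 z) bop0v (psd0l dp) subrr.
  have gvp : 0 < <<g v, g v>> by rewrite lt_def nz (psd_ge0 dp).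
  have -> : <<a u, u>> / <<u, u>> = <<a (g v), g v>> / <<g v, g v>>.
    by apply/eqP; rewrite eq_le !key.
  by rewrite divfK // subrr.
move=> a Aa ga ag.
have As := vNstar hA Aa.
have gas : g * a^# = a^# by rewrite -{1}hg.1 -starM ag.
have [r hr] := main (a + a^#) (vND hA Aa As) (ltac:(by rewrite starD starK addrC))
  (ltac:(by rewrite mulrDr ga gas)).
have hi : Num.conj ('i%C : R[i]) = - 'i%C by apply: complex_eqP => /=; rewrite ?oppr0.
have [s hs] := main ('i%C *: (a - a^#)) (vNZ hA _ (vNB hA Aa As))
  (ltac:(by rewrite starZ hi starB starK scaleNr -scalerN opprB))
  (ltac:(by rewrite -bopZAr mulrBr ga gas)).
exists ((2^-1)%:C * (r%:C - 'i%C * s%:C)).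
have e2 : (2 : R)%:C *: a = (r%:C - 'i%C * s%:C) *: g.
  rewrite scalerBl -hr -scalerA -hs scalerA.
  have -> : 'i%C * 'i%C = -1 :> R[i] by rewrite -expr2 sqr_i.
  rewrite scaleN1r opprK; bop_ring.
rewrite -scalerA -e2 scalerA -rmorphM mulVf ?pnatr_eq0 // rmorph1 scale1r //.
Qed.

Hypothesis nfd : ~ exists (N : nat) (b : 'I_N -> bop H),
  forall x, A x -> exists c : 'I_N -> R[i], x = \sum_(i < N) c i *: b i.

(** If g were minimal, tiling 1 by g would make every w_i^# x w_j a multiple of g, so the finitely
    many w_i w_j^# would span A. *)
Lemma no_minimal_proj g : A g -> proj g -> g <> 0 ->
  exists p, [/\ A p, proj p, ple p g, p <> 0 & p <> g].
Proof.
move=> Ag hg g0; apply: contrapT => hno.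
have gmin p : A p -> proj p -> ple p g -> p = 0 \/ p = g.
  move=> Ap hp pg; have [?|/eqP p0] := eqVneq p 0; first by left.
  have [?|/eqP pg'] := eqVneq p g; first by right.
  by exfalso; apply: hno; exists p.
have hs := minimal_proj_scalar Ag hg g0 gmin.
have [n [w hw]] := tiling_exists A1 Ag (proj1 H) hg g0.
apply: nfd; pose I : finType := ('I_n.+1 * 'I_n.+1)%type.
pose ev (k : 'I_#|{: I}|) : 'I_n.+1 * 'I_n.+1 := enum_val k.
exists #|{: I}|, (fun k => w (ev k).1 * (w (ev k).2)^#) => x Ax.
have hc (ij : 'I_n.+1 * 'I_n.+1) : exists k, (w ij.1)^# * x * w ij.2 = k *: g.
  case: ij => i j /=; have hi : (i <= n)%N by rewrite -ltnS.
  have hj : (j <= n)%N by rewrite -ltnS.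
  apply: hs.
  - apply: (vNM hA); last exact: (tilingA hw).
    by apply: (vNM hA) => //; apply: (vNstar hA); exact: (tilingA hw).
  - by rewrite !mulrA (tilinggl hw hg).
  - by rewrite -mulrA (tilingg hw).
have [c hcE] := choice hc.
exists (fun k => c (ev k)).
rewrite -(big_enum_val (A := {: I}) (fun ij : I => c ij *: (w ij.1 * (w ij.2)^#))) /=.
have -> : \sum_(ij in {: I}) c ij *: (w ij.1 * (w ij.2)^#) =
   \sum_(i < n.+1) \sum_(j < n.+1) c (i, j) *: (w i * (w j)^#).
  by rewrite pair_bigA /=; apply: eq_bigr => -[i j].
have [_ _ _ _ s1] := hw.
rewrite -[LHS]mulr1 -[LHS]mul1r -s1 mulr_suml; apply: eq_bigr => i _.
rewrite !mulr_sumr; apply: eq_bigr => j _.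
have := hcE (i, j) => /= h.
have hi : (i <= n)%N by rewrite -ltnS.
rewrite -[w i in RHS](tilingg hw hi) -[in RHS]mulrA [RHS]bopZAr bopZAl -h.
by rewrite !mulrA.
Qed.

(** Of a proper subprojection and its complement one has at most half the trace; this halving is
    iterated. *)
Lemma small_proj f (d : R) : A f -> proj f -> f <> 0 -> 0 < d ->
  exists g, [/\ A g, proj g, ple g f, g <> 0 & t g <= d].
Proof.
move=> Af hf f0 d0.
have [k hk] : exists k, t f <= 2 ^+ k * d.
  exists (Num.bound (t f / d)); rewrite -ler_pdivrMr //.
  have := archi_boundP (ltac:(by rewrite divr_ge0 ?(t_proj_ge0 ht) // ltW) : 0 <= t f / d).
  move/ltW/le_trans; apply; rewrite -natrX ler_nat; exact/ltnW/ltn_expl.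
elim: k f Af hf f0 hk => [|k ih] f Af hf f0 hk.
  by exists f; split => //; [exact: ple_refl | rewrite expr0 mul1r in hk].
have [p [Ap hp pf p0 pnf]] := no_minimal_proj Af hf f0.
have [q [Aq hq qf q0 tq]] : exists q, [/\ A q, proj q, ple q f, q <> 0 & t q <= t f / 2].
  have [h|h] := leP (t p) (t f / 2); first by exists p.
  exists (f - p); split => //.
  - exact: (vNB hA).
  - exact: projB.
  - by rewrite /ple mulrBr hf.2 pf.
  - by move/eqP; rewrite subr_eq0 eq_sym => /eqP.
  - by rewrite (tB hA ht) //; lra.
have [|g [Ag hg gq g0 tg]] := ih q Aq hq q0.
  by apply: le_trans tq _; move: hk; rewrite exprS -mulrA; lra.
by exists g; split => //; exact: ple_trans gq qf.
Qed.

End Tilings.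

(** Tiling p and 1 by the same small g gives counts n and m that do not depend on the trace; both
    traces of p lie between n/(m + 1) and (n + 1)/m. *)
Lemma trace_unique_proj (R : realType) (H : hilbert R) (A : set (bop H)) (t1 t2 : bop H -> R) :
  factor A -> ftrace A t1 -> ftrace A t2 -> t1 1 = 1 -> t2 1 = 1 ->
  (~ exists (N : nat) (b : 'I_N -> bop H),
     forall x, A x -> exists c : 'I_N -> R[i], x = \sum_(i < N) c i *: b i) ->
  forall p, A p -> proj p -> t1 p = t2 p.
Proof.
move=> hF h1 h2 e1 e2 nfd p Ap hp.
have [hA A1 _] := hF.
have n1 : (1 : bop H) <> 0.
  by move=> z; have := t0 hA h1; rewrite -z e1 => /eqP; rewrite oner_eq0.
apply/eqP; rewrite -subr_eq0 -normr_le0; apply/ler_addgt0Pl => e e0; rewrite addr0.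
(* The bound t1 g <= e/(e + 2) gives e m >= 2, and since n <= m + 1 the two bounds differ by at most
   2/m <= e. *)
have d0 : 0 < e / (e + 2) by rewrite divr_gt0 //; lra.
have [g [Ag hg _ g0 tg]] := small_proj hF h1 nfd A1 (proj1 H) n1 d0.
have [n [w hw]] := tiling_exists hF h1 Ap Ag hp hg g0.
have [m [w' hw']] := tiling_exists hF h1 A1 Ag (proj1 H) hg g0.
have /andP[a1 a2] := tiling_trace hF h1 Ag hg hw.
have /andP[b1 b2] := tiling_trace hF h2 Ag hg hw.
have /andP[c1 c2] := tiling_trace hF h1 Ag hg hw'.
have /andP[d1 d2] := tiling_trace hF h2 Ag hg hw'.
have f1 := t_le1 hA A1 h1 Ap hp; have f2 := t_le1 hA A1 h2 Ap hp.
have g1 := t_proj_gt0 h1 Ag hg g0; have g2 := t_proj_gt0 h2 Ag hg g0.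
move: tg; rewrite ler_pdivlMr ?(addr_gt0 e0) // => tg.
rewrite e1 in f1 c1 c2; rewrite e2 in f2 d1 d2.
have m0 : (0 : R) <= m%:R := ler0n _ _.
have n0 : (0 : R) <= n%:R := ler0n _ _.
move: a1 a2 b1 b2 c1 c2 d1 d2; rewrite -!(natr1 n) -!(natr1 m).
move: (n%:R) (m%:R) n0 m0 (t1 g) (t2 g) (t1 p) (t2 p) g1 g2 tg f1 f2 => {hw hw' n m w w'} n m n0 m0 x y P Q x0 y0 tg f1 f2.
move=> a1 a2 b1 b2 c1 c2 d1 d2.
have nm : n <= m + 1 by rewrite -(ler_pM2r x0); lra.
have em : 2 <= e * m by nra.
have mp : 0 < m by nra.
have xm : x <= m^-1 by rewrite -(ler_pM2l mp) mulfV ?gt_eqF //.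
have ym : y <= m^-1 by rewrite -(ler_pM2l mp) mulfV ?gt_eqF //.
have m1p : 0 < m + 1 by lra.
have xm1 : (m + 1)^-1 <= x by rewrite -(ler_pM2l m1p) mulfV ?gt_eqF //.
have ym1 : (m + 1)^-1 <= y by rewrite -(ler_pM2l m1p) mulfV ?gt_eqF //.
have gap : (n + 1) * m^-1 - n * (m + 1)^-1 <= e.
  have -> : (n + 1) * m^-1 - n * (m + 1)^-1 = (n + m + 1) / (m * (m + 1)) by field; rewrite !gt_eqF.
  by rewrite ler_pdivrMr ?mulr_gt0 //; nra.
rewrite ler_norml; apply/andP; split.
  suff : Q - P <= e by lra.
  apply: le_trans gap; apply: lerB.
    by apply: le_trans b2 _; rewrite ler_pM2l //; lra.
  by apply: le_trans a1; rewrite ler_wpM2l.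
apply: le_trans gap; apply: lerB.
  by apply: le_trans a2 _; rewrite ler_pM2l //; lra.
by apply: le_trans b1; rewrite ler_wpM2l.
Qed.

(** * The cost of generating a corner *)

Section CostTransfer.
Variables (R : realType) (H : hilbert R).
Implicit Types (c x y z p q g e f v : bop H) (X Y P L : seq (bop H)) (B : set (bop H)).
Let dp := rdot_psd H.

Lemma adherent_sandwich B B' c (d : bop H) x : (forall b, B b -> B' (c * b * d)) ->
  strong_adherent B x -> strong_adherent B' (c * x * d).
Proof.
move=> hB hx s r r0; have [C C0 hC] := bop_bd c.
have C1 : 0 < C + 1 by lra.
have [b Bb hb] := hx [seq d u | u <- s] _ (divr_gt0 r0 C1).
exists (c * b * d); first exact: hB.
move=> u us; rewrite !bopM -bopBv; apply: le_lt_trans (hC _) _.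
have := hb (d u) (map_f _ us); rewrite ltr_pdivlMr // => h.
by have := psd_ge0 dp (x (d u) - b (d u)); nra.
Qed.

(** [calI1] for lists of bundled operators and a real trace; with lists, families of generators can
    be indexed without proving their members distinct. *)
Definition cost1 (t : bop H -> R) x P : R :=
  \sum_(p <- P) \sum_(q <- P | p * x * q != 0) t p * t q.
Definition cost (t : bop H -> R) X P : R := \sum_(x <- X) cost1 t x P.

Definition is_partition B f P :=
  [/\ uniq P, (forall p, p \in P -> B p /\ proj p),
      (forall p q, p \in P -> q \in P -> p != q -> p * q = 0) &
      \sum_(p <- P) p = f].

Definition in_corner B f x := [/\ B x, f * x = x & x * f = x].

(** For a von Neumann algebra B and a projection f in B, this says that X generates the corner f B
    f. *)
Definition generates B f X := (forall x, x \in X -> in_corner B f x) /\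
  forall B', vNset B' -> (forall x, x \in X -> B' x) -> forall z, in_corner B f z -> B' z.

Lemma cost1_single t y P p q : uniq P -> p \in P -> q \in P ->
  (forall p', p' \in P -> p' != p -> p' * y = 0) ->
  (forall q', q' \in P -> q' != q -> y * q' = 0) ->
  cost1 t y P = if p * y * q != 0 then t p * t q else 0.
Proof.
move=> uP pP qP hp hq; rewrite /cost1 (bigD1_seq p) //= [X in _ + X]big_seq_cond.
rewrite [X in _ + X]big1 ?addr0; last first.
  move=> p' /andP[p'P np]; rewrite big1 // => q'; rewrite hp // mul0r eqxx //.
rewrite big_mkcond (bigD1_seq q) //= [X in _ + X]big_seq_cond.
rewrite [X in _ + X]big1 ?addr0 // => q' /andP[q'P nq].
by rewrite -mulrA hq // mulr0 eqxx.
Qed.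

Variables (Q : set (bop H)) (t : bop H -> R).
Hypotheses (hF : factor Q) (ht : ftrace Q t).
Let hQ : vNset Q. Proof. by case: hF. Qed.
Let Q1 : Q 1. Proof. by case: hF. Qed.
Hypothesis nfd : ~ exists (N : nat) (b : 'I_N -> bop H),
  forall x, Q x -> exists c : 'I_N -> R[i], x = \sum_(i < N) c i *: b i.

Lemma partition_proj e P p : is_partition Q e P -> p \in P -> [/\ p * e = p & e * p = p].
Proof.
move=> [uP hP oP <-] pP; split.
  rewrite mulr_sumr (bigD1_seq p) //= (hP p pP).2.2 big_seq_cond big1 ?addr0 //.
  by move=> q /andP[qP np]; apply: oP => //; rewrite eq_sym.
rewrite mulr_suml (bigD1_seq p) //= (hP p pP).2.2 big_seq_cond big1 ?addr0 //.
by move=> q /andP[qP np]; apply: oP.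
Qed.

(** f is cut into g and the ranges r_k of partial isometries u_k with initial space in g. The new
    generators are the compressions w_a^# x w_b, which live on the single block g, and the u_k,
    which live on the blocks (r_k, g); each therefore costs at most one term. *)
Lemma cost_transfer e f X P (eps : R) : Q e -> Q f -> proj e -> proj f -> e <> 0 -> f <> 0 ->
  is_partition Q e P -> generates Q e X -> 0 < eps ->
  exists Y P', [/\ is_partition Q f P', generates Q f Y & cost t Y P' <= cost t X P + eps].
Proof.
move=> Qe Qf he hf e0 f0 hP [XQ Xgen] eps0.
have [uP PQ Porth Psum] := hP.
have te := t_proj_gt0 ht Qe he e0.
pose T := t 1; have T0 : 0 <= T := t_proj_ge0 ht Q1 (proj1 H).
have tT p : Q p -> proj p -> t p <= T by exact: (t_le1 hQ Q1 ht).
pose NN : R := (size X)%:R * ((size P)%:R * (size P)%:R).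
have NN0 : 0 <= NN by rewrite !mulr_ge0 ?ler0n.
have K0 : 0 < NN * (2 * T + 1) + T + 1 by nra.
have P1 : (0 : R) < (size P)%:R + 1 by rewrite natr1 ltr0Sn.
(* d <= 1 makes t(g)^2 at most d, the third bound keeps the total error below [eps], and the last
   one guarantees that some p in P contains a full tile. *)
have [d [d0 d1 dK dP]] : exists d : R, [/\ 0 < d, d <= 1,
    (NN * (2 * T + 1) + T + 1) * d <= eps & ((size P)%:R + 1) * d <= t e].
  exists (Num.min 1 (Num.min (eps / (NN * (2 * T + 1) + T + 1)) (t e / ((size P)%:R + 1)))).
  split.
  - by rewrite !lt_min ltr01 !divr_gt0.
  - by rewrite ge_min lexx.
  - by rewrite mulrC -ler_pdivlMr // !ge_min lexx orbT.
  - by rewrite mulrC -ler_pdivlMr // !ge_min lexx !orbT.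
have [g [Qg hg gf g0 tg]] := small_proj hF ht nfd Qf hf f0 d0.
have tg0 := t_proj_gt0 ht Qg hg g0.
have hnw p : exists nw : nat * (nat -> bop H), p \in P -> tiling Q p g nw.1 nw.2.
  have [pP|_] := boolP (p \in P); last by exists (0%N, fun=> 0).
  have [Qp pp] := PQ p pP.
  by have [n [w hw]] := tiling_exists hF ht Qp Qg pp hg g0; exists (n, w).
have [nw nwP] := choice hnw.
pose n p := (nw p).1; pose w p := (nw p).2.
have til p : p \in P -> tiling Q p g (n p) (w p) by exact: nwP.
have fg : proj (f - g) := projB hg hf gf.
have Qfg : Q (f - g) by apply: (vNB hQ).
have [m [u hu]] := tiling_exists hF ht Qfg Qg fg hg g0.
have [_ u1 _ uorth usum] := hu.
have ufg k : (k <= m)%N -> (f - g) * u k = u k by move=> hk; exact: (tiling_absorb hu).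
have gfg : g * (f - g) = 0 by rewrite mulrBr (ple_sym hg hf gf) hg.2 subrr.
have gu k : (k <= m)%N -> g * u k = 0 by move=> hk; rewrite -ufg // mulrA gfg mul0r.
have ug k : (k <= m)%N -> u k * g = u k by exact: (tilingg hu).
have fu k : (k <= m)%N -> f * u k = u k.
  move=> hk; have := ufg k hk; rewrite mulrBl gu // subr0 //.
pose r k := u k * (u k)^#.
have pr k : (k <= m)%N -> proj (r k) by move=> hk; apply/pisom_star/(tiling_proj hu hg hk).
have Qr k : (k <= m)%N -> Q (r k) by move=> hk; apply/(vN_sqr hF)/(tilingA hu hk).
have ruk k : (k <= m)%N -> r k * u k = u k.
  by move=> hk; rewrite /r -mulrA pisomK //; exact: (tiling_proj hu).
have rul k l : (k <= m)%N -> (l <= m)%N -> k != l -> r k * u l = 0.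
  by move=> hk hl kl; rewrite /r -mulrA uorth // mulr0.
have rr k l : (k <= m)%N -> (l <= m)%N -> k != l -> r k * r l = 0.
  by move=> hk hl kl; rewrite {2}/r mulrA rul // mul0r.
have gr k : (k <= m)%N -> g * r k = 0 by move=> hk; rewrite /r mulrA gu // mul0r.
have rg k : (k <= m)%N -> r k * g = 0.
  by move=> hk; apply: star_inj; rewrite starM (pr k hk).1 hg.1 gr // star0.
pose L := [seq r k | k <- iota 0 m.+1].
have LP x : x \in L -> exists2 k, (k <= m)%N & x = r k.
  by move=> /mapP[k]; rewrite mem_iota add0n => /andP[_ hk] ->; exists k.
(* Only the remainder r 0 may vanish, so at most one entry is zero and orthogonal entries are
   distinct. *)
have uL : uniq (g :: L).
  rewrite cons_uniq map_inj_in_uniq ?iota_uniq ?andbT.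
    apply/negP => /LP [k hk gE]; apply: g0.
    by have := gr k hk; rewrite -gE hg.2.
  move=> k l; rewrite !mem_iota !add0n /= !ltnS => hk hl rE.
  apply/eqP/negPn/negP => kl.
  have rk0 : r k = 0 by rewrite -(pr k hk).2 {2}rE rr.
  have rl0 : r l = 0 by rewrite -rE.
  have z i : (i <= m)%N -> r i = 0 -> (0 < i)%N -> False.
    move=> hi ri i0; apply: g0; rewrite -(u1 i) ?i0 //.
    by rewrite -[u i](ruk i hi) ri mul0r mulr0.
  have [k0|k0] := posnP k; last exact: z hk rk0 k0.
  by apply: z hl rl0 _; rewrite lt0n -k0 eq_sym.
have hP' : is_partition Q f (g :: L).
  split => //.
  - move=> p; rewrite in_cons => /orP[/eqP -> //|/LP [k hk ->]].
    by split; [exact: Qr | exact: pr].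
  - move=> p q; rewrite !in_cons.
    move=> /orP[/eqP ->|/LP [k hk ->]] /orP[/eqP ->|/LP [l hl ->]]; rewrite ?eqxx //.
    + by move=> _; exact: gr.
    + by move=> _; exact: rg.
    + move=> ne; apply: rr => //; apply: contra ne => /eqP -> //.
  - rewrite big_cons /L big_map -[iota _ _]/(index_iota 0 m.+1) big_mkord usum.
    by rewrite addrC subrK.
pose I := [seq (p, i) | p <- P, i <- iota 0 (n p).+1].
pose W (a : bop H * nat) := w a.1 a.2.
have IP a : a \in I -> a.1 \in P /\ (a.2 <= n a.1)%N.
  move=> /allpairsPdep [p [i [pP]]]; rewrite mem_iota add0n => /andP[_ hi] -> /=.
  by split.
have sumI (F : bop H * nat -> R) : \sum_(a <- I) F a = \sum_(p <- P) \sum_(i < (n p).+1) F (p, nat_of_ord i).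
  rewrite /I big_allpairs_dep; apply: eq_bigr => p _.
  by rewrite -[iota _ _]/(index_iota 0 (n p).+1) big_mkord.
have WW : \sum_(a <- I) W a * (W a)^# = e.
  rewrite /I big_allpairs_dep -Psum big_seq [RHS]big_seq; apply: eq_bigr => p pP.
  rewrite -[iota _ _]/(index_iota 0 (n p).+1) big_mkord /W /=.
  by case: (til p pP).
have QW a : a \in I -> Q (W a) by move=> /IP [pP hi]; exact: (tilingA (til _ pP)).
have Wg a : a \in I -> W a * g = W a by move=> /IP [pP hi]; exact: (tilingg (til _ pP)).
have gW a : a \in I -> g * (W a)^# = (W a)^#.
  by move=> /IP [pP hi]; exact: (tilinggl (til _ pP)).
have pW a : a \in I -> a.1 * W a = W a.
  by move=> /IP [pP hi]; exact: (tiling_absorb (til _ pP)).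
have Wp a : a \in I -> (W a)^# * a.1 = (W a)^#.
  by move=> aI; have [pP _] := IP a aI; rewrite -[in LHS](PQ _ pP).2.1 -starM pW.
pose Yf x a b := (W a)^# * x * W b.
pose Y1 := [seq Yf xa.1 xa.2 b | xa <- [seq (x, a) | x <- X, a <- I], b <- I].
pose Y2 := [seq u k | k <- iota 0 m.+1].
have Y1P y : y \in Y1 -> exists x a b, [/\ x \in X, a \in I, b \in I & y = Yf x a b].
  move=> /allpairsP[[xa b] /= [/allpairsP[[x a] /= [xX aI ->]] bI ->]].
  by exists x, a, b.
have Y2P y : y \in Y2 -> exists2 k, (k <= m)%N & y = u k.
  by move=> /mapP[k]; rewrite mem_iota add0n => /andP[_ hk] ->; exists k.
have YfQ x a b : x \in X -> a \in I -> b \in I -> [/\ Q (Yf x a b), g * Yf x a b = Yf x a b & Yf x a b * g = Yf x a b].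
  move=> xX aI bI; have [Qx _ _] := XQ x xX; split.
  - apply: (vNM hQ); last exact: QW.
    by apply: (vNM hQ) => //; apply: (vNstar hQ); exact: QW.
  - by rewrite /Yf !mulrA gW.
  - by rewrite /Yf -mulrA Wg.
have fgE : f * g = g by [].
have gfE : g * f = g := ple_sym hg hf gf.
have gin y : g * y = y -> y * g = y -> f * y = y /\ y * f = y.
  move=> gy yg; split; first by rewrite -gy mulrA fgE.
  by rewrite -yg -mulrA gfE.
exists (Y1 ++ Y2), (g :: L); split => //.
- split.
    move=> y; rewrite mem_cat => /orP[/Y1P [x [a [b [xX aI bI ->]]]]|/Y2P [k hk ->]].
      have [QY gy yg] := YfQ _ _ _ xX aI bI.
      by have [? ?] := gin _ gy yg.
    split; [exact: (tilingA hu) | exact: fu |].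
    by rewrite -{1}(ug k hk) -mulrA gfE ug.
  move=> B' hB' BY.
  (* The elements of the corner e whose matrix coefficients all lie in B'. They form an algebra
     because e is the sum of the W_c W_c^# and can be inserted into a product. *)
  pose C : set (bop H) := [set x | in_corner Q e x /\ forall a b, a \in I -> b \in I -> B' (Yf x a b)].
  have CQ : C `<=` Q by move=> x [[]].
  have hC : vNset C.
    split.
    - split.
        split; first by split; rewrite ?mulr0 ?mul0r //; exact: vN0.
        by move=> a b _ _; rewrite /Yf mulr0 mul0r; exact: vN0.
      move=> k x y [[Qx ex xe] hx] [[Qy ey ye] hy]; split.
        split; first exact: vNlin.
          by rewrite mulrDr -bopZAr ex ey.
        by rewrite mulrDl -bopZAl xe ye.
      move=> a b aI bI.
      have -> : Yf (k *: x + y) a b = k *: Yf x a b + Yf y a b.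
        by rewrite /Yf mulrDr mulrDl -bopZAr -bopZAl.
      by apply: (vNlin hB'); [exact: hx | exact: hy].
    - move=> x y [[Qx ex xe] hx] [[Qy ey ye] hy]; split.
        split; first exact: (vNM hQ).
          by rewrite mulrA ex.
        by rewrite -mulrA ye.
      move=> a b aI bI.
      have -> : Yf (x * y) a b = \sum_(c <- I) Yf x a c * Yf y c b.
        rewrite /Yf -[in LHS]xe -WW !mulr_sumr !mulr_suml mulr_sumr mulr_suml.
        by apply: eq_bigr => c _; rewrite !mulrA.
      rewrite big_seq; apply: (vN_sum hB') => c cI.
      by apply: (vNM hB'); [exact: hx | exact: hy].
    - move=> x [[Qx ex xe] hx]; split.
        split; first exact: (vNstar hQ).
          by rewrite -[in LHS]he.1 -starM xe.
        by rewrite -[in LHS]he.1 -starM ex.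
      move=> a b aI bI.
      have -> : Yf (x^#) a b = (Yf x b a)^# by rewrite /Yf !starM starK mulrA.
      by apply: (vNstar hB'); exact: hx.
    - move=> x hx; split.
        split; first exact/(vN_strong hQ)/(strong_adherentS CQ).
          have := @adherent_eq _ _ C e 1 1 1 x; rewrite !mulr1 !mul1r; apply => // b [[_ eb _] _].
          by rewrite !mulr1 mul1r.
        have := @adherent_eq _ _ C 1 e 1 1 x; rewrite !mulr1 !mul1r; apply => // b [[_ _ be] _].
        by rewrite mulr1 !mul1r.
      move=> a b aI bI; apply: (vN_strong hB').
      by apply: adherent_sandwich hx => c [_ hc]; exact: hc.
  have XC x : x \in X -> C x.
    move=> xX; split; first exact: XQ.
    move=> a b aI bI; apply: BY; rewrite mem_cat; apply/orP; left.
    by apply/allpairsP; exists ((x, a), b); split => //=; apply/allpairsP; exists (x, a).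
  have QC := Xgen C hC XC.
  (* Otherwise every p would consist of its remainder alone and t e <= |P| t g, against the choice
     of d. *)
  have [p0 p0P np0] : exists2 p, p \in P & (0 < n p)%N.
    apply: contrapT => hno.
    have hn p : p \in P -> n p = 0%N.
      move=> pP; apply/eqP; rewrite -leqn0 leqNgt; apply/negP => hp.
      by apply: hno; exists p.
    have : t e <= \sum_(p <- P) t g.
      rewrite -Psum big_seq [X in _ <= X]big_seq (t_sum hQ ht); last by move=> p /PQ [].
      apply: ler_sum => p pP; have [Qp pp] := PQ p pP.
      have /andP[_] := tiling_trace hF ht Qg hg (til p pP).
      by rewrite hn // mul1r.
    rewrite big_const_seq count_predT iter_addr_0 -[X in _ <= X]mulr_natr.
    have s0 : (0 : R) <= (size P)%:R := ler0n _ _.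
    move: tg s0 dP d0; move: (size P)%:R => N; nra.
  pose a0 := (p0, 1%N); pose w0 := W a0.
  have a0I : a0 \in I.
    apply/allpairsPdep; exists p0, 1%N; split => //.
    by rewrite mem_iota add0n ltnS np0.
  have w0g : w0^# * w0 = g by have [_ h _ _ _] := til p0 p0P; apply: h; rewrite np0.
  have ew0 : e * w0 = w0.
    by rewrite /w0 -(pW _ a0I) /= mulrA; have [_ ->] := partition_proj hP p0P.
  (* With w0 a full tile, z in g Q g is the coefficient w0^# (w0 z w0^#) w0 of an element of the
     corner e Q e. *)
  have gB z : Q z -> g * z = z -> z * g = z -> B' z.
    move=> Qz gz zg.
    have zC : C (w0 * z * w0^#).
      apply: QC; split.
      - apply: (vNM hQ); last by apply: (vNstar hQ); exact: QW.
        by apply: (vNM hQ) => //; exact: QW.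
      - by rewrite !mulrA ew0.
      - by rewrite -!mulrA -[in LHS]he.1 -starM ew0.
    have [_ /(_ _ _ a0I a0I)] := zC.
    by rewrite /Yf -/w0 !mulrA w0g gz -mulrA w0g zg.
  have uB k : (k <= m)%N -> B' (u k).
    move=> hk; apply: BY; rewrite mem_cat; apply/orP; right.
    by apply/mapP; exists k => //; rewrite mem_iota add0n.
  (* Together with g, the u_k tile f itself, so every z in the corner f is a finite sum of terms U_k
     y U_l^# with y in g Q g. *)
  pose U k := if k is k'.+1 then u k' else g.
  have UB k : (k <= m.+1)%N -> B' (U k).
    by case: k => [_|k hk]; [apply: gB => //; case: hg | exact: uB].
  have UQ k : (k <= m.+1)%N -> Q (U k).
    by case: k => [_ //|k hk]; exact: (tilingA hu).
  have Ug k : (k <= m.+1)%N -> U k * g = U k.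
    by case: k => [_|k hk]; [case: hg | exact: ug].
  have UU : \sum_(k < m.+2) U k * (U k)^# = f.
    rewrite big_ord_recl /= hg.1 hg.2.
    rewrite (eq_bigr (fun k : 'I_m.+1 => u k * (u k)^#)); first by rewrite usum addrC subrK.
    by move=> k _; rewrite /bump.
  move=> z [Qz fz zf].
  have -> : z = \sum_(k < m.+2) \sum_(l < m.+2) U k * ((U k)^# * z * U l) * (U l)^#.
    rewrite -[LHS]zf -[in LHS]fz -{1}UU !mulr_suml; apply: eq_bigr => k _.
    by rewrite -UU mulr_sumr; apply: eq_bigr => l _; rewrite !mulrA.
  apply: (vN_sum hB') => k _; apply: (vN_sum hB') => l _.
  have hk : (k <= m.+1)%N by rewrite -ltnS.
  have hl : (l <= m.+1)%N by rewrite -ltnS.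
  apply: (vNM hB'); last by apply: (vNstar hB'); exact: UB.
  apply: (vNM hB'); first exact: UB.
  apply: gB.
  - apply: (vNM hQ); last exact: UQ.
    by apply: (vNM hQ) => //; apply: (vNstar hQ); exact: UQ.
  - by rewrite !mulrA -[g * _]starK starM starK hg.1 Ug.
  - by rewrite -mulrA Ug.
- have gL : g \in g :: L by rewrite mem_head.
  have nL p' : p' \in g :: L -> p' != g -> exists2 k, (k <= m)%N & p' = r k.
    by rewrite in_cons => /orP[/eqP ->|/LP //]; rewrite eqxx.
  have c1 x a b : x \in X -> a \in I -> b \in I ->
      cost1 t (Yf x a b) (g :: L) <= if a.1 * x * b.1 != 0 then t g * t g else 0.
    move=> xX aI bI; have [_ gy yg] := YfQ _ _ _ xX aI bI.
    rewrite (@cost1_single t _ _ g g) //.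
    + rewrite gy yg; case: ifP => h; last by case: ifP => // _; exact/mulr_ge0/ltW/tg0/ltW/tg0.
      case: ifP => // /negbFE /eqP axb; case/eqP: h.
      by rewrite /Yf -(Wp _ aI) -(pW _ bI) !mulrA -(mulrA _ x) -(mulrA (W a)^#) (mulrA a.1) axb mulr0 mul0r.
    + by move=> p' /nL h /h [k hk ->]; rewrite -gy mulrA rg // mul0r.
    + by move=> p' /nL h /h [k hk ->]; rewrite -yg -mulrA gr // mulr0.
  have c2 k : (k <= m)%N -> cost1 t (u k) (g :: L) <= t (r k) * t g.
    move=> hk; rewrite (@cost1_single t _ _ (r k) g) //.
    + case: ifP => // _; rewrite mulr_ge0 ?(ltW tg0) //.
      by apply: (t_proj_ge0 ht); [exact: Qr | exact: pr].
    + by rewrite in_cons; apply/orP; right; apply/mapP; exists k => //; rewrite mem_iota add0n.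
    + move=> p'; rewrite in_cons => /orP[/eqP -> _|/LP [l hl ->] ne]; first exact: gu.
      by apply: rul => //; apply: contra ne => /eqP ->.
    + by move=> p' /nL h /h [l hl ->]; rewrite -ug // -mulrA gr // mulr0.
  have b2 : \sum_(y <- Y2) cost1 t y (g :: L) <= T * d.
    rewrite /Y2 big_map -[iota _ _]/(index_iota 0 m.+1) big_mkord.
    apply: (@le_trans _ _ (\sum_(k < m.+1) t (r k) * t g)).
      by apply: ler_sum => k _; apply: c2; rewrite -ltnS.
    rewrite -mulr_suml -(t_sum hQ ht); last by move=> k _; apply: Qr; rewrite -ltnS.
    rewrite usum; apply: ler_pM => //; rewrite ?(ltW tg0) //.
      exact: (t_proj_ge0 ht).
    exact: tT.
  have n1 p : p \in P -> (n p).+1%:R * t g <= t p + t g.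
    move=> pP; have [Qp pp] := PQ p pP.
    have /andP[h _] := tiling_trace hF ht Qg hg (til p pP).
    by rewrite -natr1 mulrDl mul1r lerD2r.
  (* The number of tiles of p, remainder included, is at most t p / t g + 1. This gives (t p + t
     g)(t q + t g), whose excess over t p t q is at most (2 T + 1) d. *)
  have c3 x p q : p \in P -> q \in P ->
     (if p * x * q != 0 then ((n p).+1%:R * t g) * ((n q).+1%:R * t g) else 0) <=
     (if p * x * q != 0 then t p * t q else 0) + (2 * T + 1) * d.
    move=> pP qP; have [Qp pp] := PQ p pP; have [Qq pq] := PQ q qP.
    have tp0 := t_proj_ge0 ht Qp pp; have tq0 := t_proj_ge0 ht Qq pq.
    have tp1 := tT p Qp pp; have tq1 := tT q Qq pq.
    have Td : 0 <= (2 * T + 1) * d by rewrite mulr_ge0 ?(ltW d0) //; lra.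
    case: ifP => _; last by rewrite add0r.
    apply: (@le_trans _ _ ((t p + t g) * (t q + t g))).
      by apply: ler_pM; rewrite ?mulr_ge0 ?ler0n ?(ltW tg0) ?n1.
    have h1 : t p * t g <= T * d by apply: ler_pM => //; exact: ltW.
    have h2 : t g * t q <= d * T by apply: ler_pM => //; exact: ltW.
    have h3 : t g * t g <= d * 1 by apply: ler_pM => //; [exact: ltW | exact: ltW | lra].
    rewrite mulrDl !mulrDr; move: h1 h2 h3; rewrite mulrDl mul1r; lra.
  have c4 x : x \in X -> \sum_(a <- I) \sum_(b <- I) cost1 t (Yf x a b) (g :: L) <=
      cost1 t x P + (size P)%:R * (size P)%:R * ((2 * T + 1) * d).
    move=> xX.
    apply: (@le_trans _ _ (\sum_(a <- I) \sum_(b <- I) if a.1 * x * b.1 != 0 then t g * t g else 0)).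
      rewrite big_seq [X in _ <= X]big_seq; apply: ler_sum => a aI.
      rewrite big_seq [X in _ <= X]big_seq; apply: ler_sum => b bI; exact: c1.
    apply: (@le_trans _ _ (\sum_(p <- P) \sum_(q <- P)
       ((if p * x * q != 0 then t p * t q else 0) + (2 * T + 1) * d))).
      rewrite sumI big_seq [X in _ <= X]big_seq; apply: ler_sum => p pP.
      rewrite (eq_bigr (fun=> \sum_(q <- P) \sum_(j < (n q).+1) if p * x * q != 0 then t g * t g else 0)); last first.
        by move=> i _; rewrite sumI.
      rewrite sumr_const card_ord -[X in X <= _]mulr_natl mulr_sumr.
      rewrite big_seq [X in _ <= X]big_seq; apply: ler_sum => q qP.
      rewrite sumr_const card_ord -[X in _ * X <= _]mulr_natl.
      apply: le_trans (c3 x p q pP qP); case: ifP => _; last by rewrite !mulr0.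
      by rewrite le_eqVlt; apply/orP; left; apply/eqP; ring.
    rewrite /cost1 -(mulrA (size P)%:R (size P)%:R).
    rewrite (eq_bigr (fun p => \sum_(q <- P | p * x * q != 0) t p * t q + (size P)%:R * ((2 * T + 1) * d))).
      rewrite big_split /= big_const_seq count_predT iter_addr_0 -[X in _ + X <= _]mulr_natl //.
    move=> p _; rewrite big_split /= -big_mkcond big_const_seq count_predT iter_addr_0.
    by rewrite -[X in _ + X = _]mulr_natl.
  have b1 : \sum_(y <- Y1) cost1 t y (g :: L) <= cost t X P + NN * ((2 * T + 1) * d).
    rewrite /Y1 big_allpairs_dep big_allpairs_dep /=.
    rewrite big_seq; apply: (@le_trans _ _ (\sum_(x <- X) (cost1 t x P + (size P)%:R * (size P)%:R * ((2 * T + 1) * d)))).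
      by rewrite [X in _ <= X]big_seq; apply: ler_sum => x xX; exact: c4.
    rewrite big_split /= big_const_seq count_predT iter_addr_0 -[X in _ + X <= _]mulr_natl.
    by rewrite /NN mulrA.
  rewrite /cost big_cat /=; apply: le_trans (lerD b1 b2) _.
  apply: le_trans (lerD (lexx _) dK); rewrite /cost !mulrDl mul1r.
  by rewrite !mulrDr !mulrDl; lra.
Qed.
End CostTransfer.

(** * Vectors bounded by the trace *)

Section BoundedVectors.
Variables (R : realType) (H : hilbert R).
Implicit Types (u xi : H) (a b x y p q r s g v : bop H).
Let dp := rdot_psd H.

Variables (A : set (bop H)) (t : bop H -> R).
Hypotheses (hF : factor A) (ht : ftrace A t).
Let hA : vNset A. Proof. by case: hF. Qed.
Let A1 : A 1. Proof. by case: hF. Qed.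

Definition posfun (f : bop H -> R) :=
  (forall (k : R) a b, A a -> A b -> f (k%:C *: a + b) = k * f a + f b) /\
  (forall a, A a -> pos a -> 0 <= f a).

(** Normality along increasing sequences of projections, in the form used by exhaustion: the values
    come arbitrarily close to the value at the limit. *)
Definition seqnormal (f : bop H -> R) := forall (s : nat -> bop H) p,
  (forall n, A (s n) /\ proj (s n)) -> (forall n, ple (s n) (s n.+1)) ->
  A p -> proj p -> scv s p -> forall e : R, 0 < e -> exists n, f p < f (s n) + e.

Section PosFun.
Variable f : bop H -> R.
Hypothesis pf : posfun f.
Lemma pfD a b : A a -> A b -> f (a + b) = f a + f b.
Proof. by case: pf => h _ Aa Ab; have := h 1 a b Aa Ab; rewrite rmorph1 scale1r mul1r. Qed.
Lemma pf0 : f 0 = 0.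
Proof. by apply: (addIr (f 0)); rewrite -pfD ?addr0 ?add0r //; exact: vN0. Qed.
Lemma pfZ (k : R) a : A a -> f (k%:C *: a) = k * f a.
Proof. by case: pf => h _ Aa; have := h k a 0 Aa (vN0 hA); rewrite pf0 !addr0. Qed.
Lemma pfB a b : A a -> A b -> f (a - b) = f a - f b.
Proof.
move=> Aa Ab; have := pfZ (-1) Ab; rewrite mulN1r rmorphN rmorph1 scaleN1r => <-.
by rewrite -pfD //; exact: vNN.
Qed.
Lemma pf_ge0 a : A a -> pos a -> 0 <= f a. Proof. by case: pf => _; apply. Qed.
Lemma pf_le a b : A a -> A b -> pos (b - a) -> f a <= f b.
Proof. by move=> Aa Ab h; rewrite -subr_ge0 -pfB //; apply: pf_ge0 => //; exact: vNB. Qed.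
End PosFun.

Lemma posfun_trace : posfun t.
Proof.
split; first by case: ht.
by move=> a Aa pa; exact: (t_pos hA A1 ht).
Qed.
Lemma posfun_vec xi : posfun (fun a => <<a xi, xi>>).
Proof.
split; last by move=> a _ [_ h]; exact: h.
by move=> k a b _ _; rewrite !bopE (psdDl dp) (psdZl dp).
Qed.
Lemma posfun_scale (k : R) f : 0 <= k -> posfun f -> posfun (fun a => k * f a).
Proof.
move=> k0 [h1 h2]; split; last by move=> a Aa pa; rewrite mulr_ge0 // h2.
by move=> l a b Aa Ab; rewrite h1 //; ring.
Qed.

Lemma seqnormal_vec xi : seqnormal (fun a => <<a xi, xi>>).
Proof.
move=> s p hs inc Ap hp sp e e0.
have [N hN] := fcvg_dot dp xi (sp xi) e0.
exists N; have := hN N (leqnn N); rewrite ltr_norml; lra.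
Qed.
Lemma seqnormal_scale (k : R) f : 0 < k -> seqnormal f -> seqnormal (fun a => k * f a).
Proof.
move=> k0 h s p hs inc Ap hp sp e e0.
have [n hn] := h s p hs inc Ap hp sp (e / k) (divr_gt0 e0 k0).
exists n; have : k * f p < k * (f (s n) + e / k) by rewrite ltr_pM2l.
by rewrite mulrDr mulrCA mulfV ?gt_eqF // mulr1.
Qed.

(* Binary expansion of a positive contraction into spectral projections. *)
Lemma layer_cake f1 f2 q : posfun f1 -> posfun f2 -> A q -> proj q ->
  (forall p, A p -> proj p -> ple p q -> f1 p <= f2 p) ->
  forall x, A x -> pos x -> q * x = x -> f1 x <= f2 x.
Proof.
move=> p1 p2 Aq hq hle.
have f11 : 0 <= f1 1 by apply: (pf_ge0 p1 A1); exact: pos1.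
(* Removing c/2 times the spectral projection of x above c/2 leaves a positive operator below c/2;
   after n rounds the remaining error is c/2^n times f1 1. *)
have main n : forall (c : R) x, 0 < c -> A x -> pos x -> q * x = x -> pos (c%:C *: (1 : bop H) - x) ->
    f1 x <= f2 x + c / 2 ^+ n * f1 1.
  elim: n => [|n ih] c x c0 Ax px qx pcx.
    rewrite expr0 divr1 -(pfZ p1) // addrC -[f1 x]addr0; apply: lerD.
      by apply: (pf_le p1) => //; exact: vNZ.
    exact: (pf_ge0 p2).
  have xq : x * q = x by rewrite -{1}px.1 -{1}hq.1 -starM qx px.1.
  have c2 : 0 < c / 2 by rewrite divr_gt0.
  pose c' := (c / 2)%:C *: (1 : bop H).
  have Ac : A c' by exact: vNZ.
  have sac : (x - c')^# = x - c' by rewrite starB px.1 starZr star1.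
  have [p [hp pp pn pc pA]] := spectral_split sac.
  have Ap : A p by apply: pA => //; exact: vNB.
  have cx y : comm y x -> comm y p.
    by move=> yx; apply: pc; apply: commB => //; exact/commZ/comm1.
  have qp : comm q p by apply: cx; rewrite /comm qx xq.
  have xp : comm x p by apply: cx; exact: comm_refl.
  (* x vanishes on 1 - q, so x - c/2 is negative there and its positive spectral projection p must
     lie below q. *)
  have pq0 : p * (1 - q) = 0.
    have h1 : proj (p * (1 - q)).
      have cpq : comm p (1 - q) by apply: commB; [exact: comm1 | exact/commC].
      split; first by rewrite starM hp.1 (projC hq).1 cpq.
      by rewrite mulrA -(mulrA p (1 - q) p) -cpq mulrA hp.2 -mulrA (projC hq).2.
    have h2 := pos_sandwich (1 - q) pp.
    have h3 : (1 - q)^# * (p * (x - c')) * (1 - q) = - ((c / 2)%:C *: (p * (1 - q))).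
      have e1 : (x - c') * (1 - q) = - ((c / 2)%:C *: (1 - q)).
        by rewrite mulrBl [x * _]mulrBr mulr1 xq subrr sub0r /c' -bopZAl mul1r.
      have cpq : comm p (1 - q) by apply: commB; [exact: comm1 | exact/commC].
      rewrite (projC hq).1 -!mulrA e1 !mulrN -!bopZAr; congr (- (_ *: _)).
      by rewrite mulrA -cpq -mulrA (projC hq).2.
    rewrite h3 in h2.
    have h4 := pos_anti (posZ (ltW c2) (proj_pos h1)) h2.
    have : ((c / 2)^-1)%:C *: ((c / 2)%:C *: (p * (1 - q))) = 0 by rewrite h4 scaler0.
    by rewrite scalerA -rmorphM mulVf ?gt_eqF // rmorph1 scale1r.
  have pq : p * q = p by move: pq0; rewrite mulrBr mulr1 => /eqP; rewrite subr_eq0 eq_sym => /eqP.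
  have plq : ple p q by rewrite /ple qp pq.
  pose x1 := x - (c / 2)%:C *: p.
  have Ax1 : A x1 by apply: (vNB hA) => //; exact: vNZ.
  have px1 : pos x1.
    have -> : x1 = (1 - p) * x + p * (x - c') by rewrite /x1 /c'; bop_ring.
    apply: posD => //; apply: pos_mul => //; first exact/proj_pos/projC.
    by apply/commC/commB; [exact: comm1 | exact: xp].
  have pcx1 : pos ((c / 2)%:C *: (1 : bop H) - x1).
    have -> : (c / 2)%:C *: (1 : bop H) - x1 = - ((1 - p) * (x - c')) + p * (c%:C *: (1 : bop H) - x).
      by rewrite /x1 /c'; bop_ring.
    apply: posD => //; apply: pos_mul => //; first exact: proj_pos.
    by apply: commB; [exact/commZ/comm1 | exact/commC].
  have qx1 : q * x1 = x1 by rewrite mulrBr qx -bopZAr plq.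
  have := ih _ x1 c2 Ax1 px1 qx1 pcx1.
  have xE : x = (c / 2)%:C *: p + x1 by rewrite /x1 addrC subrK.
  have -> : f1 x = c / 2 * f1 p + f1 x1 by rewrite {1}xE; case: p1 => h _; apply: h.
  have -> : f2 x = c / 2 * f2 p + f2 x1 by rewrite {1}xE; case: p2 => h _; apply: h.
  have := hle p Ap hp plq => h5.
  have h6 : c / 2 * f1 p <= c / 2 * f2 p by rewrite ler_pM2l.
  rewrite exprS invfM mulrA; lra.
move=> x Ax px qx; have [c c0 pc] := sa_bound px.1.
apply/ler_addgt0Pl => e e0; rewrite addrC.
have K0 : 0 <= c * f1 1 / e by rewrite divr_ge0 ?mulr_ge0 // ltW.
pose n := Num.bound (c * f1 1 / e).
apply: le_trans (main n c x c0 Ax px qx pc) _; rewrite lerD2l.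
have n2 : (0 : R) < 2 ^+ n by rewrite exprn_gt0.
rewrite mulrAC ler_pdivrMr // [e * _]mulrC -ler_pdivrMr //.
apply: le_trans (ltW (archi_boundP K0)) _; rewrite -natrX ler_nat; exact/ltnW/ltn_expl.
Qed.

(* Exhaustion: below r0, remove a maximal projection on which f2 <= f1. *)
Lemma exhaust f1 f2 r0 : posfun f1 -> posfun f2 -> seqnormal f2 -> A r0 -> proj r0 ->
  exists r, [/\ A r, proj r, ple r r0, f2 r <= f1 r &
    forall p, A p -> proj p -> ple p (r0 - r) -> f1 p <= f2 p].
Proof.
move=> p1 p2 n2 Ar0 hr0.
pose P r := [/\ A r, proj r, ple r r0 & f2 r <= f1 r].
pose T := {r | P r}.
pose le (r s : T) := ple (sval r) (sval s) /\ f2 (sval s - sval r) <= f1 (sval s - sval r).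
have TA (r : T) : A (sval r) by case: (svalP r).
have Tp (r : T) : proj (sval r) by case: (svalP r).
have P0 : P 0.
  by split; [exact: vN0 | exact: proj0 | exact: mulr0 | rewrite !pf0].
have fB1 (r s : bop H) : A r -> A s -> f1 (s - r) = f1 s - f1 r by move=> Ar As; exact: (pfB p1).
have fB2 (r s : bop H) : A r -> A s -> f2 (s - r) = f2 s - f2 r by move=> Ar As; exact: (pfB p2).
have le_refl (r : T) : le r r by split; [exact/ple_refl | rewrite subrr !pf0].
have le_trans (x y z : T) : le x y -> le y z -> le x z.
  move=> [h1 h2] [h3 h4]; split; first exact: ple_trans h3.
  by move: h2 h4; rewrite !(fB1, fB2) ?TA //; lra.
have le_mono (x y : T) : le x y -> t (sval x) <= t (sval y).
  by move=> [h _]; exact: (t_ple hA ht).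
have le_bd (x : T) : t (sval x) <= t 1 by exact: (t_le1 hA A1 ht).
have le_sup (s : nat -> T) : (forall n, le (s n) (s n.+1)) -> exists u : T, forall n, le (s n) u.
  move=> hs; have inc n : ple (sval (s n)) (sval (s n.+1)) by case: (hs n).
  have [r [pr sr hr]] := proj_seq_sup (fun n => Tp (s n)) inc.
  have Ar : A r := vN_scv hA (fun n => TA (s n)) sr.
  have mono m n : (n <= m)%N -> le (s n) (s m).
    move=> /subnK <-; elim: (m - n)%N => [|k ih]; first exact: le_refl.
    by rewrite addSn; exact: le_trans ih (hs _).
  (* Normality of f2 and monotonicity of f1 carry the inequality to the limit. *)
  have key n : f2 (r - sval (s n)) <= f1 (r - sval (s n)).
    apply/ler_addgt0Pl => e e0; rewrite !(fB1, fB2) ?TA //.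
    have [m hm] := n2 _ r (fun n => conj (TA (s n)) (Tp (s n))) inc Ar pr sr e e0.
    have [k [nk mk]] : exists k, (n <= k)%N /\ (m <= k)%N.
      by exists (maxn n m); rewrite leq_maxl leq_maxr.
    have [_ h1] := mono _ _ nk; have [h3 _] := mono _ _ mk.
    have h4 : f2 (sval (s m)) <= f2 (sval (s k)).
      by apply: (pf_le p2) => //; exact/proj_pos/projB.
    have h5 : f1 (sval (s k)) <= f1 r.
      by apply: (pf_le p1) => //; apply/proj_pos/projB.
    move: h1; rewrite !(fB1, fB2) ?TA //; lra.
  have rr0 : ple r r0.
    apply: scv_unique (scvMl r0 sr) _; apply: scv_eq sr => n.
    by case: (svalP (s n)).
  have Pr : P r.
    split => //; have := key 0%N; rewrite !(fB1, fB2) ?TA //.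
    by have [_ _ _] := svalP (s 0%N); lra.
  by exists (exist _ r Pr) => n; split => //; exact: hr.
have [[r [Ar hr rr0 fr]] [_ /= rmax]] := brezis_browder le_refl le_trans le_mono le_bd le_sup (exist _ 0 P0).
exists r; split => // p Ap hp pr.
rewrite leNgt; apply/negP => lt.
have hd : proj (r0 - r) := projB hr hr0 rr0.
have rp : r * p = 0.
  rewrite -pr mulrA mulrBr (ple_sym hr hr0 rr0) hr.2 subrr mul0r //.
have pr0 : ple p r0.
  by rewrite /ple -{1}pr mulrA mulrBr hr0.2 rr0 pr.
have hrp : proj (r + p) := projD hr hp rp.
have prr : p * r = 0 by apply: star_inj; rewrite starM hp.1 hr.1 rp star0.
have Prp : P (r + p).
  split; [exact: vND | exact: hrp | by rewrite /ple mulrDr rr0 pr0 |].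
  by rewrite !pfD //; lra.
have := rmax (exist _ _ Prp); rewrite /= (tD ht) // => h.
have : t p = 0.
  apply: (addrI (t r)); rewrite addr0; apply: h; split => /=.
    by rewrite /ple mulrDl hr.2 prr addr0.
  by rewrite addrC addKr; exact: ltW.
move/(t_proj_eq0 ht Ap hp) => p0; move: lt; rewrite p0 !pf0 // ltxx //.
Qed.

Definition bdv xi := exists2 c : R, 0 <= c & forall x, A x -> <<x xi, x xi>> <= c * t (x^# * x).

Hypothesis tnormal : seqnormal t.

(** By the trace property the two sides are t(x v v^# x^#) and t(x x^#), and v v^# is a
    projection. *)
Lemma t_contr x v : A x -> A v -> proj (v * v^#) -> t ((x * v)^# * (x * v)) <= t (x^# * x).
Proof.
move=> Ax Av hp; have As := vNstar hA Ax; have Axv := vNM hA Ax Av.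
rewrite (tC ht (vNstar hA Axv) Axv) (tC ht As Ax).
apply: (pf_le posfun_trace); [exact: (vN_sqr hF) | exact: (vN_sqr hF) |].
rewrite starM mulrA -(mulrA x).
have := pos_sandwich (x^#) (proj_pos (projC hp)).
by rewrite starK mulrBr mulr1 mulrBl.
Qed.

(** The spectral slices of (x q)^# (x q) lie under q, where the vector functional of xi is at most k
    t. *)
Lemma bdv_proj (k : R) xi q : 0 <= k -> A q -> proj q ->
  (forall p, A p -> proj p -> ple p q -> << p xi, xi>> <= k * t p) -> bdv (q xi).
Proof.
move=> k0 Aq hq h; exists k => // x Ax.
have Axq : A ((x * q)^# * (x * q)) by apply: (vN_sq hF); exact: vNM.
have h1 : <<((x * q)^# * (x * q)) xi, xi>> <= k * t ((x * q)^# * (x * q)).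
  apply: (layer_cake (posfun_vec xi) (posfun_scale k0 posfun_trace) Aq hq h) => //.
    exact: pos_sq.
  by rewrite starM hq.1 !mulrA hq.2.
move: h1; rewrite bopM starEr [(x * q) xi]bopM => h1; apply: le_trans h1 _.
by rewrite ler_wpM2l // t_contr // hq.1 hq.2.
Qed.

Lemma bdv0 : bdv 0.
Proof.
by exists 0 => // x Ax; rewrite bop0v (psd0l dp) mul0r.
Qed.
Lemma bdvD u xi : bdv u -> bdv xi -> bdv (u + xi).
Proof.
move=> [c c0 hc] [d d0 hd]; exists (2 * c + 2 * d); first by lra.
move=> x Ax; rewrite bopDv; have := psdD2_le dp (x u) (x xi).
by have := hc x Ax; have := hd x Ax; lra.
Qed.
Lemma bdvZ (k : R) u : bdv u -> bdv (k%:C *: u).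
Proof.
move=> [c c0 hc]; exists (k * k * c); first by rewrite mulr_ge0 // -expr2 sqr_ge0.
move=> x Ax; rewrite bopZv (psdZl dp) (psdZr dp) (mulrA k k) -(mulrA (k * k)).
by apply: ler_wpM2l; [rewrite -expr2 sqr_ge0 | exact: hc].
Qed.

(** The part xi of u orthogonal to all bounded vectors is killed by a projection s of maximal trace.
    Below 1 - s exhaustion finds a nonzero q with q xi bounded; then |q xi|^2 is the pairing of xi
    with q xi, so it is 0 and s + q also kills xi. *)
Lemma bdv_dense u (e : R) : 0 < e -> exists2 d, bdv d & << u - d, u - d>> < e.
Proof.
move=> e0.
have [] := @psd_riesz R H (@rdot R H) dp bdv (fun w => <<u, w>>) <<u, u>> bdv0 bdvD bdvZ.
- by move=> v w _ _; rewrite (psdDr dp).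
- by move=> k v _; rewrite (psdZr dp).
- exact: psd_ge0.
- by move=> v _; exact: psdCS.
- by move=> s _; exact: hilbert_complete.
move=> v [hv horth].
suff -> : u = v by exact: hv.
pose xi := u - v.
have xo d : bdv d -> <<xi, d>> = 0 by move=> hd; rewrite (psdBl dp) horth // subrr.
apply/eqP; rewrite -subr_eq0 -/xi; apply/negPn/negP => xi0.
have xip : 0 < <<xi, xi>>.
  by rewrite lt_def (psd_ge0 dp) andbT; apply: contra xi0 => /eqP/rdot_eq0/eqP.
pose P s := [/\ A s, proj s & s xi = 0].
pose T := {s | P s}.
have TA (r : T) : A (sval r) by case: (svalP r).
have Tp (r : T) : proj (sval r) by case: (svalP r).
have P0 : P 0 by split; [exact: vN0 | exact: proj0 | ].
have le_sup (s : nat -> T) : (forall n, ple (sval (s n)) (sval (s n.+1))) ->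
    exists w : T, forall n, ple (sval (s n)) (sval w).
  move=> inc; have [r [pr sr hr]] := proj_seq_sup (fun n => Tp (s n)) inc.
  have Pr : P r.
    split => //; first exact: (vN_scv hA) (fun n => TA (s n)) sr.
    apply: fcvg_unique (sr xi) _; apply: fcvg_eq (fcvg_cst 0) => n.
    by case: (svalP (s n)).
  by exists (exist _ r Pr).
have [[s [As hs sxi]] [_ /= smax]] := @brezis_browder R T (fun x y : T => ple (sval x) (sval y))
  (fun x : T => t (sval x)) (t 1)
  (fun x : T => ple_refl (Tp x)) (fun x y w : T => @ple_trans R H (sval x) (sval y) (sval w))
  (fun x y : T => t_ple hA ht (TA x) (TA y) (Tp x) (Tp y))
  (fun x : T => t_le1 hA A1 ht (TA x) (Tp x)) le_sup (exist _ 0 P0).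
pose r0 := 1 - s.
have Ar0 : A r0 by exact: vNB.
have hr0 : proj r0 := projC hs.
have r0xi : r0 xi = xi by rewrite bopB sxi subr0.
have r0n : r0 <> 0 by move=> z; move/eqP: xi0; apply; rewrite -r0xi z.
have tr0 := t_proj_gt0 ht Ar0 hr0 r0n.
(* Chosen with k t(r0) > |xi|^2, so that the exhausted projection r cannot be all of r0. *)
pose k := (<<xi, xi>> + 1) / t r0.
have k0 : 0 < k by rewrite divr_gt0 //; lra.
have [r [Ar hr rr0 fr rmax]] := exhaust (posfun_vec xi) (posfun_scale (ltW k0) posfun_trace)
  (seqnormal_scale k0 tnormal) Ar0 hr0.
pose q := r0 - r.
have Aq : A q by exact: vNB.
have hq : proj q := projB hr hr0 rr0.
have q0 : q <> 0.
  move=> z; have rE : r = r0 by apply/eqP; rewrite eq_sym -subr_eq0 -/q z.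
  move: fr; rewrite rE r0xi /k divfK ?gt_eqF //; lra.
have hqxi : bdv (q xi) by apply: (bdv_proj (ltW k0)).
have qxi : q xi = 0.
  apply: rdot_eq0; rewrite starE hq.1 -bopM hq.2; exact: xo.
have sr0 : s * r0 = 0 by rewrite mulrBr mulr1 hs.2 subrr.
have qr0 : ple q r0 by rewrite /ple /q mulrBr hr0.2 rr0.
have sq : s * q = 0 by rewrite -qr0 mulrA sr0 mul0r.
have qs : q * s = 0 by apply: star_inj; rewrite starM hq.1 hs.1 sq star0.
have Psq : P (s + q).
  by split; [exact: vND | exact: projD | rewrite bopE sxi qxi addr0].
have := smax (exist _ _ Psq); rewrite /= (tD ht) // => h.
apply: q0; apply: (t_proj_eq0 ht) => //.
apply: (addrI (t s)); rewrite addr0; apply: h.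
by rewrite /ple mulrDl hs.2 qs addr0.
Qed.

(** Exhaustion with the roles exchanged bounds t by a multiple of one vector functional below some
    nonzero q. Tiling 1 by q transports this bound; the tiles applied to that vector give the
    family. *)
Lemma trace_dominated : exists n (xi : nat -> H), (forall i, (i < n)%N -> bdv (xi i)) /\
  forall x, A x -> t (x^# * x) <= \sum_(i < n) <<x (xi i), x (xi i)>>.
Proof.
have [z0|/eqP n1] := eqVneq (1 : bop H) 0.
  exists 0%N, (fun=> 0); split => // x Ax.
  by rewrite big_ord0 -[x]mul1r z0 mul0r mulr0 (t0 hA ht).
have [u u0] : exists u : H, 0 < <<u, u>>.
  apply: contrapT => h; apply: n1; apply: bop_ext => u; apply: rdot_eq0.
  apply/eqP; rewrite eq_le (psd_ge0 dp) andbT leNgt; apply/negP => hu.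
  by apply: h; exists u.
have [xi bxi hxi] := bdv_dense u u0.
have xi0 : 0 < <<xi, xi>>.
  rewrite lt_def (psd_ge0 dp) andbT; apply/negP => /eqP/rdot_eq0 z.
  by move: hxi; rewrite z subr0 ltxx.
have t10 := t_proj_gt0 ht A1 (proj1 H) n1.
pose k := (t 1 + 1) / <<xi, xi>>.
have k0 : 0 < k by rewrite divr_gt0 //; lra.
have [r [Ar hr rr0 fr rmax]] := exhaust posfun_trace (posfun_scale (ltW k0) (posfun_vec xi))
  (seqnormal_scale k0 (@seqnormal_vec xi)) A1 (proj1 H).
pose q := 1 - r.
have Aq : A q by exact: vNB.
have hq : proj q := projC hr.
have q0 : q <> 0.
  move=> z; have rE : r = 1 by apply/eqP; rewrite eq_sym -subr_eq0 -/q z.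
  move: fr; rewrite rE bop1 /k divfK ?gt_eqF //; lra.
have [n [w hw]] := tiling_exists hF ht A1 Aq (proj1 H) hq q0.
have [_ _ _ _ ws] := hw.
exists n.+1, (fun i => (Num.sqrt k)%:C *: w i xi); split.
  move=> i; rewrite ltnS => hi; apply: bdvZ.
  have Aw := tilingA hw hi; have [c c0 hc] := bxi.
  exists c => // x Ax; rewrite -!bopM; apply: le_trans (hc _ (vNM hA Ax Aw)) _.
  apply: ler_wpM2l => //.
  by apply: t_contr => //; apply/pisom_star/(tiling_proj hw).
move=> x Ax; have As := vNstar hA Ax.
have -> : t (x^# * x) = \sum_(i < n.+1) t ((x * w i)^# * (x * w i)).
  rewrite (tC ht As Ax) -{1}[x]mulr1 -ws mulr_sumr mulr_suml (t_sum hA ht).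
    apply: eq_bigr => i _; have hi : (i <= n)%N by rewrite -ltnS.
    have Axw := vNM hA Ax (tilingA hw hi).
    by rewrite (tC ht (vNstar hA Axw) Axw) starM !mulrA.
  move=> i _; have hi : (i <= n)%N by rewrite -ltnS.
  apply: (vNM hA) => //; apply: (vNM hA) => //.
  by apply: (vN_sqr hF); exact: (tilingA hw).
apply: ler_sum => i _; have hi : (i <= n)%N by rewrite -ltnS.
have Aw := tilingA hw hi; have Axw := vNM hA Ax Aw.
have qy : q * ((x * w i)^# * (x * w i)) = (x * w i)^# * (x * w i).
  by rewrite starM !mulrA (tilinggl hw hq hi).
have h := layer_cake posfun_trace (posfun_scale (ltW k0) (posfun_vec xi)) Aq hq rmax
  (vN_sq hF Axw) (pos_sq (x * w i)) qy.
apply: le_trans h _.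
rewrite bopZv (psdZl dp) (psdZr dp) (mulrA (Num.sqrt k)) -expr2 sqr_sqrtr ?(ltW k0) //.
by rewrite !bopM starEr.
Qed.

End BoundedVectors.

Lemma fcvg_norm (R : realType) (H : hilbert R) (s : nat -> H) u : fcvg (@rdot R H) s u ->
  forall e : R, 0 < e -> exists N, forall n, (N <= n)%N -> `|<<u, u>> - << s n, s n>>| < e.
Proof.
move=> su e e0; have dp := rdot_psd H.
have [N hN] := fcvg_dot dp u su (divr_gt0 e0 (ltr0Sn R 3)).
have [M hM] := su _ (divr_gt0 e0 (ltr0Sn R 1)).
exists (maxn N M) => n; rewrite geq_max => /andP[/hN h1 /hM].
have := psd_ge0 dp (u - s n); rewrite (psdB2 dp); move: h1; rewrite !ltr_norml (psdC dp (s n)).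
by move=> /andP[h1 h2] h3 h4; apply/andP; split; lra.
Qed.

(** * Extension of bounded relations with dense domain *)

Section Extension.
Variables (R : realType) (H1 H2 : hilbert R).
Let dp1 := rdot_psd H1.
Let dp2 := rdot_psd H2.

Lemma fcvg_map (S : H1 -> H2) (C : R) (s : nat -> H1) u : 0 <= C ->
  (forall u v, S (u - v) = S u - S v) -> (forall u, <<S u, S u>> <= C * <<u, u>>) ->
  fcvg (@rdot R H1) s u -> fcvg (@rdot R H2) (fun n => S (s n)) (S u).
Proof.
move=> C0 SB hS su e e0; have C1 : 0 < C + 1 by lra.
have [N hN] := su _ (divr_gt0 e0 C1); exists N => n /hN; rewrite ltr_pdivlMr // => h.
rewrite -SB; apply: le_lt_trans (hS _) _.
by have := psd_ge0 dp1 (u - s n); nra.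
Qed.

Lemma dense_seq (D : set H1) u : (forall e : R, 0 < e -> exists2 d, D d & << u - d, u - d>> < e) ->
  exists s : nat -> H1, (forall n, D (s n)) /\ fcvg (@rdot R H1) s u.
Proof.
move=> h.
have hn n : exists d, D d /\ << u - d, u - d>> < n.+1%:R^-1.
  have [d Dd hd] := h n.+1%:R^-1 (ltac:(by rewrite invr_gt0 ltr0n)).
  by exists d.
have [s hs] := choice hn; exists s; split => [n|]; first by case: (hs n).
move=> e /inv_lt_ex [N hN]; exists N => n /hN; apply: lt_trans; by case: (hs n).
Qed.

(** Stated for a graph, so that well-definedness need not be checked beforehand: the bound forces
    two values over the same u to agree. *)
Lemma extension (G : H1 -> H2 -> Prop) (C : R) : 0 <= C ->
  (forall k u v u' v', G u v -> G u' v' -> G (k *: u + u') (k *: v + v')) ->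
  (forall u v, G u v -> <<v, v>> <= C * <<u, u>>) ->
  (forall u (e : R), 0 < e -> exists u' v', G u' v' /\ <<u - u', u - u'>> < e) ->
  exists S : H1 -> H2, [/\ linear S, (forall u, <<S u, S u>> <= C * <<u, u>>) &
     forall u v, G u v -> S u = v].
Proof.
move=> C0 Glin Gbd Gdense.
have GB u v u' v' : G u v -> G u' v' -> G (u - u') (v - v').
  by move=> h h'; rewrite addrC [v - _]addrC -(scaleN1r u') -(scaleN1r v'); exact: Glin.
pose Gb u v := exists s s', [/\ forall n, G (s n) (s' n), fcvg (@rdot R H1) s u &
                              fcvg (@rdot R H2) s' v].
have ex u : exists v, Gb u v.
  have [s [hs su]] := @dense_seq [set u' | exists v', G u' v'] u (fun e e0 => ltac:(
      by have [u' [v' [g h]]] := Gdense u e e0; exists u' => //; exists v')).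
  have [s' hs'] := choice hs.
  have [v hv] : exists v, fcvg (@rdot R H2) s' v.
    apply: hilbert_complete => e e0; have C1 : 0 < 4 * (C + 1) by lra.
    have [N hN] := su _ (divr_gt0 e0 C1); exists N => m n Nm Nn.
    apply: le_lt_trans (Gbd _ _ (GB _ _ _ _ (hs' m) (hs' n))) _.
    have := psd_tri2 dp1 (s m) u (s n); rewrite (psd_swap2 dp1 (s m) u).
    have := hN _ Nm; have := hN _ Nn; rewrite !ltr_pdivlMr // => h1 h2 h3.
    have X0 := psd_ge0 dp1 (s m - s n).
    have h4 : C * << s m - s n, s m - s n>> <= (C + 1) * << s m - s n, s m - s n>>.
      by apply: ler_wpM2r => //; lra.
    apply: le_lt_trans h4 _.
    have C2 : 0 <= C + 1 by lra.
    have := ler_wpM2l C2 h3; rewrite mulrDr; move: h1 h2; clear.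
    by move: (C + 1) <<u - s n, u - s n>> <<u - s m, u - s m>> => c x y; lra.
  by exists v, s, s'.
have Gb_bd u v : Gb u v -> <<v, v>> <= C * <<u, u>>.
  move=> [s [s' [g su sv]]].
  apply/ler_addgt0Pl => e e0; rewrite addrC.
  have C1 : 0 < C + 1 by lra.
  have d0 : 0 < e / (C + 1) by rewrite divr_gt0.
  have [N hN] := fcvg_norm su d0; have [M hM] := fcvg_norm sv d0.
  have := hN _ (leq_maxl N M); have := hM _ (leq_maxr N M); set n := maxn N M.
  have h := Gbd _ _ (g n); rewrite !ltr_norml => /andP[_ h1] /andP[h2 _].
  have h3 : C * << s n, s n>> <= C * (<<u, u>> + e / (C + 1)).
    by apply: ler_wpM2l => //; lra.
  have h4 : C * (e / (C + 1)) + e / (C + 1) = e.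
    by rewrite -[X in _ + X]mul1r -mulrDl mulrCA mulfV ?gt_eqF // mulr1.
  by move: h3; rewrite mulrDr; lra.
have Gb_lin k u v u' v' : Gb u v -> Gb u' v' -> Gb (k *: u + u') (k *: v + v').
  move=> [s [s' [g su sv]]] [r [r' [g' ru rv]]].
  exists (fun n => k *: s n + r n), (fun n => k *: s' n + r' n); split.
  - by move=> n; exact: Glin.
  - by apply: fcvgD => //; exact: fcvgZ.
  - by apply: fcvgD => //; exact: fcvgZ.
have Gb_fun u v v' : Gb u v -> Gb u v' -> v = v'.
  move=> h h'; have := Gb_lin (-1) _ _ _ _ h h'.
  rewrite !scaleN1r addNr => /Gb_bd; rewrite (psd0l dp1) mulr0 => h0.
  have /rdot_eq0 : <<- v + v', - v + v'>> = 0 by apply/le_anti; rewrite h0 (psd_ge0 dp2).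
  by rewrite addrC => /eqP; rewrite subr_eq0 eq_sym => /eqP.
have [S hS] := choice ex; exists S; split.
- by move=> k u v; apply: Gb_fun (hS _) _; exact: Gb_lin.
- by move=> u; exact: Gb_bd.
- move=> u v g; apply: Gb_fun (hS u) _.
  exists (fun=> u), (fun=> v); split; [by [] | exact: fcvg_cst | exact: fcvg_cst].
Qed.
End Extension.

(** * The standard form and the Jones projection *)

Section StandardForm.
Variables (R : realType) (H K : hilbert R).
Let dH := rdot_psd H.
Let dK := rdot_psd K.
Local Notation cvgH := (fcvg (@rdot R H)).
Local Notation cvgK := (fcvg (@rdot R K)).
Variables (A N : set (bop H)) (t : bop H -> R) (h : bop H -> K).
Hypotheses (hF : factor A) (ht : ftrace A t).
Hypotheses (NA : N `<=` A) (hN : vNset N) (N1 : N 1).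
Let hA : vNset A. Proof. by case: hF. Qed.
Let A1 : A 1. Proof. by case: hF. Qed.
Hypothesis hlin : forall (k : R[i]) x y, A x -> A y -> h (k *: x + y) = k *: h x + h y.
Hypothesis hdotE : forall x y, A x -> A y -> <<h x, h y>> = t (y^# * x).
Hypothesis hdense : forall u (e : R), 0 < e -> exists2 v, (h @` A) v & <<u - v, u - v>> < e.
Implicit Types (x y z m n : bop H) (T X Y Z : bop K).

Lemma hB x y : A x -> A y -> h (x - y) = h x - h y.
Proof.
by move=> Ax Ay; have := hlin (-1) Ay Ax; rewrite !scaleN1r ![- _ + _]addrC.
Qed.
Lemma h_norm x : A x -> <<h x, h x>> = t (x^# * x).
Proof. by move=> Ax; rewrite hdotE. Qed.
Lemma h_inj x : A x -> h x = 0 -> x = 0.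
Proof.
by move=> Ax hx; apply: (t_sq_eq0 ht Ax); rewrite -h_norm // hx (psd0l dK).
Qed.
(** The trace property makes x |-> [x^#] isometric in L2, so adjoints of approximants converge as
    well. *)
Lemma h_star x : A x -> <<h (x^#), h (x^#)>> = <<h x, h x>>.
Proof.
move=> Ax; have As := vNstar hA Ax.
by rewrite !h_norm // starK (tC ht).
Qed.

Lemma t_star x : A x -> t (x^#) = t x.
Proof.
move=> Ax; have := hdotE A1 Ax; rewrite (psdC dK) hdotE // mulr1 => <-.
by rewrite star1 mul1r.
Qed.

(** If x x^# <= C then (y x)(y x)^# <= C y y^#, and the trace turns this into a bound for right
    multiplication. The alternative [~ A x] lets the statement hold for every x. *)
Lemma t_right_bd x : exists2 C : R, 0 <= C & forall y, A y ->
   t ((y * x)^# * (y * x)) <= C * t (y^# * y) \/ ~ A x.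
Proof.
have [Ax|nAx] := pselect (A x); last by exists 0 => // y _; right.
have [C C0 hC] := sa_bound (pos_sq (x^#)).1; exists C; first exact: ltW.
rewrite starK in hC; move=> y Ay; left.
have Ayx := vNM hA Ay Ax; have Ays := vNstar hA Ay.
rewrite (tC ht (vNstar hA Ayx) Ayx) (tC ht Ays Ay) -(tZ hA ht); last exact: (vN_sqr hF).
apply: (pf_le hF (posfun_trace hF ht)).
- exact: (vN_sqr hF).
- by apply: (vNZ hA); exact: (vN_sqr hF).
have := pos_sandwich (y^#) hC; rewrite starK starM.
have -> : y * (C%:C *: (1 : bop H) - x * x^#) * y^# = C%:C *: (y * y^#) - y * x * (x^# * y^#) by bop_ring.
by [].
Qed.

Lemma h_ext (k : bop H -> bop H) : (forall (c : R[i]) x y, A x -> A y -> k (c *: x + y) = c *: k x + k y) ->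
  (forall x, A x -> A (k x)) ->
  (exists2 C : R, 0 <= C & forall y, A y -> <<h (k y), h (k y)>> <= C * <<h y, h y>>) ->
  exists T, forall y, A y -> T (h y) = h (k y).
Proof.
move=> klin kA [C C0 hC].
pose G (u v : K) := exists y, [/\ A y, u = h y & v = h (k y)].
have [||| S [Sl Sb SG]] := @extension R K K G C C0.
- move=> c u v u' v' [y [Ay -> ->]] [y' [Ay' -> ->]]; exists (c *: y + y'); split.
  + exact: (vNlin hA).
  + by rewrite hlin.
  + by rewrite klin // hlin //; exact: kA.
- by move=> u v [y [Ay -> ->]]; exact: hC.
- move=> u e e0; have [_ [y Ay <-] hy] := hdense u e0.
  by exists (h y), (h (k y)); split => //; exists y.
have bS : bounded_op S by apply/bounded_opP; split => //; exists C.
by exists (mkbop bS) => y Ay; apply: SG; exists y.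
Qed.

Lemma right_ex x : exists T, A x -> forall y, A y -> T (h y) = h (y * x).
Proof.
have [Ax|nAx] := pselect (A x); last by exists 0.
have [||| T hT] := @h_ext (fun y => y * x).
- by move=> c y z _ _; rewrite mulrDl -bopZAl.
- by move=> y Ay; exact: (vNM hA).
- have [C C0 hC] := t_right_bd x; exists C => // y Ay.
  rewrite !h_norm //; last exact: (vNM hA).
  by have [] := hC y Ay.
by exists T.
Qed.

Lemma left_ex x : exists T, A x -> forall y, A y -> T (h y) = h (x * y).
Proof.
have [Ax|nAx] := pselect (A x); last by exists 0.
have [||| T hT] := @h_ext (fun y => x * y).
- by move=> c y z _ _; rewrite mulrDr -bopZAr.
- by move=> y Ay; exact: (vNM hA).
- have [C C0 hC] := sa_bound (pos_sq x).1; exists C; first exact: ltW.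
  move=> y Ay; rewrite !h_norm // -?(tZ hA ht); [|exact: (vN_sq hF)|exact: (vNM hA)].
  apply: (pf_le hF (posfun_trace hF ht)).
  + by apply: (vN_sq hF); exact: (vNM hA).
  + by apply: (vNZ hA); exact: (vN_sq hF).
  have := pos_sandwich y hC.
  have -> : y^# * (C%:C *: (1 : bop H) - x^# * x) * y = C%:C *: (y^# * y) - (x * y)^# * (x * y).
    by rewrite starM; bop_ring.
  by [].
by exists T.
Qed.

(** Right and left multiplication on the completion; for x outside A the chosen operator is
    arbitrary. *)
Definition rightop x : bop K := projT1 (cid (right_ex x)).
Definition leftop x : bop K := projT1 (cid (left_ex x)).
Lemma rightopE x y : A x -> A y -> rightop x (h y) = h (y * x).
Proof. by move=> Ax; rewrite /rightop; case: cid => T /= /(_ Ax); apply. Qed.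
Lemma leftopE x y : A x -> A y -> leftop x (h y) = h (x * y).
Proof. by move=> Ax; rewrite /leftop; case: cid => T /= /(_ Ax); apply. Qed.

Lemma h_eq T X : (forall y, A y -> T (h y) = X (h y)) -> T = X.
Proof.
move=> hTX; apply: bop_ext => u.
have [s [hs su]] := dense_seq (fun e e0 => hdense u e0).
apply: fcvg_unique (fcvg_op T su) _; apply: fcvg_eq (fcvg_op X su) => n.
by have [y Ay <-] := hs n; rewrite hTX.
Qed.
Lemma h_dot_eq (u v : K) : (forall y, A y -> <<u, h y>> = <<v, h y>>) -> u = v.
Proof.
move=> huv; apply: rdot_extr => w.
have [s [hs sw]] := dense_seq (fun e e0 => hdense w e0).
apply: (psd_cvg_eq2 dK sw sw) => n.
by have [y Ay <-] := hs n; rewrite !(psdC dK (h y)) huv.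
Qed.

Lemma leftop_star x : A x -> leftop (x^#) = (leftop x)^#.
Proof.
move=> Ax; have As := vNstar hA Ax; apply: h_eq => y Ay; apply: h_dot_eq => z Az.
by rewrite starEr !leftopE // !hdotE ?starM ?mulrA //; exact: (vNM hA).
Qed.
Lemma rightop_star x : A x -> rightop (x^#) = (rightop x)^#.
Proof.
move=> Ax; have As := vNstar hA Ax; apply: h_eq => y Ay; apply: h_dot_eq => z Az.
rewrite starEr !rightopE // !hdotE ?starM //; try exact: (vNM hA).
rewrite mulrA (tC ht) ?mulrA //; apply: (vNM hA) => //; exact: (vNstar hA).
Qed.
Lemma leftop_lin (k : R[i]) x y : A x -> A y -> leftop (k *: x + y) = k *: leftop x + leftop y.
Proof.
move=> Ax Ay; apply: h_eq => z Az; rewrite !bopE !leftopE //; last exact: (vNlin hA).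
rewrite mulrDl -bopZAl hlin //; exact: (vNM hA).
Qed.
Lemma leftopM x y : A x -> A y -> leftop (x * y) = leftop x * leftop y.
Proof.
move=> Ax Ay; apply: h_eq => z Az; rewrite !bopE !leftopE ?mulrA //; exact: (vNM hA).
Qed.
Lemma leftop1 : leftop 1 = 1.
Proof. by apply: h_eq => z Az; rewrite leftopE // mul1r. Qed.

Variable e : bop K.
Hypothesis he : proj e.
Hypothesis eN : forall n, N n -> e (h n) = h n.
Hypothesis eran : forall u (d : R), 0 < d -> exists2 v, (h @` N) v & << e u - v, e u - v>> < d.

Lemma eseq (u : K) : e u = u -> exists n : nat -> bop H, (forall k, N (n k)) /\ cvgK (fun k => h (n k)) u.
Proof.
move=> eu; have [s [hs su]] := dense_seq (fun d d0 => eran u d0).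
have hk k : exists n, N n /\ h n = s k by have [n Nn <-] := hs k; exists n.
have [n hn] := choice hk; exists n; split => [k|]; first by case: (hn k).
rewrite eu in su; apply: fcvg_eq su => k; by case: (hn k).
Qed.

Lemma e_eq T X : (forall n, N n -> T (h n) = X (h n)) -> T * e = X * e.
Proof.
move=> hTX; apply: bop_ext => u; rewrite !bopM.
have [n [Nn nu]] := eseq (ltac:(by rewrite -bopM he.2) : e (e u) = e u).
apply: fcvg_unique (fcvg_op T nu) _; apply: fcvg_eq (fcvg_op X nu) => k.
by rewrite hTX.
Qed.

(** The range of e is invariant under T and [T^#], hence reducing. *)
Lemma e_comm T : (forall n, N n -> e (T (h n)) = T (h n)) ->
  (forall n, N n -> e (T^# (h n)) = T^# (h n)) -> comm T e.
Proof.
move=> h1 h2; have e1 : e * T * e = T * e by apply: e_eq => n Nn; exact: h1.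
have e2 : e * T^# * e = T^# * e by apply: e_eq => n Nn; exact: h2.
have e3 : e * T * e = e * T by have := congr1 (@star R K) e2; rewrite !starM starK he.1 mulrA.
by rewrite /comm -e3 -e1.
Qed.

Lemma rightop_e n : N n -> comm (rightop n) e.
Proof.
move=> Nn; apply: e_comm => m Nm.
  by rewrite rightopE ?eN //; [exact: (vNM hN) | exact: NA | exact: NA].
rewrite -rightop_star; last exact: NA.
have Ns := vNstar hN Nn.
by rewrite rightopE ?eN //; [exact: (vNM hN) | exact: NA | exact: NA].
Qed.
Lemma leftop_e n : N n -> comm (leftop n) e.
Proof.
move=> Nn; apply: e_comm => m Nm.
  by rewrite leftopE ?eN //; [exact: (vNM hN) | exact: NA | exact: NA].
rewrite -leftop_star; last exact: NA.
have Ns := vNstar hN Nn.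
by rewrite leftopE ?eN //; [exact: (vNM hN) | exact: NA | exact: NA].
Qed.

Variable Q : set (bop K).
Hypotheses (hQ : vNset Q) (Q1 : Q 1) (Qe : Q e).
Hypothesis QL : forall x, A x -> Q (leftop x).
Hypothesis Qmin : forall B, vNset B ->
  (forall x T, A x -> (forall y, A y -> T (h y) = h (x * y)) -> B T) -> B e -> Q `<=` B.

(** The commutant of the right action of N is a von Neumann algebra containing the left action of A
    and e, hence it contains the basic construction. *)
Lemma Q_rightop T n : Q T -> N n -> T * rightop n = rightop n * T.
Proof.
pose B := [set T : bop K | forall n, N n -> T * rightop n = rightop n * T].
have hB : vNset B.
  split.
  - split; first by move=> m _; rewrite mul0r mulr0.
    by move=> k X Y hX hY m Nm; rewrite mulrDl mulrDr -bopZAl -bopZAr hX // hY.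
  - by move=> X Y hX hY m Nm; rewrite -mulrA hY // mulrA hX // mulrA.
  - move=> X hX m Nm; have := congr1 (@star R K) (hX _ (vNstar hN Nm)).
    by rewrite !starM rightop_star ?starK //; exact: NA.
  - move=> X hX m Nm.
    have := @adherent_eq _ _ B 1 (rightop m) (rightop m) 1 X; rewrite mul1r mulr1; apply => // Y hY.
    by rewrite mul1r mulr1; exact: hY.
move=> QT; have := Qmin hB _ _ QT; apply.
  move=> x X Ax hX m Nm; have Am := NA Nm; apply: h_eq => y Ay.
  by rewrite !bopM !(rightopE, hX) ?mulrA //; exact: (vNM hA).
by move=> m Nm; rewrite rightop_e.
Qed.

Definition theta n : bop K := leftop n * e.

Hypothesis tnormal : seqnormal A t.
Let D := bdv A t.

Lemma vec_ex (d : H) : D d -> exists S : K -> H, [/\ linear S,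
  (exists2 C : R, 0 <= C & forall u, <<S u, S u>> <= C * <<u, u>>) & forall x, A x -> S (h x) = x d].
Proof.
move=> [C C0 hC].
pose G (u : K) (v : H) := exists x, [/\ A x, u = h x & v = x d].
have [||| S [Sl Sb SG]] := @extension R K H G C C0.
- move=> c u v u' v' [y [Ay -> ->]] [y' [Ay' -> ->]]; exists (c *: y + y'); split.
  + exact: (vNlin hA).
  + by rewrite hlin.
  + by rewrite !bopE.
- by move=> u v [y [Ay -> ->]]; rewrite h_norm //; exact: hC.
- move=> u d' d0; have [_ [y Ay <-] hy] := hdense u d0.
  by exists (h y), (y d); split => //; exists y.
exists S; split => //; first by exists C.
by move=> x Ax; apply: SG; exists x.
Qed.

(** T is determined by T(h 1), because it commutes with right multiplication by N. Approximating T(h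
    1) by h(n_k) fixes the n_k; the same n_k serve for [T^#], since adjoints are isometric in L2. *)
Lemma corner_seq T : Q T -> e * T = T -> T * e = T -> exists n : nat -> bop H,
  [/\ forall k, N (n k),
      forall m, N m -> cvgK (fun k => h (n k * m)) (T (h m)) &
      forall m, N m -> cvgK (fun k => h ((n k)^# * m)) (T^# (h m))].
Proof.
move=> QT eT Te; have QTs := vNstar hQ QT.
have eTs : e * T^# = T^# by rewrite -[in LHS]he.1 -starM Te.
have [n [Nn nT]] := eseq (ltac:(by rewrite -bopM eT) : e (T (h 1)) = T (h 1)).
have An k : A (n k) := NA (Nn k).
have Ans k : A ((n k)^#) := vNstar hA (An k).
have T_m m : N m -> T (h m) = rightop m (T (h 1)).
  move=> Nm; have Am := NA Nm.
  have -> : h m = rightop m (h 1) by rewrite rightopE // mul1r.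
  by rewrite -bopM Q_rightop.
have Ts_m m : N m -> T^# (h m) = rightop m (T^# (h 1)).
  move=> Nm; have Am := NA Nm.
  have -> : h m = rightop m (h 1) by rewrite rightopE // mul1r.
  by rewrite -bopM Q_rightop.
exists n; split => // m Nm; have Am := NA Nm.
  rewrite T_m //; apply: fcvg_eq (fcvg_op (rightop m) nT) => k.
  by rewrite rightopE.
rewrite Ts_m //.
have [v nv] : exists v, cvgK (fun k => h ((n k)^#)) v.
  apply: hilbert_complete => d d0; have d1 : 0 < d / 4 by rewrite divr_gt0.
  have [M hM] := nT _ d1; exists M => i j Mi Mj.
  rewrite -hB // -starB h_star; last exact: (vNB hA).
  rewrite hB //; have := psd_tri2 dK (h (n i)) (T (h 1)) (h (n j)).
  rewrite (psd_swap2 dK (h (n i)) (T _)).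
  by have := hM _ Mi; have := hM _ Mj; lra.
have ev : e v = v.
  apply: fcvg_unique (fcvg_op e nv) _; apply: fcvg_eq nv => k.
  by rewrite eN //; exact: (vNstar hN).
(* Both vectors lie in the range of e, the closure of h(N), so testing against h x with x in N is
   enough. *)
have -> : T^# (h 1) = v.
  apply/eqP; rewrite -subr_eq0; apply/eqP/rdot_eq0.
  set w := T^# (h 1) - v.
  have ew : e w = w by rewrite bopBv ev -bopM eTs.
  have wN x : N x -> <<h x, w>> = 0.
    move=> Nx; have Ax := NA Nx; rewrite (psdBr dK) -starE T_m //.
    apply/eqP; rewrite subr_eq0; apply/eqP.
    rewrite [RHS](psdC dK).
    apply: (psd_cvg_eq2 dK (fcvg_op (rightop x) nT) nv) => k.
    rewrite rightopE // !hdotE //; last exact: (vNM hA).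
    by rewrite star1 mul1r -starM t_star //; exact: (vNM hA).
  have [x [Nx xw]] := eseq ew.
  by apply: (fcvg_dot_eq xw) => k; exact: wN.
apply: fcvg_eq (fcvg_op (rightop m) nv) => k.
by rewrite rightopE.
Qed.

(* This says that the corner commutes with S^# S, which lies in the commutant of the
   left action of N. *)
Lemma corner_symm T d (S : K -> H) : Q T -> e * T = T -> T * e = T ->
  linear S -> (exists2 C : R, 0 <= C & forall u, << S u, S u>> <= C * <<u, u>>) ->
  (forall x, A x -> S (h x) = x d) ->
  forall u v, e u = u -> e v = v -> << S (T u), S v>> = << S u, S (T^# v)>>.
Proof.
move=> QT eT Te Sl [C C0 SC] Sd u v eu ev.
have Scv s w : cvgK s w -> cvgH (fun k => S (s k)) (S w).
  by apply: fcvg_map C0 _ SC => x y; exact: (linB Sl).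
have [n [Nn n1 n2]] := corner_seq QT eT Te.
have base a b : N a -> N b -> << S (T (h a)), S (h b)>> = << S (h a), S (T^# (h b))>>.
  move=> Na Nb; rewrite [RHS](psdC dH).
  apply: (psd_cvg_eq2 dH (Scv _ _ (n1 a Na)) (Scv _ _ (n2 b Nb))) => k.
  have [Aa Ab Ank] := And3 (NA Na) (NA Nb) (NA (Nn k)).
  rewrite !Sd //; [|exact: (vNM hA (vNstar hA Ank) Ab) | exact: (vNM hA)].
  by rewrite !bopM starE (psdC dH).
have [a [Na au]] := eseq eu; have [b [Nb bv]] := eseq ev.
have step b' : N b' -> << S (T u), S (h b')>> = << S u, S (T^# (h b'))>>.
  move=> Nb'; apply: (psd_cvg_eq2 dH (Scv _ _ (fcvg_op T au)) (Scv _ _ au)) => k.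
  by rewrite base.
rewrite (psdC dH) [RHS](psdC dH).
apply: (psd_cvg_eq2 dH (Scv _ _ bv) (Scv _ _ (fcvg_op (T^#) bv))) => k.
by rewrite (psdC dH) step // (psdC dH).
Qed.

(** If C bounds [T^# T], then Y = C e - [T^# T] is positive, and its root Z is again in the corner.
    The symmetry relation for Z and for T gives 0 <= |S Z (h 1)|^2 = C |d|^2 - |S T (h 1)|^2, with C
    independent of d. *)
Lemma corner_bound T : Q T -> e * T = T -> T * e = T -> exists2 C : R, 0 <= C &
  forall d (S : K -> H), linear S ->
  (exists2 C : R, 0 <= C & forall u, << S u, S u>> <= C * <<u, u>>) ->
  (forall x, A x -> S (h x) = x d) ->
  << S (T (h 1)), S (T (h 1))>> <= C * << d, d>>.
Proof.
move=> QT eT Te; have QTs := vNstar hQ QT.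
have eTs : e * T^# = T^# by rewrite -[in LHS]he.1 -starM Te.
have Tse : T^# * e = T^# by rewrite -[in LHS]he.1 -starM eT.
have [C C0 hC] := sa_bound (pos_sq T).1; exists C; first exact: ltW.
move=> d S Sl Sb Sd.
pose Y := C%:C *: e - T^# * T.
have pY : pos Y.
  have -> : Y = e^# * (C%:C *: (1 : bop K) - T^# * T) * e.
    rewrite he.1 mulrBr mulrBl -bopZAr -bopZAl mulr1 he.2 /Y; congr (_ - _).
    by rewrite mulrA eTs -mulrA Te.
  exact: pos_sandwich.
have QY : Q Y by apply: (vNB hQ); [exact: (vNZ hQ) | exact: (vNM hQ)].
have [Z [pZ ZZ _ ZQ]] := bop_sqrt pY.
have QZ : Q Z by exact: ZQ.
have Y1e : Y * (1 - e) = 0.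
  by rewrite mulrBr mulr1 /Y mulrBl -bopZAl he.2 -mulrA Te subrr.
have Ze : Z * e = Z.
  have /eqP : Z * (1 - e) = 0.
    by apply: star_mul0; rewrite starM pZ.1 -mulrA (mulrA Z) ZZ Y1e mulr0.
  by rewrite mulrBr mulr1 subr_eq0 eq_sym => /eqP.
have eZ : e * Z = Z by have := congr1 (@star R K) Ze; rewrite starM pZ.1 he.1.
have eh1 : e (h 1) = h 1 by exact: eN.
have e1 : << S (T (h 1)), S (T (h 1))>> = << S (h 1), S ((T^# * T) (h 1))>>.
  by apply: (corner_symm (d := d)) => //; rewrite -bopM eT.
have e2 : << S (Z (h 1)), S (Z (h 1))>> = << S (h 1), S (Y (h 1))>>.
  rewrite -ZZ bopM -{3}pZ.1.
  by apply: (corner_symm (d := d)) => //; rewrite -bopM eZ.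
have Yh1 : S (Y (h 1)) = C%:C *: S (h 1) - S ((T^# * T) (h 1)).
  by rewrite /Y bopB bopZ eh1 (linB Sl) (linZ Sl).
have := psd_ge0 dH (S (Z (h 1))).
by rewrite e2 Yh1 (psdBr dH) (psdZr dH) -e1 Sd // bop1; lra.
Qed.

(** As S h(n_k) = n_k d, convergence in L2 becomes convergence at every bounded vector d, and the
    uniform bound extends the limit to all of H. *)
Lemma corner_vec_limit T (n : nat -> bop H) : Q T -> e * T = T -> T * e = T ->
  (forall k, N (n k)) -> cvgK (fun k => h (n k)) (T (h 1)) ->
  exists y : bop H, forall d, D d -> cvgH (fun k => n k d) (y d).
Proof.
move=> QT eT Te Nn nT.
have [C C0 hC] := corner_bound QT eT Te.
have lim d : D d -> exists v, cvgH (fun k => n k d) v /\ <<v, v>> <= C * << d, d>>.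
  move=> Dd; have [S [Sl Sb Sd]] := vec_ex Dd.
  exists (S (T (h 1))); split; last exact: hC.
  have [C' C'0 SC] := Sb.
  have := fcvg_map C'0 (linB Sl) SC nT; apply: fcvg_eq => k.
  by rewrite Sd //; exact: NA.
pose G (d v : H) := D d /\ cvgH (fun k => n k d) v.
have DZ (c : R[i]) d : D d -> D (c *: d).
  move=> [B B0 hB']; exists ((complex.Re c ^+ 2 + complex.Im c ^+ 2) * B).
    by rewrite mulr_ge0 // addr_ge0 ?sqr_ge0.
  by move=> x Ax; rewrite bopZv rdot_scale -mulrA ler_wpM2l ?hB' // addr_ge0 ?sqr_ge0.
have [||| S [Sl Sb SG]] := @extension R H H G C C0.
- move=> c u v u' v' [Du uv] [Du' uv']; split.
    by apply: (bdvD); [exact: DZ | ].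
  apply: (@fcvg_eq _ _ (fun k => c *: n k u + n k u')); first by move=> k; rewrite bopDv bopZv.
  by apply: fcvgD => //; exact: fcvgZ.
- move=> u v [Du uv]; have [v' [uv' hv']] := lim u Du.
  by rewrite (fcvg_unique uv uv').
- move=> u d d0; have [u' Du' hu'] := bdv_dense hF ht tnormal u d0.
  by have [v' [uv' _]] := lim u' Du'; exists u', v'.
have bS : bounded_op S by apply/bounded_opP; split => //; exists C.
exists (mkbop bS) => d Dd; have [v [dv _]] := lim d Dd.
by have -> : mkbop bS d = v by apply: SG.
Qed.

Lemma h_norm_dominated : exists (l : nat) (xi : nat -> H), (forall i, (i < l)%N -> D (xi i)) /\
  forall x, A x -> <<h x, h x>> <= \sum_(i < l) <<x (xi i), x (xi i)>>.
Proof.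
have [l [xi [h1 h2]]] := trace_dominated hF ht tnormal.
by exists l, xi; split => // x Ax; rewrite h_norm //; exact: h2.
Qed.

Lemma corner_theta T : Q T -> e * T = T -> T * e = T -> exists2 m, N m & T = theta m.
Proof.
move=> QT eT Te; have QTs := vNstar hQ QT.
have eTs : e * T^# = T^# by rewrite -[in LHS]he.1 -starM Te.
have Tse : T^# * e = T^# by rewrite -[in LHS]he.1 -starM eT.
have [n [Nn n1 n2]] := corner_seq QT eT Te.
have c1 : cvgK (fun k => h (n k)) (T (h 1)).
  by apply: fcvg_eq (n1 1 N1) => k; rewrite mulr1.
have c2 : cvgK (fun k => h ((n k)^#)) (T^# (h 1)).
  by apply: fcvg_eq (n2 1 N1) => k; rewrite mulr1.
have [y hy] := corner_vec_limit QT eT Te Nn c1.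
have [y' hy'] := corner_vec_limit QTs eTs Tse (fun k => vNstar hN (Nn k)) c2.
(* The adjoint relation holds on D along the approximants and extends by density in each variable in
   turn. *)
have yy : y' = y^#.
  have ysD d d' : D d -> D d' -> <<y d, d'>> = << d, y' d'>>.
    move=> Dd Dd'; rewrite [RHS](psdC dH).
    apply: (psd_cvg_eq2 dH (hy d Dd) (hy' d' Dd')) => k.
    by rewrite starE (psdC dH).
  apply: star_unique => u v.
  have [s [hs su]] := dense_seq (fun d d0 => bdv_dense hF ht tnormal u d0).
  have [r [hr rv]] := dense_seq (fun d d0 => bdv_dense hF ht tnormal v d0).
  have step d : D d -> <<y u, d>> = <<u, y' d>>.
    move=> Dd; apply: (psd_cvg_eq2 dH (fcvg_op y su) su) => k.
    by rewrite ysD //; exact: hs.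
  rewrite (psdC dH) [RHS](psdC dH).
  apply: (psd_cvg_eq2 dH rv (fcvg_op y' rv)) => k.
  by rewrite (psdC dH) step ?(psdC dH u) //; exact: hr.
have Ny : N y.
  apply: (vN_strong_star (D := D) hN); first by move=> u d d0; exact: (bdv_dense hF ht tnormal).
  move=> s d sD d0.
  have [k hk] : exists k, forall v, v \in s ->
      <<y v - n k v, y v - n k v>> < d /\ <<y^# v - (n k)^# v, y^# v - (n k)^# v>> < d.
    have [M hM] : exists M, forall k, (M <= k)%N -> forall v, v \in s ->
      <<y v - n k v, y v - n k v>> < d /\ <<y^# v - (n k)^# v, y^# v - (n k)^# v>> < d.
      elim: s sD => [|v s ih] sD; first by exists 0%N.
      have [|M hM] := ih; first by move=> w ws; apply: sD; rewrite in_cons ws orbT.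
      have Dv : D v by apply: sD; rewrite mem_head.
      have [M1 hM1] := hy v Dv d d0; have := hy' v Dv; rewrite yy => /(_ d d0) [M2 hM2].
      exists (maxn M (maxn M1 M2)) => k; rewrite !geq_max => /and3P[k0 k1 k2] w.
      by rewrite in_cons => /orP[/eqP ->|]; [split; [exact: hM1 | exact: hM2] | exact: hM].
    by exists M; exact: hM.
  by exists (n k).
have Ay := NA Ny.
(* Convergence of n_k to y is known only at bounded vectors of H; finitely many of these dominate
   the L2 norm, so h(n_k) also converges to h y. *)
have hyT : h y = T (h 1).
  have [l [xi [Dxi hxi]]] := h_norm_dominated.
  have cy : cvgK (fun k => h (n k)) (h y).
    move=> d d0; have l0 : 0 < d / l.+1%:R by rewrite divr_gt0 ?ltr0n.
    have hM i : exists M, (i < l)%N -> forall k, (M <= k)%N ->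
        <<y (xi i) - n k (xi i), y (xi i) - n k (xi i)>> < d / l.+1%:R.
      case: (ltnP i l) => [il|_]; last by exists 0%N.
      by have [M h1] := hy (xi i) (Dxi i il) _ l0; exists M.
    have [M hM'] := choice hM.
    exists (\max_(i < l) M i)%N => k Mk.
    have Ank := NA (Nn k).
    rewrite -hB //; apply: le_lt_trans (hxi _ (vNB hA Ay Ank)) _.
    apply: (@le_lt_trans _ _ (\sum_(i < l) d / l.+1%:R)).
      apply: ler_sum => i _; apply: ltW; apply: hM' => //.
      by apply: leq_trans Mk; exact: (leq_bigmax (F := fun i : 'I_l => M i)).
    rewrite sumr_const card_ord -[X in X < _]mulr_natr mulrAC ltr_pdivrMr ?ltr0n //.
    by rewrite ltr_pM2l // ltr_nat.
  exact: fcvg_unique cy c1.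
exists y => //; rewrite -Te /theta; apply: e_eq => m Nm.
have Am := NA Nm.
apply: fcvg_unique (n1 m Nm) _; rewrite leftopE // -rightopE // hyT.
by apply: fcvg_eq (fcvg_op (rightop m) c1) => k; rewrite rightopE //; exact: NA.
Qed.

Lemma theta_lin (k : R[i]) m n : N m -> N n -> theta (k *: m + n) = k *: theta m + theta n.
Proof.
move=> Nm Nn; rewrite /theta leftop_lin; [|exact: NA|exact: NA].
by rewrite mulrDl -bopZAl.
Qed.
Lemma theta0 : theta 0 = 0.
Proof. by have := theta_lin (-1) N1 N1; rewrite !scaleN1r !addNr. Qed.
Lemma thetaM m n : N m -> N n -> theta (m * n) = theta m * theta n.
Proof.
move=> Nm Nn; rewrite /theta leftopM; [|exact: NA|exact: NA].
by rewrite -!mulrA (mulrA e) -(leftop_e Nn) -!mulrA he.2.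
Qed.
Lemma theta_star n : N n -> theta (n^#) = (theta n)^#.
Proof.
move=> Nn; rewrite /theta starM he.1 leftop_star; last exact: NA.
by rewrite -leftop_star; [exact: (leftop_e (vNstar hN Nn)) | exact: NA].
Qed.
Lemma theta1 : theta 1 = e.
Proof. by rewrite /theta leftop1 mul1r. Qed.
Lemma theta_corner n : N n -> in_corner Q e (theta n).
Proof.
move=> Nn; split; first by apply: (vNM hQ) => //; exact/QL/NA.
  by rewrite /theta mulrA -(leftop_e Nn) -mulrA he.2.
by rewrite /theta -mulrA he.2.
Qed.
Lemma theta_h1 n : N n -> theta n (h 1) = h n.
Proof. by move=> Nn; rewrite bopM eN // leftopE ?mulr1 //; exact: NA. Qed.
Lemma theta_inj m n : N m -> N n -> theta m = theta n -> m = n.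
Proof.
move=> Nm Nn mn; apply/eqP; rewrite -subr_eq0; apply/eqP/h_inj.
  by apply: (vNB hA); exact: NA.
by rewrite hB; [rewrite -(theta_h1 Nm) -(theta_h1 Nn) mn subrr | exact: NA | exact: NA].
Qed.

(** Vectors h n + w with e w = 0 are dense, and theta z sends such a vector to h z multiplied on the
    right by n, so smallness of h z in L2 makes theta z small at each of them. *)
Lemma theta_bd (s : seq K) : (forall v, v \in s -> exists n w, [/\ N n, e w = 0 & v = h n + w]) ->
  exists2 C : R, 0 <= C & forall z v, N z -> v \in s -> <<theta z v, theta z v>> <= C * <<h z, h z>>.
Proof.
elim: s => [|v s ih] hs; first by exists 0.
have [|C C0 hC] := ih; first by move=> w ws; apply: hs; rewrite in_cons ws orbT.
have [n [w [Nn ew ->]]] := hs v (mem_head _ _).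
have [B B0 hB'] := bop_bd (rightop n).
exists (C + B) => [|z u Nz]; first exact: addr_ge0.
have hz := psd_ge0 dK (h z).
rewrite in_cons => /orP[/eqP ->|us].
  rewrite bopM bopDv eN // ew addr0 leftopE; [|exact: NA|exact: NA].
  rewrite -(rightopE (NA Nn) (NA Nz)).
  by apply: le_trans (hB' _) _; rewrite mulrDl lerDr mulr_ge0.
by apply: le_trans (hC z u Nz us) _; rewrite mulrDl lerDl mulr_ge0.
Qed.

Lemma D_bd (s : seq H) : (forall v, v \in s -> D v) ->
  exists2 C : R, 0 <= C & forall z v, A z -> v \in s -> <<z v, z v>> <= C * <<h z, h z>>.
Proof.
elim: s => [|v s ih] hs; first by exists 0.
have [|C C0 hC] := ih; first by move=> w ws; apply: hs; rewrite in_cons ws orbT.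
have [B B0 hB'] := hs v (mem_head _ _).
exists (C + B) => [|z u Az]; first exact: addr_ge0.
have hz := psd_ge0 dK (h z).
rewrite in_cons => /orP[/eqP ->|us].
  by apply: le_trans (hB' _ Az) _; rewrite -h_norm // mulrDl lerDr mulr_ge0.
by apply: le_trans (hC z u Az us) _; rewrite mulrDl lerDl mulr_ge0.
Qed.

Definition generatesN (X : seq (bop H)) := (forall x, x \in X -> N x) /\
  forall B, vNset B -> (forall x, x \in X -> B x) -> N `<=` B.

(** The elements of N whose image lies in B form a von Neumann algebra. For its closedness, strong
    approximation at the dominating vectors of H yields closeness in L2, hence strong-* closeness of
    the images on a dense set. *)
Lemma generates_theta (X : seq (bop H)) : generatesN X -> generates Q e [seq theta x | x <- X].
Proof.
move=> [XN Xgen]; split; first by move=> _ /mapP[x /XN Nx ->]; exact: theta_corner.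
move=> B hB' XB T [QT eT Te]; have [y Ny ->] := corner_theta QT eT Te.
pose C : set (bop H) := [set n | N n /\ B (theta n)].
suff : N `<=` C by move=> /(_ y Ny) [].
apply: Xgen; last by move=> x xX; split; [exact: XN | apply: XB; exact: map_f].
have CN : C `<=` N by move=> x [].
split.
- split; first by split; [exact: vN0 | rewrite theta0; exact: vN0].
  move=> k a b [Na Ba] [Nb Bb]; split; first exact: vNlin.
  by rewrite theta_lin //; exact: (vNlin hB').
- by move=> a b [Na Ba] [Nb Bb]; split; [exact: vNM | rewrite thetaM //; exact: (vNM hB')].
- by move=> a [Na Ba]; split; [exact: vNstar | rewrite theta_star //; exact: (vNstar hB')].
move=> x hx; have Nx : N x by exact/(vN_strong hN)/(strong_adherentS CN).
split => //.
apply: (vN_strong_star (D := [set v : K | exists n w, [/\ N n, e w = 0 & v = h n + w]]) hB').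
  move=> u d d0; have [_ [n Nn <-] hn] := eran u d0.
  exists (h n + (u - e u)); last first.
    by have -> : u - (h n + (u - e u)) = e u - h n by rewrite opprD opprB addrCA [u + _]addrC subrK addrC.
  by exists n, (u - e u); rewrite bopBv -bopM he.2 subrr.
move=> s d sD d0; have [M M0 hM] := theta_bd sD.
have [l [xi [Dxi hxi]]] := h_norm_dominated.
have M1 : 0 < M + 1 by lra.
have l1 : 0 < d / (M + 1) / l.+1%:R by rewrite !divr_gt0 ?ltr0n.
have [a [Na Ba] ha] := hx [seq xi i | i <- iota 0 l] _ l1.
have hxa : <<h (x - a), h (x - a)>> < d / (M + 1).
  have Axa : A (x - a) by apply: NA; exact: vNB.
  apply: le_lt_trans (hxi _ Axa) _.
  apply: (@le_lt_trans _ _ (\sum_(i < l) d / (M + 1) / l.+1%:R)).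
    apply: ler_sum => i _; apply: ltW; apply: ha.
    by apply/mapP; exists (i : nat) => //; rewrite mem_iota /= add0n.
  rewrite sumr_const card_ord -[X in X < _]mulr_natr mulrAC ltr_pdivrMr ?ltr0n //.
  by rewrite ltr_pM2l ?divr_gt0 // ltr_nat.
have Nxa : N (x - a) by exact: vNB.
have key z v : N z -> v \in s -> <<h z, h z>> < d / (M + 1) -> <<theta z v, theta z v>> < d.
  move=> Nz vs; rewrite ltr_pdivlMr // => hz; apply: le_lt_trans (hM z v Nz vs) _.
  by apply: le_lt_trans hz; rewrite mulrC ler_wpM2l ?(psd_ge0 dK) //; lra.
have thB m n : N m -> N n -> theta (m - n) = theta m - theta n.
  by move=> Nm Nn; have := theta_lin (-1) Nn Nm; rewrite !scaleN1r ![- _ + _]addrC.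
exists (theta a) => // v vs; split.
  by rewrite -bopB -thB //; exact: key.
rewrite -!theta_star // -bopB -thB; [|exact: vNstar|exact: vNstar].
rewrite -starB; apply: key => //; first exact: vNstar.
by rewrite h_star //; exact: NA.
Qed.

(** In this direction, approximation of theta y at the single vector h 1 is already closeness in L2,
    which controls y and its adjoint at all bounded vectors of H. *)
Lemma generates_theta_inv (X : seq (bop H)) : (forall x, x \in X -> N x) ->
  generates Q e [seq theta x | x <- X] -> generatesN X.
Proof.
move=> XN [_ Xgen]; split => // B hB' XB n Nn.
pose C : set (bop K) := [set T | exists2 a, N a /\ B a & T = theta a].
suff /(_ (theta n)) : forall T, in_corner Q e T -> C T.
  by move=> /(_ (theta_corner Nn)) [a [Na Ba] /theta_inj -> //].
apply: Xgen; last first.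
  by move=> _ /mapP[x xX ->]; exists x => //; split; [exact: XN | exact: XB].
have CQ T : C T -> in_corner Q e T by move=> [a [Na _] ->]; exact: theta_corner.
split.
- split; first by exists 0; [split; [exact: vN0 | exact: vN0] | rewrite theta0].
  move=> k _ _ [a [Na Ba] ->] [b [Nb Bb] ->]; exists (k *: a + b).
    by split; exact: vNlin.
  by rewrite theta_lin.
- move=> _ _ [a [Na Ba] ->] [b [Nb Bb] ->]; exists (a * b).
    by split; exact: vNM.
  by rewrite thetaM.
- move=> _ [a [Na Ba] ->]; exists (a^#); last by rewrite theta_star.
  by split; exact: vNstar.
move=> T hT.
have QT : Q T by apply: (vN_strong hQ); apply: strong_adherentS hT => Z /CQ [].
have eT : e * T = T.
  have := @adherent_eq _ _ C e 1 1 1 T; rewrite !mulr1 !mul1r; apply => // Z /CQ [_ eZ _].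
  by rewrite !mulr1 mul1r.
have Te : T * e = T.
  have := @adherent_eq _ _ C 1 e 1 1 T; rewrite !mulr1 !mul1r; apply => // Z /CQ [_ _ Ze].
  by rewrite mulr1 !mul1r.
have [y Ny TE] := corner_theta QT eT Te; exists y => //; split => //.
apply: (vN_strong_star (D := D) hB'); first by move=> u d d0; exact: (bdv_dense hF ht tnormal).
move=> s d sD d0; have [M M0 hM] := D_bd sD.
have M1 : 0 < M + 1 by lra.
have [_ [a [Na Ba] ->] ha] := hT [:: h 1] _ (divr_gt0 d0 M1).
have := ha _ (mem_head _ _); rewrite TE !theta_h1 // => hya.
have [Ay Aa] := conj (NA Ny) (NA Na).
have key z v : A z -> v \in s -> <<h z, h z>> < d / (M + 1) -> <<z v, z v>> < d.
  move=> Az vs; rewrite ltr_pdivlMr // => hz; apply: le_lt_trans (hM z v Az vs) _.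
  by apply: le_lt_trans hz; rewrite mulrC ler_wpM2l ?(psd_ge0 dK) //; lra.
rewrite -hB // in hya.
exists a => // v vs; split; first by rewrite -bopB; apply: key => //; exact: vNB.
rewrite -bopB -starB; apply: key => //; first by apply: (vNstar hA); exact: vNB.
by rewrite h_star //; exact: vNB.
Qed.

Hypothesis hFQ : factor Q.
Variables (tQ : bop K -> R) (tN : bop H -> R).
Hypotheses (htQ : ftrace Q tQ) (htN : ftrace N tN) (hFN : factor N).
Hypotheses (tQe : tQ e = 1) (tN1 : tN 1 = 1).
Hypothesis nfdQ : ~ exists (M : nat) (b : 'I_M -> bop K),
  forall x : bop K, Q x -> exists c : 'I_M -> R[i], x = \sum_(i < M) c i *: b i.
Hypothesis nfdN : ~ exists (M : nat) (b : 'I_M -> bop H),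
  forall x, N x -> exists c : 'I_M -> R[i], x = \sum_(i < M) c i *: b i.

(** The composite of [tQ] with theta is a trace on N, normalised because tQ e = 1; uniqueness on
    projections identifies it with [tN]. *)
Lemma theta_trace p : N p -> proj p -> tQ (theta p) = tN p.
Proof.
have QT m : N m -> Q (theta m) by move=> /theta_corner [].
have ht' : ftrace N (fun a => tQ (theta a)).
  split.
  - move=> r a b Na Nb; rewrite theta_lin // (tD htQ) ?(tZ hQ htQ) //; try exact: QT.
    by apply: (vNZ hQ); exact: QT.
  - by move=> a b Na Nb; rewrite !thetaM // (tC htQ) //; exact: QT.
  - move=> a Na; rewrite thetaM ?theta_star //; last exact: vNstar.
    by apply: (t_sq_ge0 htQ); exact: QT.
  - move=> a Na; rewrite thetaM ?theta_star //; last exact: vNstar.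
    move/(t_sq_eq0 htQ (QT _ Na)); rewrite -theta0 => /theta_inj; apply => //.
    exact: vN0.
by move=> Np hp; apply: (trace_unique_proj hFN ht' htN _ tN1 nfdN Np hp); rewrite theta1.
Qed.

Lemma theta_proj p : N p -> proj p -> proj (theta p).
Proof. by move=> Np [sp pp]; split; rewrite -?theta_star // ?sp // -?thetaM // pp. Qed.

Lemma theta_sum (P : seq (bop H)) : (forall p, p \in P -> N p) ->
  theta (\sum_(p <- P) p) = \sum_(p <- P) theta p.
Proof.
elim: P => [|p P ih] hP; first by rewrite !big_nil theta0.
rewrite !big_cons -ih => [|q qP]; last by apply: hP; rewrite in_cons qP orbT.
have Np : N p by apply: hP; rewrite mem_head.
have NS : N (\sum_(p <- P) p).
  by rewrite big_seq; apply: (vN_sum hN) => q qP; apply: hP; rewrite in_cons qP orbT.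
by have := theta_lin 1 Np NS; rewrite !scale1r.
Qed.

Lemma theta_eq0 x : N x -> (theta x == 0) = (x == 0).
Proof.
move=> Nx; apply/eqP/eqP => [|->]; last exact: theta0.
by rewrite -theta0 => /theta_inj; apply => //; exact: vN0.
Qed.

Lemma theta_cost (X P : seq (bop H)) : (forall x, x \in X -> N x) -> is_partition N 1 P ->
  cost tQ [seq theta x | x <- X] [seq theta p | p <- P] = cost tN X P.
Proof.
move=> XN [_ PN _ _]; rewrite /cost big_map big_seq [RHS]big_seq; apply: eq_bigr => x /XN Nx.
rewrite /cost1 big_map big_seq [RHS]big_seq; apply: eq_bigr => p /PN [Np hp].
rewrite big_map big_mkcond [RHS]big_mkcond big_seq [RHS]big_seq; apply: eq_bigr => q /PN [Nq hq].
have Npx := vNM hN Np Nx; have Npxq := vNM hN Npx Nq.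
by rewrite -!thetaM // theta_eq0 // !theta_trace.
Qed.

Lemma theta_partition (P : seq (bop H)) : is_partition N 1 P -> is_partition Q e [seq theta p | p <- P].
Proof.
move=> [uP PN oP sP]; split.
- rewrite map_inj_in_uniq // => p q /PN [Np _] /PN [Nq _]; exact: theta_inj.
- move=> _ /mapP[p /PN [Np hp] ->]; split; last exact: theta_proj.
  by have [] := theta_corner Np.
- move=> _ _ /mapP[p pP ->] /mapP[q qP ->] ne.
  have [[Np _] [Nq _]] := (PN p pP, PN q qP).
  rewrite -thetaM // oP ?theta0 //; by apply: contra ne => /eqP ->.
- by rewrite big_map -theta_sum ?sP ?theta1 // => p /PN [].
Qed.

(** Transfer from the projection e to 1 inside Q, after theta has moved X and P to the corner
    without changing the cost. *)
Lemma Q_le_N (X P : seq (bop H)) (eps : R) : generatesN X -> is_partition N 1 P -> 0 < eps ->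
  exists (Y P' : seq (bop K)), [/\ generates Q 1 Y, is_partition Q 1 P' & cost tQ Y P' <= cost tN X P + eps].
Proof.
move=> gX pP eps0.
have e0 : e <> 0 by move=> z; have := tQe; rewrite z (t0 hQ htQ) => /eqP; rewrite eq_sym oner_eq0.
have n1 : (1 : bop K) <> 0 by move=> z; apply: e0; rewrite -[e]mul1r z mul0r.
have [Y [P' [h1 h2 h3]]] := cost_transfer hFQ htQ nfdQ Qe Q1 he (proj1 K) e0 n1
  (theta_partition pP) (generates_theta gX) eps0.
by exists Y, P'; split => //; rewrite -theta_cost //; case: gX.
Qed.

Lemma N_le_Q (Y P : seq (bop K)) (eps : R) : generates Q 1 Y -> is_partition Q 1 P -> 0 < eps ->
  exists (X P' : seq (bop H)), [/\ generatesN X, is_partition N 1 P' & cost tN X P' <= cost tQ Y P + eps].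
Proof.
move=> gY pP eps0.
have e0 : e <> 0 by move=> z; have := tQe; rewrite z (t0 hQ htQ) => /eqP; rewrite eq_sym oner_eq0.
have n1 : (1 : bop K) <> 0 by move=> z; apply: e0; rewrite -[e]mul1r z mul0r.
have [Z [P2 [h1 h2 h3]]] := cost_transfer hFQ htQ nfdQ Q1 Qe (proj1 K) he n1 e0 pP gY eps0.
(* An inverse of theta on the corner is chosen, with the value 0 elsewhere. *)
have inv T : exists x, in_corner Q e T -> N x /\ theta x = T.
  have [hT|nT] := pselect (in_corner Q e T); last by exists 0.
  by have [QT eT Te] := hT; have [x Nx ->] := corner_theta QT eT Te; exists x.
have [f fP] := choice inv.
have Zc T : T \in Z -> in_corner Q e T by case: h2 => + _; apply.
have P2c T : T \in P2 -> in_corner Q e T.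
  move=> TP; have [_ /(_ T TP) [QT _] _ _] := h1.
  by have [? ?] := partition_proj h1 TP.
have ZE : [seq theta x | x <- [seq f T | T <- Z]] = Z.
  rewrite -map_comp -[RHS]map_id; apply/eq_in_map => T /Zc /fP [_ /=]; exact.
have PE : [seq theta x | x <- [seq f T | T <- P2]] = P2.
  rewrite -map_comp -[RHS]map_id; apply/eq_in_map => T /P2c /fP [_ /=]; exact.
have fZN x : x \in [seq f T | T <- Z] -> N x by move=> /mapP[T /Zc /fP [Nf _] ->].
have hP' : is_partition N 1 [seq f T | T <- P2].
  have [uP PQ oP sP] := h1; split.
  - by rewrite map_inj_in_uniq // => S T /P2c /fP [_ {2}<-] /P2c /fP [_ {2}<-] ->.
  - move=> _ /mapP[T TP ->]; have [Nf fT] := fP T (P2c T TP); split => //.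
    have [_ [sT TT]] := PQ T TP.
    split; apply: theta_inj => //; [exact: vNstar | by rewrite theta_star // fT | exact: vNM |].
    by rewrite thetaM // fT.
  - move=> _ _ /mapP[S SP ->] /mapP[T TP ->] ne.
    have [Nf fS] := fP S (P2c S SP); have [Ng fT] := fP T (P2c T TP).
    apply: theta_inj; [exact: vNM | exact: vN0 |].
    rewrite thetaM // fS fT theta0 oP //; by apply: contra ne => /eqP ->.
  - apply: theta_inj => //.
      by rewrite big_map big_seq; apply: (vN_sum hN) => T TP; have [] := fP T (P2c T TP).
    rewrite theta_sum; last by move=> _ /mapP[T TP ->]; have [] := fP T (P2c T TP).
    by rewrite -(big_map theta predT id) PE sP theta1.
exists [seq f T | T <- Z], [seq f T | T <- P2]; split => //.
  by apply: generates_theta_inv => //; rewrite ZE.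
by rewrite -theta_cost // ZE PE.
Qed.

End StandardForm.

(** * From functions to bundled operators *)

Section Translation.
Variables (R : realType) (H : hilbert R).
Implicit Types (a b x y p q : bop H) (M : set (H -> H)) (B : set (bop H)).
Let dp := rdot_psd H.

Definition inb M : set (bop H) := [set a | M (bfun a)].

Lemma bfun_inj : injective (@bfun R H).
Proof. by move=> a b ab; apply: bop_ext => u; rewrite ab. Qed.

Lemma adjoint_star a (T : H -> H) : is_adjoint a T -> bounded_op T -> T = star a.
Proof.
by move=> aT bT; have -> : T = mkbop bT by []; congr bfun; apply/star_adjoint.
Qed.

Lemma adjointP a : is_adjoint a (star a). Proof. exact/star_adjoint. Qed.

Section VN.
Variable M : set (H -> H).
Hypothesis hM : vN_algebra M.

Lemma vN_bounded T : M T -> bounded_op T. Proof. by case: hM => h _ _ _ _; exact: h. Qed.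
Lemma vN_bop T : M T -> exists a : bop H, bfun a = T.
Proof. by move=> /vN_bounded bT; exists (mkbop bT). Qed.

Lemma vN_vNset : vNset (inb M).
Proof.
have [_ [M0 Ml] MM Ms Mc] := hM; split.
- by split => // k a b Ma Mb; exact: Ml.
- by move=> a b Ma Mb; exact: MM.
- move=> a Ma; have [T MT aT] := Ms _ Ma.
  by rewrite /inb /= -(adjoint_star aT (vN_bounded MT)).
- move=> a ha; apply: Mc; split; first exact: bop_bounded.
  apply/ptws_closureP => s e e0; have [b Mb hb] := ha s e e0.
  by exists b.
Qed.
End VN.

Lemma vNset_vN B : vNset B -> vN_algebra [set bfun a | a in B].
Proof.
move=> hB; split.
- by move=> _ [a _ <-]; exact: bop_bounded.
- split; first by exists 0 => //; exact: vN0.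
  by move=> c _ _ [a Ba <-] [b Bb <-]; exists (c *: a + b) => //; exact: vNlin.
- by move=> _ _ [a Ba <-] [b Bb <-]; exists (a * b) => //; exact: vNM.
- move=> _ [a Ba <-]; exists (star a); last exact: adjointP.
  by exists (star a) => //; exact: vNstar.
- move=> T [bT /ptws_closureP hT]; exists (mkbop bT) => //.
  apply: (vN_strong hB) => s e e0; have [_ [b Bb <-] hb] := hT s e e0.
  by exists b.
Qed.

(** Bundled and unbundled von Neumann algebras correspond through [bfun], so minimality can be
    tested on bundled ones. *)
Lemma W_star_eqP M (X : set (H -> H)) : vN_algebra M -> X `<=` M ->
  (W_star X = M <-> forall B, vNset B -> (forall a, X a -> B a) -> inb M `<=` B).
Proof.
move=> hM XM; split.
  move=> WM B hB XB a Ma.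
  have : W_star X a by rewrite WM.
  move=> /(_ [set bfun a | a in B]) []; last by move=> b Bb /bfun_inj <-.
  split; first exact: vNset_vN.
  move=> T XT; have [b bT] := vN_bop hM (XM _ XT); exists b => //.
  by apply: XB; rewrite bT.
move=> h; apply/seteqP; split; first by move=> T; apply; split.
move=> T MT M' [hM' XM']; have [a aT] := vN_bop hM MT; rewrite -aT.
have := h (inb M') (vN_vNset hM') (fun a Xa => XM' _ Xa) a; apply.
by rewrite /inb /= aT.
Qed.

Definition rtrace (tau : (H -> H) -> R[i]) : bop H -> R := fun a => complex.Re (tau a).

Lemma is_trace_ftrace M tau : is_trace M tau -> ftrace (inb M) (rtrace tau).
Proof.
move=> [tl tc tp tf _]; split.
- move=> r a b Ma Mb; rewrite /rtrace -ReZ -ReD -tl //.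
- by move=> a b Ma Mb; rewrite /rtrace; congr complex.Re; exact: tc.
- move=> a Ma; have := tp _ _ Ma (adjointP a); rewrite lecE => /andP[_]; exact.
- move=> a Ma h0; have h1 := tp _ _ Ma (adjointP a).
  have : (a : H -> H) = 0.
    apply: (tf _ _ Ma (adjointP a)); apply: complex_eqP; first exact: h0.
    by move: h1; rewrite lecE => /andP[/eqP /= ->].
  by move=> a0; apply: bfun_inj; rewrite a0.
Qed.

Lemma II1_factor_factor M : II1_factor M -> factor (inb M).
Proof.
move=> [hM M1 hc _ _]; split; [exact: vN_vNset | exact: M1 |].
move=> x Mx hx; have [|c xc] := hc _ Mx.
  move=> T MT; have [a aT] := vN_bop hM MT; rewrite -aT.
  by apply: (congr1 (@bfun R H) (hx a _)); rewrite /inb /= aT.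
by exists c; apply: bfun_inj; rewrite xc.
Qed.

Lemma bfun_sum I (s : seq I) (P : pred I) (F : I -> bop H) :
  bfun (\sum_(i <- s | P i) F i) = \sum_(i <- s | P i) bfun (F i).
Proof. by apply: (big_morph (@bfun R H)). Qed.

Lemma II1_factor_nfd M : II1_factor M -> ~ exists (N : nat) (b : 'I_N -> bop H),
  forall x, inb M x -> exists c : 'I_N -> R[i], x = \sum_(i < N) c i *: b i.
Proof.
move=> [hM _ _ nfd _] [N [b hb]]; apply: nfd; exists N, (fun i => bfun (b i)) => T MT.
have [a aT] := vN_bop hM MT; have [|c ac] := hb a; first by rewrite /inb /= aT.
by exists c; rewrite -aT ac bfun_sum.
Qed.

Lemma sa_hdot_real a u : star a = a -> hdot (a u) u = (<<a u, u>>)%:C.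
Proof.
move=> sa; have := adjointP a u u; rewrite sa [RHS]hdotC => h; apply: complex_eqP => //=.
by move: h; case: (hdot (a u) u) => r s [] /=; lra.
Qed.

Lemma op_leP a b : star a = a -> star b = b -> op_le a b <-> pos (b - a).
Proof.
move=> sa sb; split.
  move=> h; split; first by rewrite starB sa sb.
  move=> u; have := h u; rewrite !sa_hdot_real // lecR.
  by rewrite bopB (psdBl dp) subr_ge0.
move=> [_ h] u; rewrite !sa_hdot_real // lecR.
by have := h u; rewrite bopB (psdBl dp) subr_ge0.
Qed.

(** The strong limit p of increasing projections is their supremum among the self-adjoint elements
    of M, so [normal_on] applies to them. *)
Lemma is_trace_seqnormal M tau : vN_algebra M -> M idfun -> is_trace M tau ->
  seqnormal (inb M) (rtrace tau).
Proof.
move=> hM M1 htau s p hs inc Mp hp sp e e0.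
have ht := is_trace_ftrace htau; have hA := vN_vNset hM.
have [_ _ _ _ tn] := htau.
pose D := [set bfun (s n) | n in [set: nat]].
have incm m n : (n <= m)%N -> ple (s n) (s m).
  move=> /subnK <-; elim: (m - n)%N => [|k ih]; first exact: (ple_refl (hs n).2).
  by rewrite addSn; exact: ple_trans ih (inc _).
have sn_p n : ple (s n) p.
  have h : scv (fun m => s (m + n)%N) p.
    by move=> u d /(sp u) [N hN]; exists N => k Nk; apply: hN; exact: leq_trans (leq_addr _ _).
  apply: scv_unique (scvMr (s n) h) _; apply: scv_eq (scv_cst (s n)) => m.
  by rewrite incm // leq_addl.
have le_ple a b : proj a -> proj b -> ple a b -> op_le a b.
  by move=> ha hb ab; apply/op_leP; [exact: ha.1 | exact: hb.1 | exact/proj_pos/projB].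
have tE : rtrace tau p = sup [set complex.Re (tau d) | d in D].
  apply: tn.
  - by exists (s 0%N), 0%N.
  - move=> _ [n _ <-]; split; first exact: (hs n).1.
    by have := adjointP (s n); rewrite (hs n).2.1.
  - move=> _ _ [m _ <-] [n _ <-]; exists (s (maxn m n)); split.
    + by exists (maxn m n).
    + by apply: le_ple; [exact: (hs _).2 | exact: (hs _).2 | apply: incm; exact: leq_maxl].
    + by apply: le_ple; [exact: (hs _).2 | exact: (hs _).2 | apply: incm; exact: leq_maxr].
  - split.
    + by split => //; have := adjointP p; rewrite hp.1.
    + by move=> _ [n _ <-]; apply: le_ple => //; exact: (hs n).2.
    + move=> y [My ya] hy; have [b by_] := vN_bop hM My; rewrite -by_ in ya hy *.
      have sb : star b = b by have /bfun_inj := adjoint_star ya (bop_bounded b).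
      apply/op_leP; [exact: hp.1 | exact: sb |]; split; first by rewrite starB sb hp.1.
      move=> u; rewrite bopB (psdBl dp) subr_ge0; apply: fcvg_dot_le (sp u) _ => n.
      have /op_leP := hy (s n) (ex_intro2 _ _ n I erefl).
      by move=> /(_ (hs n).2.1 sb) [_ /(_ u)]; rewrite bopB (psdBl dp) subr_ge0.
have hsup : has_sup [set complex.Re (tau d) | d in D].
  split; first by exists (rtrace tau (s 0%N)), (bfun (s 0%N)) => //; exists 0%N.
  exists (rtrace tau p) => _ [_ [n _ <-] <-].
  exact: (t_ple hA ht (hs n).1 Mp (hs n).2 hp (sn_p n)).
have [_ [_ [n _ <-] <-] hn] := sup_adherent e0 hsup.
by exists n; rewrite tE; move: hn; rewrite ltrBlDr.
Qed.

Definition tob (T : H -> H) : bop H :=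
  if pselect (bounded_op T) is left bT then mkbop bT else 0.
Lemma tobK a : tob a = a.
Proof.
rewrite /tob; case: pselect => [bT|]; first exact: bop_ext.
by case; exact: bop_bounded.
Qed.
Lemma bfunK M T : vN_algebra M -> M T -> bfun (tob T) = T.
Proof. by move=> hM /(vN_bop hM) [a <-]; rewrite tobK. Qed.

Definition gens M (X : seq (bop H)) := (forall x, x \in X -> inb M x) /\
  forall B, vNset B -> (forall x, x \in X -> B x) -> inb M `<=` B.

Lemma sum_undup_le (T : eqType) (s : seq T) (F : T -> R) : (forall i, 0 <= F i) ->
  \sum_(i <- undup s) F i <= \sum_(i <- s) F i.
Proof.
move=> F0; elim: s => [|i s ih] /=; first by rewrite !big_nil.
by case: ifP => _; rewrite !big_cons ?lerD2l // (le_trans ih) // lerDr.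
Qed.

Lemma calI1_map tau x (P : seq (bop H)) (Pf : {fset H -> H}) :
  perm_eq Pf [seq bfun p | p <- P] ->
  calI1 tau x Pf = cost1 (rtrace tau) x P.
Proof.
move=> PP; rewrite /calI1 (perm_big _ PP) /= big_map; apply: eq_bigr => p _.
rewrite (perm_big _ PP) /= big_map big_mkcond [RHS]big_mkcond; apply: eq_bigr => q _.
by congr (if ~~ _ then _ else _).
Qed.

(** A partition has distinct entries, but generators may repeat in a list; removing repetitions can
    only lower the cost, because traces of projections are nonnegative. *)
Lemma calG_le M tau (X P : seq (bop H)) : vN_algebra M ->
  (forall p, inb M p -> proj p -> 0 <= rtrace tau p) ->
  gens M X -> is_partition (inb M) 1 P -> (calG M tau <= (cost (rtrace tau) X P)%:E)%E.
Proof.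
move=> hM tp [XM Xgen] [uP PM oP sP].
pose Xf : {fset H -> H} := seq_fset tt [seq bfun x | x <- X].
pose Pf : {fset H -> H} := seq_fset tt [seq bfun p | p <- P].
have XfE T : (T \in Xf) = (T \in [seq bfun x | x <- X]) by rewrite seq_fsetE.
have PfE T : (T \in Pf) = (T \in [seq bfun x | x <- P]) by rewrite seq_fsetE.
have PP : perm_eq Pf [seq bfun p | p <- P].
  apply: uniq_perm; [exact: fset_uniq | by rewrite map_inj_uniq //; exact: bfun_inj | exact: PfE].
have XX : perm_eq Xf (undup [seq bfun x | x <- X]).
  by apply: uniq_perm; [exact: fset_uniq | exact: undup_uniq | move=> T; rewrite mem_undup XfE].
have XfM : [set` Xf] `<=` M.
  by move=> T /=; rewrite XfE => /mapP[x xX ->]; exact: XM.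
have WX : W_star [set` Xf] = M.
  apply/(W_star_eqP hM XfM) => B hB XB; apply: Xgen => // x xX.
  by apply: XB; rewrite /= XfE map_f.
have hPf : proj_partitions M Pf.
  split.
  - move=> T; rewrite PfE => /mapP[p pP ->]; have [Mp [sp pp]] := PM p pP; split => //.
    split; first exact: bop_bounded.
      by rewrite -[RHS](congr1 (@bfun R H) pp).
    by have := adjointP p; rewrite sp.
  - move=> S T; rewrite !PfE => /mapP[p pP ->] /mapP[q qP ->] pq.
    have pq' : p != q by apply: contra pq => /eqP ->.
    exact: (congr1 (@bfun R H) (oP p q pP qP pq')).
  - rewrite (perm_big _ PP) /= big_map -bfun_sum sP //.
apply: (@le_trans _ _ (calI M tau Xf)); first by apply: ereal_inf_lbound; exists Xf.
apply: (@le_trans _ _ (calI_part tau Xf Pf)%:E); first by apply: ereal_inf_lbound; exists Pf.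
rewrite lee_fin /calI_part (perm_big _ XX) /=.
have c0 T : 0 <= calI1 tau T Pf.
  rewrite /calI1 (perm_big _ PP) /= big_map big_seq; apply: sumr_ge0 => p pP.
  rewrite (perm_big _ PP) /= big_map big_seq_cond; apply: sumr_ge0 => q /andP[qP _].
  have [[Mp hp] [Mq hq]] := (PM p pP, PM q qP).
  by apply: mulr_ge0; [exact: (tp p) | exact: (tp q)].
apply: le_trans (sum_undup_le _ c0) _; rewrite big_map /cost.
by apply: ler_sum => x _; rewrite (calI1_map _ _ PP).
Qed.

Lemma calG_ge M tau (r : \bar R) : vN_algebra M ->
  (forall X P, gens M X -> is_partition (inb M) 1 P -> (r <= (cost (rtrace tau) X P)%:E)%E) ->
  (r <= calG M tau)%E.
Proof.
move=> hM h; apply: le_ereal_inf_tmp => _ [Xf [XM WX] <-].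
apply: le_ereal_inf_tmp => _ [Pf [PM oP sP] <-].
pose X := [seq tob T | T <- Xf]; pose P := [seq tob T | T <- Pf].
have bK T : M T -> bfun (tob T) = T by exact: bfunK.
have XE : [seq bfun x | x <- X] = Xf.
  by rewrite -map_comp -[RHS]map_id; apply/eq_in_map => T TX /=; apply: bK; exact: XM.
have PE : [seq bfun x | x <- P] = Pf.
  by rewrite -map_comp -[RHS]map_id; apply/eq_in_map => T TP /=; apply: bK; have [] := PM T TP.
have PP : perm_eq Pf [seq bfun p | p <- P] by rewrite PE.
have Pp p : p \in P -> bfun p \in Pf.
  by move=> /mapP[T TP ->]; rewrite bK //; have [] := PM T TP.
have -> : calI_part tau Xf Pf = cost (rtrace tau) X P.
  rewrite /calI_part /cost -XE big_map; apply: eq_bigr => x _.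
  exact: calI1_map.
apply: h.
- split.
    by move=> _ /mapP[T TX ->]; rewrite /inb /= bK; exact: XM.
  have /(W_star_eqP hM XM) Xgen := WX.
  move=> B hB XB; apply: Xgen => // a /= aX; apply: XB.
  by apply/mapP; exists (bfun a) => //; rewrite tobK.
- split.
  + rewrite map_inj_in_uniq ?fset_uniq // => S T SP TP ST.
    by rewrite -(bK S (PM S SP).1) -(bK T (PM T TP).1) ST.
  + move=> p /Pp pP; have [Mp [bp pp ap]] := PM _ pP; split => //; split.
      by have /bfun_inj := adjoint_star ap bp.
    exact: bfun_inj.
  + move=> p q /Pp pP /Pp qP pq; apply: bfun_inj; exact: oP.
  + by apply: bfun_inj; rewrite bfun_sum -(big_map (@bfun R H) predT id) PE sP.
Qed.

End Translation.

(** * Assembly: the Jones projection, scaling of the trace, and the two inequalities *)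

Unset Implicit Arguments.
Set Strict Implicit.
Set Printing Implicit Defensive.

Theorem mainTheorem9 (R : realType) (H : hilbert R) (M N : set (H -> H))
    (hM : II1_factor M) (hN : II1_factor N) (hNM : N `<=` M)
    (tauM tauN : (H -> H) -> R[i])
    (htauM : is_tracial_state M tauM) (htauN : is_tracial_state N tauN)
    (L2M : hilbert R) (eta : (H -> H) -> L2M) (hL2 : is_L2 M tauM eta)
    (eN : L2M -> L2M) (heN : is_Jones_projection N eta eN)
    (hfin : II1_factor (basic_construction M eta eN))
    (Tr : (L2M -> L2M) -> R[i])
    (hTr : is_trace (basic_construction M eta eN) Tr) (hTre : Tr eN = 1)
    (lambda : R) (hlambda : Tr idfun = lambda%:C) :
  calG N tauN =
  ((lambda ^+ 2)%:E *
     calG (basic_construction M eta eN)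
          (fun T => ((lambda^-1)%:C * Tr T)%R))%E.
Proof.
have [vM M1 _ _ _] := hM; have [vN N1 _ _ _] := hN; have [vQ Q1 _ _ _] := hfin.
have dK := rdot_psd L2M.
have subQ T : (left_action M eta `|` [set eN]) T -> basic_construction M eta eN T.
  by move=> hT M' [_]; apply.
have QeN : basic_construction M eta eN eN by apply: subQ; right.
have [e eE] := vN_bop vQ QeN.
pose h (a : bop H) : L2M := eta a.
have [etal etad etac] := hL2.
have hA := vN_vNset vM; have hNN := vN_vNset vN; have hQ := vN_vNset vQ.
have hF := II1_factor_factor hM; have hFN := II1_factor_factor hN; have hFQ := II1_factor_factor hfin.
have ht := is_trace_ftrace htauM.1; have htN := is_trace_ftrace htauN.1.
have htQ := is_trace_ftrace hTr.
have NA : inb N `<=` inb M by move=> a; exact: hNM.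
have hlin (k : R[i]) (x y : bop H) : inb M x -> inb M y -> h (k *: x + y) = k *: h x + h y.
  by move=> Mx My; exact: etal.
have hdotE (x y : bop H) : inb M x -> inb M y -> rdot (h x) (h y) = rtrace tauM (star y * x).
  by move=> Mx My; rewrite /rdot /h (etad _ _ _ Mx My (adjointP y)).
have hdense (u : L2M) (d : R) : 0 < d -> exists2 v, (h @` inb M) v & rdot (u - v) (u - v) < d.
  move=> d0; have : closure (eta @` M) u by rewrite etac.
  move=> /closure_rdotP /(_ d d0) [_ [T MT <-] hT]; have [a aT] := vN_bop vM MT.
  by exists (h a); [exists a => //; rewrite /inb /= aT | rewrite /h aT].
(* The Jones projection is given by its range and an orthogonality relation; that e is a
   self-adjoint idempotent is derived from these. *)
pose S := closure (eta @` N).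
have eS u : S (e u) by rewrite eE; case: (heN u).
have eO u v : S v -> rdot (u - e u) v = 0.
  by move=> Sv; rewrite /rdot eE; have [_ ->] := heN u.
have efix v : S v -> e v = v.
  move=> Sv; apply/esym/eqP; rewrite -subr_eq0; apply/eqP/rdot_eq0.
  by rewrite (psdBr dK) !eO // subrr.
have he : proj e.
  split; last by apply: bop_ext => u; rewrite bopM efix.
  apply/esym/star_unique => u v.
  have h1 : rdot (e u) v = rdot (e u) (e v).
    by rewrite -[in LHS](subrK (e v) v) (psdDr dK) (psdC dK) eO // add0r.
  have h2 : rdot u (e v) = rdot (e u) (e v).
    by rewrite -[in LHS](subrK (e u) u) (psdDl dK) eO // add0r.
  by rewrite h1 h2.
have eNh (n : bop H) : inb N n -> e (h n) = h n.
  by move=> Nn; apply: efix; apply: subset_closure; exists (n : H -> H).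
have eran (u : L2M) (d : R) : 0 < d -> exists2 v, (h @` inb N) v & rdot (e u - v) (e u - v) < d.
  move=> d0; have /closure_rdotP /(_ d d0) [_ [T NT <-] hT] := eS u.
  have [a aT] := vN_bop vN NT.
  by exists (h a); [exists a => //; rewrite /inb /= aT | rewrite /h aT].
pose Q := inb (basic_construction M eta eN).
have Qe : Q e by rewrite /Q /inb /= eE.
have Qleft (x : bop H) (T : bop L2M) : inb M x ->
    (forall y, inb M y -> T (h y) = h (x * y)) -> left_action M eta T.
  move=> Mx hT; split; first exact: bop_bounded.
  exists (x : H -> H) => // y My; have [b by_] := vN_bop vM My; rewrite -by_.
  by apply: hT; rewrite /inb /= by_.
have QL (x : bop H) : inb M x -> Q (leftop hF ht hlin hdotE hdense x).
  move=> Mx; apply: subQ; left; apply: (Qleft x) => // y My; exact: leftopE.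
have Qmin (B : set (bop L2M)) : vNset B ->
    (forall x (T : bop L2M), inb M x -> (forall y, inb M y -> T (h y) = h (x * y)) -> B T) ->
    B e -> Q `<=` B.
  move=> hB Bl Be T QT.
  have [b Bb /bfun_inj <- //] : [set bfun b | b in B] T.
  apply: QT; split; first exact: vNset_vN.
  move=> X [[bX [x Mx hx]]|->]; last by exists e.
  have [a ax] := vN_bop vM Mx.
  exists (mkbop bX) => //; apply: (Bl a); first by rewrite /inb /= ax.
  by move=> y My; rewrite mkbopE /h (hx _ My) -ax.
have tnormal := is_trace_seqnormal vM M1 htauM.1.
have tQe : rtrace Tr e = 1 by rewrite /rtrace eE hTre.
have tN1 : rtrace tauN 1 = 1 by rewrite /rtrace; have [_ ->] := htauN.
have nfdN := II1_factor_nfd hN; have nfdQ := II1_factor_nfd hfin.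
have leN X P eps := @N_le_Q R H L2M _ _ _ h hF ht NA hNN N1 hlin hdotE hdense e he eNh eran
  Q hQ Q1 Qe QL Qmin tnormal hFQ _ _ htQ htN hFN tQe tN1 nfdQ nfdN X P eps.
have leQ X P eps := @Q_le_N R H L2M _ _ _ h hF ht NA hNN N1 hlin hdotE hdense e he eNh eran
  Q hQ Q1 Qe QL Qmin tnormal hFQ _ _ htQ htN hFN tQe tN1 nfdQ nfdN X P eps.
(* lambda is at least Tr e = 1, since e <= 1. *)
have l0 : 0 < lambda.
  have : rtrace Tr e <= rtrace Tr 1 by apply: (t_le1 hQ Q1 htQ).
  by rewrite tQe /rtrace hlambda /= => /(lt_le_trans ltr01).
pose tr' T : R[i] := (lambda^-1)%:C * Tr T.
have tr'E (a : bop L2M) : rtrace tr' a = lambda^-1 * rtrace Tr a by rewrite /rtrace ReZ.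
(* Each term of the cost is a product of two traces, whence the square. *)
have costE X P : cost (rtrace tr') X P = (lambda ^+ 2)^-1 * cost (rtrace Tr) X P.
  rewrite /cost mulr_sumr; apply: eq_bigr => x _; rewrite /cost1 mulr_sumr.
  apply: eq_bigr => p _; rewrite mulr_sumr; apply: eq_bigr => q _.
  by rewrite !tr'E -exprVn; ring.
have l2 : 0 < lambda ^+ 2 by rewrite exprn_gt0.
have gensQ X : gens (basic_construction M eta eN) X <-> generates Q 1 X.
  split=> -[h1 h2]; split.
  - by move=> x /h1 Qx; split; rewrite ?mul1r ?mulr1.
  - by move=> B hB XB z [Qz _ _]; exact: (h2 B).
  - by move=> x /h1 [].
  - by move=> B hB XB z Qz; apply: (h2 B) => //; split; rewrite ?mul1r ?mulr1.
(* For each inequality, an arbitrary generating list and partition on one side are transferred to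
   the other with excess [eps]. *)
apply/eqP; rewrite eq_le; apply/andP; split.
  rewrite -lee_pdivrMl //; apply: calG_ge => // Y P /gensQ gY pP.
  rewrite costE EFinM lee_pmul2l ?lte_fin ?invr_gt0 //.
  apply/lee_addgt0Pr => eps eps0; have [X [P' [gX pP' hc]]] := leN Y P eps gY pP eps0.
  apply: le_trans (calG_le vN _ gX pP') _; last by rewrite -EFinD lee_fin.
  by move=> p Np hp; exact: (t_proj_ge0 htN).
apply: calG_ge => // X P gX pP.
apply/lee_addgt0Pr => eps eps0; have [Y [P' [gY pP' hc]]] := leQ X P eps gX pP eps0.
rewrite -lee_pdivlMl //.
have /gensQ {}gY := gY.
apply: le_trans (calG_le vQ _ gY pP') _.
  by move=> p Qp hp; rewrite tr'E mulr_ge0 ?invr_ge0 ?(ltW l0) // (t_proj_ge0 htQ).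
by rewrite costE -EFinD lee_fin ler_pM2l // invr_gt0.
Qed.
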